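(* Let $\Theta\subseteq\mathbb R^m$ be bounded and let $\mathcal F=\{\phi_\theta:\theta\in\Theta\}$ be a set of potentials on $\mathbb R^d$ for which there exist constants $L,p\ge0$ with $$|\phi_\theta(x)-\phi_{\theta'}(x)|\le L\|\theta-\theta'\|\,(1+\|x\|)^p\qquad\forall\theta,\theta'\in\Theta,\ \forall x\in\mathbb R^d.$$ Let $P$ be a probability measure on $\mathbb R^d$ satisfying a Poincaré inequality ($\mathrm{Var}_P(f)\le C_{\mathtt{PI}}\int\|\nabla f\|^2dP$ for every differentiable $f$, with $C_{\mathtt{PI}}<\infty$). Assume that for some $\beta,a\ge0$ all potentials in $\mathcal F$, as well as the convex potential $\phi_0$, are $(\beta,a)$-smooth, and let $Q=(\nabla\phi_0)_\sharp P$. Let $\alpha>0$ and let $\mathcal F_\alpha$ be the set of $(\alpha,a)$-strongly convex elements of $\mathcal F$. Then there exist constants $C,q\ge0$ independent of $n$ such that for all $n\ge2$ $$\mathbb E\|\nabla\hat\phi_{\mathcal F}-\nabla\phi_0\|^2_{L^2(P)}\le C(\log n)^q\Big(\inf_{\phi\in\mathcal F_\alpha}\|\nabla\phi-\nabla\phi_0\|^2_{L^2(P)}+n^{-1}\Big).$$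
   Context: $d\ge2$. A potential here is a function $\phi:\mathbb R^d\to\mathbb R$ with $\phi(0)=0$. It is $(\beta,a)$-smooth if twice differentiable with $\|\nabla^2\phi(x)\|_{\mathrm{op}}\le\beta(1+\|x\|)^a$ for all $x$, and $(\alpha,a)$-strongly convex if $\lambda_{\min}(\nabla^2\phi(x))\ge\alpha(1+\|x\|)^a$ for all $x$ (for $a=0$ the usual notions of smoothness and strong convexity for differentiable functions may be used). From independent i.i.d. samples $X_1,\dots,X_n\sim P$, $Y_1,\dots,Y_n\sim Q$ with empirical measures $P_n,Q_n$, $\hat\phi_{\mathcal F}\in\arg\min_{\phi\in\mathcal F}\int\phi\,dP_n+\int\phi^*\,dQ_n$ is a measurable minimizer (assumed to exist), where $\phi^*(y)=\sup_x\{\langle x,y\rangle-\phi(x)\}$. *)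

(* Defs.v *)
From HB Require Import structures.
From mathcomp Require Import all_boot all_order all_algebra.
From mathcomp Require Import all_classical all_reals all_analysis.

Set Implicit Arguments.
Unset Strict Implicit.
Unset Printing Implicit Defensive.

Import Order.TTheory GRing.Theory Num.Theory.
Import numFieldNormedType.Exports.

Local Open Scope classical_set_scope.
Local Open Scope ring_scope.

(* R^d with its Borel sigma-algebra; convertible to 'rV[R]_d. *)
Definition borelrV (R : realType) (d : nat) :=
  g_sigma_algebraType (@open 'rV[R]_d).

Section euclidean.
Context {R : realType} {d : nat}.
Implicit Types (x y : 'rV[R]_d) (A : 'M[R]_d).

Definition dotrV x y : R := \sum_i x 0 i * y 0 i.

(* The library norm `|x| on 'rV[R]_d is the sup norm. *)
Definition enorm x : R := Num.sqrt (dotrV x x).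

Definition opnorm A : R := sup [set enorm (v *m A) | v in [set v | enorm v <= 1]].

(* Meaningful when A has a real eigenvalue, e.g. when A is symmetric
   and 0 < d. *)
Definition lambda_min A : R := inf [set l | eigenvalue A l].

End euclidean.

Section potentials.
Context {R : realType} {d : nat}.
Implicit Types (f phi : 'rV[R]_d -> R) (x y : 'rV[R]_d).

Definition grad f x : 'rV[R]_d := \row_i 'D_(delta_mx 0 i) f x.

(* The entry (i, j) is the derivative in direction i of the j-th partial
   derivative. *)
Definition hessian f x : 'M[R]_d := 'J (grad f) x.

Definition twice_differentiable f : Prop :=
  (forall x, differentiable f x) /\ (forall x, differentiable (grad f) x).

(* The second disjunct is the usual notion of beta-smoothness, which does not
   need second derivatives. *)
Definition smooth (beta a : R) phi : Prop :=
  (twice_differentiable phi /\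
   forall x, opnorm (hessian phi x) <= beta * (1 + enorm x) `^ a) \/
  [/\ a = 0, forall x, differentiable phi x &
      forall x y, enorm (grad phi x - grad phi y) <= beta * enorm (x - y)].

Definition strongly_convex (alpha a : R) phi : Prop :=
  (twice_differentiable phi /\
   forall x, alpha * (1 + enorm x) `^ a <= lambda_min (hessian phi x)) \/
  [/\ a = 0, forall x, differentiable phi x &
      forall x y, phi x + dotrV (grad phi x) (y - x)
                  + alpha / 2 * enorm (y - x) ^+ 2 <= phi y].

Definition potential phi : Prop := phi 0 = 0.

Definition conjugate phi y : \bar R :=
  ereal_sup [set (dotrV x y - phi x)%:E | x in setT].

End potentials.

Section empirical_measure.
Context d (T : measurableType d) (R : realType) (n : nat) (x : 'I_n -> T).
Local Open Scope ereal_scope.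

Definition empirical (A : set T) : \bar R :=
  (n%:R^-1)%:E * \sum_(i < n) \d_(x i) A.

Let empiricalE : empirical =
  mscale ((n%:R^-1)%:nng : {nonneg R})%R (msum (fun k => \d_(nth point (codom x) k)) n).
Proof.
apply/funext => A; rewrite /empirical /mscale/=; congr (_ * _).
apply: eq_bigr => i _; suff -> : nth point (codom x) i = x i by [].
have -> : val i = enum_rank i by rewrite enum_rank_ord.
by rewrite nth_codom enum_rankK.
Qed.

Let empirical0 : empirical set0 = 0.
Proof. by rewrite empiricalE measure0. Qed.

Let empirical_ge0 A : 0 <= empirical A.
Proof. by rewrite empiricalE measure_ge0. Qed.

Let empirical_sigma_additive : semi_sigma_additive empirical.
Proof. rewrite empiricalE; exact: measure_semi_sigma_additive. Qed.

HB.instance Definition _ := isMeasure.Build _ _ _ empirical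
  empirical0 empirical_ge0 empirical_sigma_additive.

End empirical_measure.
Arguments empirical {d T R n}.

Section statistics.
Context {R : realType} {d : nat}.
Local Open Scope ereal_scope.
Implicit Types (P : probability (borelrV R d) R) (phi : 'rV[R]_d -> R).

(* The library variance 'V_P[f] is +oo when f is not square integrable. *)
Definition poincare P : Prop :=
  exists2 CPI : R, (0 <= CPI)%R &
    forall f : 'rV[R]_d -> R, (forall x, differentiable f x) ->
      'V_P[f] <= CPI%:E * \int[P]_x (enorm (grad f x) ^+ 2)%:E.

(* || grad phi - grad psi ||^2 in L^2(P) *)
Definition grad_dist2 P phi psi : \bar R :=
  \int[P]_x (enorm (grad phi x - grad psi x) ^+ 2)%:E.

Definition semidual (P Q : {measure set (borelrV R d) -> \bar R}) phi : \bar R :=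
  \int[P]_x (phi x)%:E + \int[Q]_y conjugate phi y.

End statistics.

Definition mutually_independent {R : realType} {dO dT : measure_display}
    {Om : measurableType dO} {T : measurableType dT} {I : finType}
    (Pr : probability Om R) (X : I -> Om -> T) : Prop :=
  forall (J : {set I}) (A : I -> set T), (forall i, measurable (A i)) ->
    Pr (\bigcap_(i in [set` J]) (X i @^-1` A i)) =
    (\prod_(i in J) Pr (X i @^-1` A i))%E.

Definition has_law {R : realType} {dO dT : measure_display}
    {Om : measurableType dO} {T : measurableType dT}
    (Pr : probability Om R) (X : Om -> T) (mu : probability T R) : Prop :=
  measurable_fun setT X /\
  forall A, measurable A -> pushforward Pr X A = mu A.

(* X_1, ..., X_n i.i.d. of law P and Y_1, ..., Y_n i.i.d. of law Q, the two
   samples being independent of each other. *)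
Definition iid_samples {R : realType} {dO dT : measure_display}
    {Om : measurableType dO} {T : measurableType dT} {n : nat}
    (Pr : probability Om R) (P Q : probability T R)
    (X Y : 'I_n -> Om -> T) : Prop :=
  [/\ forall i, has_law Pr (X i) P, forall i, has_law Pr (Y i) Q &
      mutually_independent Pr
        (fun k : 'I_n + 'I_n => match k with inl i => X i | inr j => Y j end)].

(* Measurability of the random function phihat is with respect to the
   product sigma-algebra on functions, that is, of each evaluation. *)
Definition measurable_minimizer {R : realType} {d n : nat}
    {dO : measure_display} {Om : measurableType dO}
    (F : set ('rV[R]_d -> R)) (X Y : 'I_n -> Om -> borelrV R d)
    (phihat : Om -> 'rV[R]_d -> R) : Prop :=
  (forall x, measurable_fun setT (fun w => phihat w x)) /\
  forall w,
    let objective := semidual (empirical (X ^~ w)) (empirical (Y ^~ w)) in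
    F (phihat w) /\ forall phi, F phi -> (objective (phihat w) <= objective phi)%E.

(* Main.v *)
Require Import Defs.
From HB Require Import structures.
From mathcomp Require Import all_boot all_order all_algebra.
From mathcomp Require Import all_classical all_reals all_analysis.
From mathcomp Require Import measurable_realfun zify ring lra.

Set Implicit Arguments.
Unset Strict Implicit.
Unset Printing Implicit Defensive.

Import Order.TTheory GRing.Theory Num.Theory.
Import numFieldNormedType.Exports.

Local Open Scope classical_set_scope.
Local Open Scope ring_scope.

(** The semidual objective S(phi) = P phi + Q phi^* is minimized at phi0, because Q is
    the image of P by grad phi0 and phi0 is convex.  Its excess at phi is the
    integral under P of Fenchel's defect phi(x) + phi^*(y) - <x, y> at y = grad phi0 x.
    Smoothness of phi alone, convex or not, bounds the defect below by a multiple of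
    |grad phi(x) - grad phi0(x)|^2 (grad_dist_le_gap: test the conjugate at the point
    reached from x by a small step towards y - grad phi(x)); strong convexity bounds it
    above in the same way (strongly_convex_conj_le).  So the excess is equivalent to the
    squared distance, up to a factor polynomial in |x|.

    Poincare's inequality, applied to the powers of the coordinates, gives P
    subexponential moments (coord_moments).  Everything can thus be restricted to a ball of
    radius r = O(log n), on which polynomial factors are powers of log n and outside of
    which all moments are smaller than any power of n (tail_moment).  The conjugates, which
    may be infinite, are replaced by suprema over that ball; this is harmless, as a lower
    bound is all that is asked of the objective at the minimizer.

    The rate 1/n comes from a self-bounding variance.  For f = phi - phi0, Poincare's
    inequality bounds the variance of f(X) by the squared distance of the gradients, hence
    by the excess.  At y = grad phi0 x, the difference of the conjugates at y equals the
    defect minus f(x) (centredQ_grad), and the second moment of the defect is at most its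
    supremum on the ball times its mean.  Hence both empirical terms have a variance at
    most a power of log n times the excess, and Chernoff's bound shows that the empirical
    excess is at least half of the excess up to O(polylog / n) (concentration).  A union
    bound over a net of O(n^m) parameters makes this uniform.

    On this event, of probability 1 - O(n^-2), the excess of the minimizer is at most twice
    the empirical excess of any strongly convex competitor psi, whose mean is at most a
    multiple of the squared distance from psi to phi0 (oracle_inequality).  Collecting the
    powers of log n gives the theorem. *)

(** * Euclidean geometry of row vectors *)

Section euclid.
Context {R : realType} {d : nat}.
Implicit Types (x y z : 'rV[R]_d) (a : R).

Lemma dotrVC x y : dotrV x y = dotrV y x.
Proof. by apply: eq_bigr => i _; rewrite mulrC. Qed.

Lemma dotrVDl x y z : dotrV (x + y) z = dotrV x z + dotrV y z.
Proof. by rewrite -big_split; apply: eq_bigr => i _; rewrite !mxE mulrDl. Qed.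

Lemma dotrVZl a x y : dotrV (a *: x) y = a * dotrV x y.
Proof. by rewrite mulr_sumr; apply: eq_bigr => i _; rewrite !mxE mulrA. Qed.

Lemma dotrVDr x y z : dotrV x (y + z) = dotrV x y + dotrV x z.
Proof. by rewrite dotrVC dotrVDl !(dotrVC x). Qed.

Lemma dotrVZr a x y : dotrV x (a *: y) = a * dotrV x y.
Proof. by rewrite dotrVC dotrVZl dotrVC. Qed.

Lemma dotrVNl x y : dotrV (- x) y = - dotrV x y.
Proof. by rewrite -scaleN1r dotrVZl mulN1r. Qed.

Lemma dotrVNr x y : dotrV x (- y) = - dotrV x y.
Proof. by rewrite -scaleN1r dotrVZr mulN1r. Qed.

Lemma dotrVBl x y z : dotrV (x - y) z = dotrV x z - dotrV y z.
Proof. by rewrite dotrVDl dotrVNl. Qed.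

Lemma dotrVBr x y z : dotrV x (y - z) = dotrV x y - dotrV x z.
Proof. by rewrite dotrVDr dotrVNr. Qed.

Lemma dotrV0l x : dotrV 0 x = 0.
Proof. by rewrite -(scale0r 0) dotrVZl mul0r. Qed.

Lemma dotrV0r x : dotrV x 0 = 0.
Proof. by rewrite dotrVC dotrV0l. Qed.

Lemma dotrVv_ge0 x : 0 <= dotrV x x.
Proof. by apply: sumr_ge0 => i _; rewrite -expr2 sqr_ge0. Qed.

Lemma enorm_ge0 x : 0 <= enorm x.
Proof. exact: sqrtr_ge0. Qed.

Lemma enorm_sqr x : enorm x ^+ 2 = dotrV x x.
Proof. by rewrite sqr_sqrtr// dotrVv_ge0. Qed.

Lemma enorm0 : enorm (0 : 'rV[R]_d) = 0.
Proof. by rewrite /enorm dotrV0l sqrtr0. Qed.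

Lemma enormZ a x : enorm (a *: x) = `|a| * enorm x.
Proof.
by rewrite /enorm dotrVZl dotrVZr mulrA -expr2 sqrtrM ?sqr_ge0// sqrtr_sqr.
Qed.

Lemma enormN x : enorm (- x) = enorm x.
Proof. by rewrite -scaleN1r enormZ normrN1 mul1r. Qed.

Lemma enormB x y : enorm (x - y) = enorm (y - x).
Proof. by rewrite -enormN opprB. Qed.

Lemma coord_le_enorm x i : `|x 0 i| <= enorm x.
Proof.
rewrite -(ler_pXn2r (ltn0Sn 1)) ?nnegrE ?enorm_ge0// enorm_sqr.
rewrite real_normK ?num_real// /dotrV (bigD1 i)//= expr2 lerDl.
by apply: sumr_ge0 => j _; rewrite -expr2 sqr_ge0.
Qed.

Lemma enorm_eq0 x : enorm x = 0 -> x = 0.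
Proof.
move=> x0; apply/rowP => i; rewrite mxE; apply/eqP; rewrite -normr_le0.
by rewrite -x0 coord_le_enorm.
Qed.

Lemma cauchy_schwarz x y : dotrV x y <= enorm x * enorm y.
Proof.
have [y0|y0] := eqVneq (enorm y) 0.
  by rewrite (enorm_eq0 y0) dotrV0r enorm0 mulr0.
have yp : 0 < enorm y by rewrite lt_def y0 enorm_ge0.
have [x0|x0] := eqVneq (enorm x) 0.
  by rewrite (enorm_eq0 x0) dotrV0l enorm0 mul0r.
have xp : 0 < enorm x by rewrite lt_def x0 enorm_ge0.
have := dotrVv_ge0 (enorm y *: x - enorm x *: y).
rewrite dotrVBl !dotrVBr !dotrVZl !dotrVZr (dotrVC y x) -!enorm_sqr => H.
have : 0 <= (enorm x * enorm y) * (enorm x * enorm y - dotrV x y) *+ 2.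
  apply: (le_trans H); rewrite le_eqVlt; apply/orP; left; apply/eqP; ring.
by rewrite pmulrn_lge0// pmulr_rge0 ?mulr_gt0// subr_ge0.
Qed.

Lemma normr_dotrV x y : `|dotrV x y| <= enorm x * enorm y.
Proof.
by rewrite ler_norml cauchy_schwarz lerNl -dotrVNl -(enormN x) cauchy_schwarz.
Qed.

Lemma ler_enormD x y : enorm (x + y) <= enorm x + enorm y.
Proof.
rewrite -(ler_pXn2r (ltn0Sn 1)) ?nnegrE ?addr_ge0 ?enorm_ge0//.
rewrite enorm_sqr dotrVDl !dotrVDr sqrrD -!enorm_sqr (dotrVC y x).
have := cauchy_schwarz x y; lra.
Qed.

Lemma ler_enormB x y : enorm (x - y) <= enorm x + enorm y.
Proof. by rewrite -(enormN y) ler_enormD. Qed.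

Lemma norm_le_enorm x : `|x| <= enorm x.
Proof.
rewrite [leLHS]/Num.norm/= mx_normrE; apply/bigmax_leP; split=> [|[i j] _].
  exact: enorm_ge0.
by rewrite /= (ord1 i) coord_le_enorm.
Qed.

Lemma coord_le_norm x i : `|x 0 i| <= `|x|.
Proof.
rewrite [leRHS]/Num.norm/= mx_normrE; apply/bigmax_geP; right => /=.
by exists (0, i).
Qed.

Lemma enorm_le_norm x : enorm x <= d%:R * `|x|.
Proof.
have : enorm x <= \sum_i `|x 0 i|.
  have {1}-> : x = \sum_i x 0 i *: delta_mx 0 i by exact: row_sum_delta.
  apply: (@le_trans _ _ (\sum_i enorm (x 0 i *: delta_mx 0 i : 'rV[R]_d))).
    elim/big_ind2 : _ => [|? ? ? ? h1 h2|//]; first by rewrite enorm0.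
    by rewrite (le_trans (ler_enormD _ _))// lerD.
  apply: ler_sum => i _; rewrite enormZ ler_piMr// /enorm.
  suff -> : dotrV (delta_mx 0 i : 'rV[R]_d) (delta_mx 0 i) = 1 by rewrite sqrtr1.
  rewrite /dotrV (bigD1 i)//= !mxE !eqxx/= mulr1 big1 ?addr0// => j ji.
  by rewrite !mxE (negbTE ji) mulr0.
move=> /le_trans; apply.
apply: (@le_trans _ _ (\sum_(i < d) `|x|)).
  by apply: ler_sum => i _; exact: coord_le_norm.
by rewrite sumr_const card_ord mulr_natl.
Qed.

Lemma dotrV_continuous y : continuous (dotrV ^~ y : 'rV[R]_d -> R).
Proof.
apply: continuous_big => [|i _]; first exact: add_continuous.
by move=> x; apply: continuousM; [exact: coord_continuous|exact: cst_continuous].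
Qed.

Lemma enorm_continuous : continuous (enorm : 'rV[R]_d -> R).
Proof.
move=> x; apply: (continuous_comp (f := fun x : 'rV[R]_d => dotrV x x)
  (g := Num.sqrt)); last exact: sqrt_continuous.
move: x; apply: continuous_big => [|i _]; first exact: add_continuous.
by move=> x; apply: continuousM; exact: coord_continuous.
Qed.

End euclid.

(** * Differential calculus *)

Section gradient.
Context {R : realType} {d : nat}.
Implicit Types (f : 'rV[R]_d -> R) (x y u v : 'rV[R]_d).

Lemma derive_grad f x v : differentiable f x -> 'D_v f x = dotrV (grad f x) v.
Proof.
move=> df; rewrite deriveE// {1}(row_sum_delta v) linear_sum /dotrV.
by apply: eq_bigr => i _; rewrite linearZ/= !mxE deriveE// mulrC.
Qed.

Lemma differentiable_dotrV (g : 'rV[R]_d -> 'rV[R]_d) u x :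
  differentiable g x -> differentiable (fun y => dotrV (g y) u) x.
Proof.
move=> dg.
have lin : linear (dotrV ^~ u : 'rV[R]_d -> R).
  by move=> c y z; rewrite dotrVDl dotrVZl.
pose linM := GRing.isLinear.Build _ _ _ _ _ lin.
pose L : {linear 'rV[R]_d -> R} := HB.pack (dotrV ^~ u : 'rV[R]_d -> R) linM.
rewrite -[fun _ => _]/(L \o g); apply: differentiable_comp => //.
exact/linear_differentiable/dotrV_continuous.
Qed.

Lemma derive_dotrV (g : 'rV[R]_d -> 'rV[R]_d) u v x :
  differentiable g x -> 'D_v (fun y => dotrV (g y) u) x = dotrV (v *m 'J g x) u.
Proof.
move=> dg; rewrite -deriveEjacobian//.
have lin : linear (dotrV ^~ u : 'rV[R]_d -> R).
  by move=> c y z; rewrite dotrVDl dotrVZl.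
pose linM := GRing.isLinear.Build _ _ _ _ _ lin.
pose L : {linear 'rV[R]_d -> R} := HB.pack (dotrV ^~ u : 'rV[R]_d -> R) linM.
rewrite deriveE; last exact: differentiable_dotrV.
rewrite -[fun _ => _]/(L \o g) diff_comp//; last first.
  exact/linear_differentiable/dotrV_continuous.
rewrite /= (@diff_lin _ _ _ L); first by rewrite deriveE.
exact: dotrV_continuous.
Qed.

Lemma is_derive_line f x v (t : R) : differentiable f (x + t *: v) ->
  is_derive t 1 (fun s => f (x + s *: v)) ('D_v f (x + t *: v)).
Proof.
move=> df; have dvf := @diff_derivable _ _ _ f _ v df.
have E h : f (h *: v + (x + t *: v)) = f (x + (h + t) *: v).
  by rewrite scalerDl addrCA addrC -addrA (addrC (t *: v)).
have F : (fun h : R => h^-1 *: (f (x + (h *: 1 + t) *: v) - f (x + t *: v)))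
    = (fun h => h^-1 *: (f (h *: v + (x + t *: v)) - f (x + t *: v))).
  by apply/funext => h; rewrite [_ *: 1]mulr1 E.
by apply: DeriveDef; rewrite ?/derivable ?/derive /= F.
Qed.

Lemma mvt_line f x v : (forall y, differentiable f y) ->
  exists2 c : R, 0 <= c <= 1 & f (x + v) - f x = 'D_v f (x + c *: v).
Proof.
move=> df.
have := @MVT_segment R (fun s => f (x + s *: v)) (fun t => 'D_v f (x + t *: v)) 0 1.
case=> //.
- by move=> t _; exact: is_derive_line.
- apply: derivable_within_continuous => t _.
  by have [] := is_derive_line (df (x + t *: v)).
- move=> c; rewrite in_itv/= => c01.
  by rewrite scale1r scale0r addr0 subr0 mulr1 => E; exists c.
Qed.

Lemma mvt_grad f x v : (forall y, differentiable f y) ->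
  exists2 c : R, 0 <= c <= 1 & f (x + v) - f x = dotrV (grad f (x + c *: v)) v.
Proof.
by move=> df; have [c c01 ->] := mvt_line x v df; exists c => //; rewrite derive_grad.
Qed.

Lemma mvt_jacobian (g : 'rV[R]_d -> 'rV[R]_d) x u v :
  (forall y, differentiable g y) -> exists2 c : R, 0 <= c <= 1 &
    dotrV (g (x + v) - g x) u = dotrV (v *m 'J g (x + c *: v)) u.
Proof.
move=> dg.
have := @mvt_line (fun y => dotrV (g y) u) x v.
case=> [y|c c01]; first exact: differentiable_dotrV.
by rewrite -dotrVBl derive_dotrV// => ->; exists c.
Qed.

End gradient.

Section operator_norm.
Context {R : realType} {d : nat}.
Implicit Types (A : 'M[R]_d) (v : 'rV[R]_d).

Lemma opnormP A v : enorm (v *m A) <= opnorm A * enorm v.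
Proof.
have bnd w : enorm (w *m A) <= enorm w * \sum_i enorm (row i A).
  rewrite mulmx_sum_row mulr_sumr.
  apply: (@le_trans _ _ (\sum_i enorm (w 0 i *: row i A))).
    elim/big_ind2 : _ => [|? ? ? ? h1 h2|//]; first by rewrite enorm0.
    by rewrite (le_trans (ler_enormD _ _))// lerD.
  apply: ler_sum => i _; rewrite enormZ ler_wpM2r ?enorm_ge0//.
  exact: coord_le_enorm.
have [v0|v0] := eqVneq (enorm v) 0.
  by rewrite (enorm_eq0 v0) mul0mx enorm0 mulr0.
have vp : 0 < enorm v by rewrite lt_def v0 enorm_ge0.
rewrite -ler_pdivrMr//; apply: sup_upper_bound => /=.
  split; first by exists (enorm (0 *m A)), 0 => //=; rewrite enorm0.
  exists (\sum_i enorm (row i A)) => _ [w /= w1 <-].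
  by rewrite (le_trans (bnd w))// ler_piMl// sumr_ge0// => i _; exact: enorm_ge0.
exists ((enorm v)^-1 *: v) => /=.
  by rewrite enormZ ger0_norm ?invr_ge0 ?enorm_ge0// mulVf.
by rewrite -scalemxAl enormZ ger0_norm ?invr_ge0 ?enorm_ge0// mulrC.
Qed.

End operator_norm.

Section first_order.
Context {R : realType}.

Lemma differentiable_error (V W : normedModType R) (f : V -> W) (x : V) (e : R) :
  differentiable f x -> 0 < e -> exists2 del : R, 0 < del &
    forall w, `|w| < del -> `|f (x + w) - f x - 'd f x w| <= e * `|w|.
Proof.
move=> df e0.
have /eqaddoP := diff_locally df.
move=> /(_ e e0)/nbhs_ballP[del /= del0 H].
exists del => // w wd; have := H w.
rewrite -ball_normE /= sub0r normrN => /(_ wd).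
by rewrite !fctE /= opprD addrA (addrC w).
Qed.

End first_order.

Section smoothness.
Context {R : realType} {d : nat}.
Implicit Types (f phi : 'rV[R]_d -> R) (x y u v : 'rV[R]_d).

Lemma powR_le_expn (s a : R) (A : nat) : 1 <= s -> a <= A%:R -> s `^ a <= s ^+ A.
Proof.
by move=> s1 aA; rewrite -powR_mulrn ?(le_trans ler01)// ler_powR.
Qed.

Lemma smooth_differentiable beta a phi : smooth beta a phi ->
  forall x, differentiable phi x.
Proof. by case=> [[[]]|[]]. Qed.

(** Both notions of smoothness reduce to this local Lipschitz bound; under a bound
    on the Hessian, the increment of the gradient is tested against itself in the
    mean value theorem. *)
Lemma smooth_grad_lipschitz beta a (A : nat) phi : 0 <= beta -> a <= A%:R ->
  smooth beta a phi -> forall x v, enorm (grad phi (x + v) - grad phi x)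
     <= beta * (1 + enorm x + enorm v) ^+ A * enorm v.
Proof.
move=> beta0 aA [[[df dg] H]|[a0 df H]] x v; last first.
  rewrite (le_trans (H _ _))// (addrC x) addrK ler_wpM2r ?enorm_ge0//.
  by rewrite ler_peMr// exprn_ege1// -addrA lerDl addr_ge0// enorm_ge0.
set K := beta * _; set u := grad phi (x + v) - grad phi x.
have [c /andP[c0 c1] E] := mvt_jacobian x u v dg.
have le_opnorm : opnorm (hessian phi (x + c *: v)) <= K.
  apply: (le_trans (H _)); apply: ler_wpM2l => //.
  apply: (@le_trans _ _ ((1 + enorm (x + c *: v)) ^+ A)).
    by apply: powR_le_expn => //; rewrite lerDl enorm_ge0.
  apply: lerXn2r; rewrite ?nnegrE ?addr_ge0 ?enorm_ge0//.
  rewrite -addrA lerD2l (le_trans (ler_enormD _ _))// lerD2l enormZ ger0_norm//.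
  by rewrite ler_piMl// enorm_ge0.
have : enorm u * enorm u <= K * enorm v * enorm u.
  rewrite -expr2 enorm_sqr {1}/u E (le_trans (cauchy_schwarz _ _))//.
  rewrite ler_wpM2r ?enorm_ge0// (le_trans (opnormP _ _))//.
  by rewrite ler_wpM2r ?enorm_ge0.
have [u0|u0] := eqVneq (enorm u) 0.
  move=> _; rewrite u0 mulr_ge0 ?enorm_ge0// mulr_ge0// exprn_ge0//.
  by rewrite !addr_ge0 ?enorm_ge0.
by rewrite ler_pM2r// lt_def u0 enorm_ge0.
Qed.

Lemma smooth_grad_continuous beta a phi : smooth beta a phi ->
  continuous (grad phi).
Proof.
move=> [[[_ dg] _]|[_ _ H]] x; first exact/differentiable_continuous.
have FF : Filter (nbhs x) by exact: nbhs_filter.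
apply/(@cvgrPdist_lt _ _ _ (nbhs x) FF) => e e0; set K := (`|beta| + 1) * d%:R + 1.
have K0 : 0 < K by rewrite ltr_wpDl// mulr_ge0 ?addr_ge0.
apply/nbhs_ballP; exists (e / K) => /=; first by rewrite divr_gt0.
move=> y; rewrite -ball_normE/= ltr_pdivlMr// => xy.
apply: (le_lt_trans (norm_le_enorm _)); apply: (le_lt_trans (H _ _)).
apply: le_lt_trans xy.
apply: (@le_trans _ _ ((`|beta| + 1) * (d%:R * `|x - y|))).
  apply: (@le_trans _ _ ((`|beta| + 1) * enorm (x - y))).
    by rewrite ler_wpM2r ?enorm_ge0// (le_trans (ler_norm _))// lerDl.
  by rewrite ler_wpM2l ?addr_ge0//; exact: enorm_le_norm.
by rewrite mulrA mulrC ler_wpM2l// lerDl.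
Qed.

Lemma smooth_taylor beta a (A : nat) phi : 0 <= beta -> a <= A%:R ->
  smooth beta a phi -> forall x v,
  `|phi (x + v) - phi x - dotrV (grad phi x) v|
     <= beta * (1 + enorm x + enorm v) ^+ A * enorm v ^+ 2.
Proof.
move=> beta0 aA sm x v.
have [c /andP[c0 c1] ->] := mvt_grad x v (smooth_differentiable sm).
rewrite -dotrVBl (le_trans (normr_dotrV _ _))// expr2 mulrA.
rewrite ler_wpM2r ?enorm_ge0// (le_trans (smooth_grad_lipschitz beta0 aA sm _ _))//.
have le_cv : enorm (c *: v) <= enorm v.
  by rewrite enormZ ger0_norm// ler_piMl// enorm_ge0.
rewrite ler_pM ?enorm_ge0 ?mulr_ge0 ?exprn_ge0 ?addr_ge0 ?enorm_ge0//.
rewrite ler_wpM2l// lerXn2r ?nnegrE ?addr_ge0 ?enorm_ge0//.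
by rewrite lerD2l.
Qed.

End smoothness.

Section schwarz.
Context {R : realType} {d : nat}.
Implicit Types (phi : 'rV[R]_d -> R) (x y u v : 'rV[R]_d).

(** The mean value theorem in the direction u leaves a difference of gradients at
    two points within O(h) of x, where the gradient is affine up to o(h). *)
Lemma second_difference phi x u v (e : R) : twice_differentiable phi -> 0 < e ->
  exists2 del : R, 0 < del & forall h, 0 < h < del ->
  `|phi (x + h *: u + h *: v) - phi (x + h *: u) - phi (x + h *: v) + phi x
    - h ^+ 2 * dotrV (v *m hessian phi x) u|
  <= 2 * d%:R * e * (enorm u + enorm v) * enorm u * h ^+ 2.
Proof.
move=> [df dg] e0; have [del del0 H] := differentiable_error (dg x) e0.
set s := enorm u + enorm v + 1.
have uv0 : 0 <= enorm u + enorm v by rewrite addr_ge0 ?enorm_ge0.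
have s0 : 0 < s by rewrite ltr_wpDl.
exists (del / s); first by rewrite divr_gt0.
move=> h /andP[h0 hd].
pose G (t : R) := phi (x + h *: v + t *: (h *: u)) - phi (x + t *: (h *: u)).
pose dG (t : R) := dotrV (grad phi (x + h *: v + t *: (h *: u))
               - grad phi (x + t *: (h *: u))) (h *: u).
have GdG (t : R) : is_derive t 1 G (dG t).
  rewrite /dG dotrVBl -!derive_grad//.
  by apply: is_deriveB; exact: is_derive_line.
have cG : {within `[0, 1], continuous G}.
  by apply: derivable_within_continuous => t _; have [] := GdG t.
have [c] := MVT_segment ler01 (fun t _ => GdG t) cG.
rewrite in_itv/= => /andP[c0 c1].
rewrite /G !scale1r !scale0r !addr0 subr0 mulr1 => E.
have -> : phi (x + h *: u + h *: v) - phi (x + h *: u) - phi (x + h *: v) + phi x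
    = dG c by rewrite -E (addrAC x (h *: v)); ring.
pose r w := grad phi (x + w) - grad phi x - w *m hessian phi x.
have rP w : `|w| < del -> enorm (r w) <= d%:R * e * `|w|.
  move=> wd; rewrite (le_trans (enorm_le_norm _))// -mulrA ler_wpM2l//.
  by have := H w wd; rewrite /r /hessian /jacobian mul_rV_lin1.
have small w : enorm w <= h * (enorm u + enorm v) ->
    enorm (r w) <= d%:R * e * (h * (enorm u + enorm v)).
  move=> wh; have wn := le_trans (norm_le_enorm w) wh.
  apply: (le_trans (rP w _)).
    apply: (le_lt_trans wn); apply: (@le_lt_trans _ _ (h * s)).
      by rewrite ler_wpM2l ?lerDl// ltW.
    by rewrite -ltr_pdivlMr.
  by rewrite ler_wpM2l// mulr_ge0// ltW.
have e1 : enorm (c *: (h *: u)) <= h * enorm u.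
  by rewrite !enormZ ger0_norm// (gtr0_norm h0) ler_piMl// mulr_ge0 ?enorm_ge0// ltW.
have s1 := small (c *: (h *: u)).
have s2 := small (h *: v + c *: (h *: u)).
have -> : dG c - h ^+ 2 * dotrV (v *m hessian phi x) u
    = h * dotrV (r (h *: v + c *: (h *: u)) - r (c *: (h *: u))) u.
  rewrite /dG /r !dotrVZr !dotrVBl mulmxDl -!scalemxAl !dotrVDl !dotrVZl -!addrA.
  ring.
rewrite normrM gtr0_norm//.
rewrite (_ : 2 * _ * _ * _ * _ * _ = h * (2 * (d%:R * e * (h * (enorm u + enorm v))) * enorm u)); last by ring.
rewrite ler_pM2l// (le_trans (normr_dotrV _ _))// ler_wpM2r ?enorm_ge0//.
rewrite (le_trans (ler_enormB _ _))// mulr_natl mulr2n lerD//.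
  apply: s2; rewrite (le_trans (ler_enormD _ _))// mulrDr addrC lerD//.
  by rewrite enormZ gtr0_norm.
by apply: s1; rewrite (le_trans e1)// ler_wpM2l ?lerDl ?enorm_ge0// ltW.
Qed.

(** Both orders of differentiation are limits of the same second difference
    quotient. *)
Lemma hessian_sym phi x u v : twice_differentiable phi ->
  dotrV (u *m hessian phi x) v = dotrV (v *m hessian phi x) u.
Proof.
move=> dphi; apply/eqP; rewrite -subr_eq0 -normr_le0; apply/ler_addgt0Pl => e e0.
rewrite addr0.
set K := 2 * d%:R * (enorm u + enorm v) * (enorm u + enorm v) + 1.
have K0 : 0 < K by rewrite ltr_wpDl// !mulr_ge0 ?addr_ge0 ?enorm_ge0.
have eK : 0 < e / K by rewrite divr_gt0.
have [d1 d10 H1] := second_difference x u v dphi eK.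
have [d2 d20 H2] := second_difference x v u dphi eK.
pose h := Num.min d1 d2 / 2.
have m0 : 0 < Num.min d1 d2 by rewrite lt_min d10.
have h0 : 0 < h by rewrite divr_gt0.
have hm : h < Num.min d1 d2 by rewrite ltr_pdivrMr// ltr_pMr// ltr1n.
have /H1 {}H1 : 0 < h < d1 by rewrite h0 (lt_le_trans hm)// ge_min lexx.
have /H2 {}H2 : 0 < h < d2 by rewrite h0 (lt_le_trans hm)// ge_min lexx orbT.
have hh : 0 < h ^+ 2 by rewrite exprn_gt0.
rewrite -(ler_pM2l hh) -[X in X * `|_|](gtr0_norm hh) -normrM.
set a := dotrV (u *m _) v; set b := dotrV (v *m _) u.
move: H1 H2; rewrite -/a -/b (addrAC x (h *: v) (h *: u)).
set D := phi (x + h *: u + h *: v).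
set D1 := D - _ - _ + _ => H1; set D2 := D - _ - _ + _ => H2.
have DD : D1 = D2 by rewrite /D1 /D2; ring.
rewrite (_ : h ^+ 2 * (a - b) = (D1 - h ^+ 2 * b) - (D2 - h ^+ 2 * a)); last first.
  by rewrite DD; ring.
rewrite (le_trans (ler_normB _ _))// (le_trans (lerD H1 H2))//.
rewrite (addrC (enorm v)) -mulrDl mulrC ler_wpM2l ?(ltW hh)//.
rewrite -mulrDr; apply: (@le_trans _ _ ((K - 1) * (e / K))).
  rewrite le_eqVlt; apply/orP; left; apply/eqP; set z := e / K; rewrite /K.
  by set S := enorm u + enorm v; ring.
rewrite mulrBl mul1r mulrC divfK ?gt_eqF// gerBl.
exact: ltW.
Qed.

End schwarz.

Section convexity.
Context {R : realType} {d : nat}.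
Implicit Types (phi : 'rV[R]_d -> R) (x y u v : 'rV[R]_d) (A : 'M[R]_d).

Lemma mulmx_dotrV_continuous A : continuous (fun v : 'rV[R]_d => dotrV (v *m A) v).
Proof.
apply: continuous_big => [|i _]; first exact: add_continuous.
move=> x; apply: continuousM; last exact: coord_continuous.
rewrite (_ : (fun v : 'rV[R]_d => (v *m A) 0 i) =
  fun v => \sum_j v 0 j * A j i); last by apply/funext => v; rewrite mxE.
move: x; apply: continuous_big => [|j _]; first exact: add_continuous.
by move=> x; apply: continuousM; [exact: coord_continuous|exact: cst_continuous].
Qed.

(** The minimum of the quadratic form of a symmetric matrix over the unit
    sphere is attained at an eigenvector, so that it bounds the smallest
    eigenvalue from above. *)
Lemma lambda_min_le A v : (0 < d)%N ->
  (forall u w, dotrV (u *m A) w = dotrV (w *m A) u) ->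
  lambda_min A * enorm v ^+ 2 <= dotrV (v *m A) v.
Proof.
move=> d0 symA; pose S := [set w : 'rV[R]_d | enorm w = 1].
have S0 : S !=set0.
  exists (delta_mx 0 (Ordinal d0)); rewrite /S/= /enorm.
  rewrite /dotrV (bigD1 (Ordinal d0))//= !mxE !eqxx/= mulr1 big1 ?addr0 ?sqrtr1//.
  by move=> j ji; rewrite !mxE (negbTE ji) mulr0.
have cS : compact S.
  apply: bounded_closed_compact.
    exists 1; split=> // M M1 w /= w1; rewrite (le_trans (norm_le_enorm w))//.
    by rewrite w1 ltW.
  rewrite (_ : S = enorm @^-1` [set 1])//.
  by apply: closed_comp => [w _|]; [exact: enorm_continuous|exact: closed_eq].
have [v0 /set_mem v0S v0min] : exists2 c, c \in S &
    forall t, t \in S -> dotrV (c *m A) c <= dotrV (t *m A) t.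
  apply: (EVT_min_rV S0 cS (f := fun v => dotrV (v *m A) v)).
  by apply: continuous_subspaceT => w; exact: mulmx_dotrV_continuous.
set l := dotrV (v0 *m A) v0 in v0min.
have lP w : l * enorm w ^+ 2 <= dotrV (w *m A) w.
  have [w0|w0] := eqVneq (enorm w) 0.
    by rewrite w0 (enorm_eq0 w0) mul0mx dotrV0l expr0n mulr0.
  have wp : 0 < enorm w by rewrite lt_def w0 enorm_ge0.
  have := v0min ((enorm w)^-1 *: w).
  rewrite inE /S/= enormZ ger0_norm ?invr_ge0 ?enorm_ge0// mulVf// => /(_ erefl).
  by rewrite -scalemxAl dotrVZl dotrVZr mulrA -expr2 exprVn ler_pdivlMl ?exprn_gt0// mulrC.
have el : eigenvalue A l.
  apply/eigenvalueP; exists v0; last first.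
    by apply/eqP => v00; move: v0S; rewrite /S/= v00 enorm0 => /eqP; rewrite eq_sym oner_eq0.
  (* v0 minimizes the nonnegative form w |-> <w A, w> - l |w|^2, hence is critical. *)
  apply/eqP; rewrite -subr_eq0; apply/eqP/enorm_eq0.
  set w := v0 *m A - l *: v0; have wE : v0 *m A = w + l *: v0 by rewrite subrK.
  clearbody w.
  set b := dotrV (w *m A) w - l * dotrV w w.
  have b0 : 0 <= b by rewrite subr_ge0 -enorm_sqr.
  have v01 : dotrV v0 v0 = 1 by rewrite -enorm_sqr v0S expr1n.
  have ww : dotrV (v0 *m A) w = dotrV w w + l * dotrV v0 w.
    by rewrite wE dotrVDl dotrVZl.
  have key t : 0 <= t * (dotrV w w *+ 2) + t ^+ 2 * b.
    have := lP (v0 + t *: w); rewrite enorm_sqr mulmxDl -!scalemxAl.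
    rewrite !(dotrVDl, dotrVDr, dotrVZl, dotrVZr) (symA w v0) ww v01 -/l -subr_ge0.
    move/le_trans; apply; rewrite le_eqVlt; apply/orP; left; apply/eqP.
    rewrite /b (dotrVC w v0); ring.
  apply/eqP; rewrite -sqrf_eq0 enorm_sqr; apply/eqP.
  have c0 := dotrVv_ge0 w; move: c0 key; set c := dotrV w w => c0 key.
  have b1 : 0 < b + 1 by rewrite ltr_wpDl.
  have := key (- c / (b + 1)).
  rewrite (_ : _ + _ = - (c ^+ 2 * (b + 2) / (b + 1) ^+ 2)); last first.
    by field; rewrite gt_eqF.
  rewrite oppr_ge0 => H; apply/eqP; rewrite -sqrf_eq0 eq_le sqr_ge0 andbT.
  have b2 : 0 < (b + 2) / (b + 1) ^+ 2 by rewrite divr_gt0 ?exprn_gt0// ltr_wpDl.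
  by move: H; rewrite -mulrA pmulr_lle0.
apply: le_trans (lP v); apply: ler_wpM2r; first exact: sqr_ge0.
apply: ge_inf => //; exists l => k /eigenvalueP[w wA w0].
have := lP w; rewrite wA dotrVZl -enorm_sqr ler_pM2r// exprn_gt0// lt_def enorm_ge0 andbT.
by apply: contra w0 => /eqP/enorm_eq0/eqP.
Qed.

(** Along a segment the slope of phi grows at least linearly, since the smallest
    eigenvalue of the symmetric Hessian bounds its quadratic form. *)
Lemma strongly_convexP alpha a phi : (0 < d)%N -> 0 < alpha -> 0 <= a ->
  strongly_convex alpha a phi -> forall x v,
  phi x + dotrV (grad phi x) v + alpha / 2 * enorm v ^+ 2 <= phi (x + v).
Proof.
move=> d0 alpha0 a0 [[[df dg] H]|[_ df H]] x v; last first.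
  by have := H x (x + v); rewrite (addrC x v) addrK.
pose G (t : R) := phi (x + t *: v) - t * dotrV (grad phi x) v
                  - t ^+ 2 * (alpha / 2 * enorm v ^+ 2).
pose dG (t : R) := dotrV (grad phi (x + t *: v) - grad phi x) v
                   - t * (alpha * enorm v ^+ 2).
have GdG (t : R) : is_derive t 1 G (dG t).
  have H1 := is_derive_line (df (x + t *: v)).
  apply: is_derive_eq.
  rewrite derive_grad// /dG dotrVBl /GRing.scale /=.
  set X := dotrV _ _; set Y := dotrV _ _; set Z := enorm v; lra.
have cG : {within `[0, 1], continuous G}.
  by apply: derivable_within_continuous => t _; have [] := GdG t.
have [c] := MVT_segment ler01 (fun t _ => GdG t) cG.
rewrite in_itv/= => /andP[c0 c1].
rewrite /G !scale1r !scale0r !addr0 subr0 mulr1 !mul1r expr1n !mul0r expr0n/= mul0r.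
rewrite mul1r !subr0 => E.
suff : 0 <= dG c by rewrite -E; lra.
rewrite /dG subr_ge0.
have [s _ ->] := mvt_jacobian x v (c *: v) dg.
rewrite -scalemxAl dotrVZl ler_wpM2l//.
apply: le_trans (lambda_min_le _ d0 _); last first.
  by move=> u w; exact: (hessian_sym _ _ _ (conj df dg)).
apply: ler_wpM2r; first exact: sqr_ge0.
apply: le_trans (H _); rewrite ler_peMr ?(ltW alpha0)//.
by rewrite -[leLHS](powRr0 (1 + enorm (x + s *: (c *: v)))) ler_powR// lerDl enorm_ge0.
Qed.

(** The chord of slope phi (x + v) - phi x lies above the directional derivative,
    up to an arbitrarily small error at a small step t. *)
Lemma convex_above_tangent phi x v : convex_function [set: 'rV[R]_d] phi ->
  differentiable phi x -> phi x + dotrV (grad phi x) v <= phi (x + v).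
Proof.
move=> cphi df; apply/ler_addgt0Pl => e e0.
have K0 : 0 < enorm v + 1 by rewrite ltr_wpDl// enorm_ge0.
have [del del0 H] := differentiable_error df (divr_gt0 e0 K0).
pose t := Num.min 1 (del / (enorm v + 1)) / 2.
have m0 : 0 < Num.min 1 (del / (enorm v + 1)) by rewrite lt_min ltr01/= divr_gt0.
have t0 : 0 < t by rewrite divr_gt0.
have tm : t < Num.min 1 (del / (enorm v + 1)).
  by rewrite ltr_pdivrMr// ltr_pMr// ltr1n.
have t1 : t <= 1 by rewrite ltW// (lt_le_trans tm)// ge_min lexx.
have td : t < del / (enorm v + 1) by rewrite (lt_le_trans tm)// ge_min lexx orbT.
have nv : `|t *: v| <= t * enorm v.
  by rewrite (le_trans (norm_le_enorm _))// enormZ gtr0_norm.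
have := H (t *: v); rewrite -deriveE// derive_grad// dotrVZr.
set g := dotrV (grad phi x) v => {}H.
have := cphi (Itv01 (ltW t0) t1) (x + v) x.
rewrite !inE => /(_ I I); rewrite convRE.
rewrite [X in phi X <= _](_ : _ = x + t *: v); last first.
  rewrite /conv/= scalerDr addrAC -scalerDl/= /unstable.onem addrCA subrr addr0 scale1r.
  by rewrite addrC.
move=> /= {}cphi.
have {}H : phi x + t * g - phi (x + t *: v) <= t * e.
  have nvd : `|t *: v| < del.
    apply: (le_lt_trans nv); apply: (@le_lt_trans _ _ (t * (enorm v + 1))).
      by rewrite ler_wpM2l ?lerDl// ltW.
    by rewrite -ltr_pdivlMr.
  have := H nvd; rewrite distrC => /(le_trans (ler_norm _)) => {}H.
  have : e / (enorm v + 1) * `|t *: v| <= t * e.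
    rewrite -mulrA mulrC ler_pM2r// mulrC ler_pdivrMr//.
    by rewrite (le_trans nv)// ler_pM2l// lerDl.
  lra.
rewrite /unstable.onem in cphi.
have : t * (phi x + g) <= t * (phi (x + v) + e) by lra.
by rewrite ler_pM2l// (addrC e).
Qed.

End convexity.

Section controlled.
Context {R : realType} {d : nat}.
Implicit Types (phi : 'rV[R]_d -> R) (x v : 'rV[R]_d).

(** The regularity of potentials that the statistical argument uses, with constants
    that can be shared by the whole family and phi0. *)
Record controlled (B : R) (k : nat) phi : Prop := Controlled {
  controlled_differentiable : forall x, differentiable phi x ;
  controlled_grad_continuous : continuous (grad phi) ;
  controlled0 : phi 0 = 0 ;
  controlled_le : forall x, `|phi x| <= B * (1 + enorm x) ^+ k ;
  controlled_grad_le : forall x, enorm (grad phi x) <= B * (1 + enorm x) ^+ k ;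
  controlled_taylor : forall x v, phi (x + v) - phi x - dotrV (grad phi x) v
    <= B * (1 + enorm x + enorm v) ^+ k * enorm v ^+ 2 }.

Lemma enorm1_ge1 x : 1 <= 1 + enorm x.
Proof. by rewrite lerDl enorm_ge0. Qed.

Lemma controlled_mono B B' k k' phi : 0 <= B -> B <= B' -> (k <= k')%N ->
  controlled B k phi -> controlled B' k' phi.
Proof.
move=> B0 BB kk [dphi cphi phi0 le1 le2 le3].
have M (s : R) : 1 <= s -> B * s ^+ k <= B' * s ^+ k'.
  move=> s1; have s0 := le_trans ler01 s1.
  by rewrite ler_pM ?exprn_ge0// ler_weXn2l.
split=> // [x|x|x v].
- by rewrite (le_trans (le1 x))// M// enorm1_ge1.
- by rewrite (le_trans (le2 x))// M// enorm1_ge1.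
- rewrite (le_trans (le3 x v))// ler_wpM2r ?sqr_ge0// M//.
  by rewrite -addrA lerDl addr_ge0 ?enorm_ge0.
Qed.

Lemma smooth_controlled beta a (A : nat) G phi : 0 <= beta -> a <= A%:R ->
  0 <= G -> smooth beta a phi -> phi 0 = 0 -> enorm (grad phi 0) <= G ->
  controlled (G + beta) A.+2 phi.
Proof.
move=> beta0 aA G0 sm phi0 gradG; have dphi := smooth_differentiable sm.
have B0 : 0 <= G + beta by rewrite addr_ge0.
have grad_le x : enorm (grad phi x) <= (G + beta) * (1 + enorm x) ^+ A.+1.
  have := smooth_grad_lipschitz beta0 aA sm 0 x.
  rewrite add0r enorm0 addr0 => H.
  rewrite -(subrK (grad phi 0) (grad phi x)) (le_trans (ler_enormD _ _))//.
  rewrite addrC mulrDl; apply: lerD.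
    by rewrite (le_trans gradG)// ler_peMr// exprn_ege1// enorm1_ge1.
  rewrite (le_trans H)// exprSr mulrA ler_wpM2l// ?mulr_ge0 ?exprn_ge0 ?addr_ge0 ?enorm_ge0//.
  by rewrite lerDr.
split=> // [|x|x|x v].
- exact: smooth_grad_continuous sm.
- have [c /andP[c0 c1]] := mvt_grad 0 x dphi.
  rewrite add0r phi0 subr0 add0r => ->.
  rewrite (le_trans (normr_dotrV _ _))// exprSr mulrA.
  apply: ler_pM; rewrite ?enorm_ge0//; last by rewrite lerDr.
  apply: (le_trans (grad_le _)); rewrite ler_wpM2l// lerXn2r// ?nnegrE ?addr_ge0 ?enorm_ge0//.
  by rewrite lerD2l enormZ ger0_norm// ler_piMl ?enorm_ge0.
- by rewrite (le_trans (grad_le x))// ler_wpM2l// ler_weXn2l// enorm1_ge1.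
- rewrite (le_trans (ler_norm _))// (le_trans (smooth_taylor beta0 aA sm x v))//.
  rewrite ler_wpM2r ?sqr_ge0// ler_pM ?exprn_ge0 ?addr_ge0 ?enorm_ge0//.
    by rewrite lerDr.
  by rewrite ler_weXn2l ?leqW// -addrA lerDl addr_ge0 ?enorm_ge0.
Qed.

(** A gradient is the largest directional slope, and Taylor expansion bounds it by
    the values on the unit sphere. *)
Lemma smooth_grad0_le beta a (A : nat) c phi : 0 <= beta -> a <= A%:R -> 0 <= c ->
  smooth beta a phi -> phi 0 = 0 -> (forall v, enorm v = 1 -> `|phi v| <= c) ->
  enorm (grad phi 0) <= c + beta * 2 ^+ A.
Proof.
move=> beta0 aA c0 sm phi0 H; set g := grad phi 0.
have [->|g0] := eqVneq (enorm g) 0.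
  by rewrite addr_ge0// mulr_ge0// exprn_ge0.
have gp : 0 < enorm g by rewrite lt_def g0 enorm_ge0.
pose v := (enorm g)^-1 *: g.
have v1 : enorm v = 1 by rewrite enormZ ger0_norm ?invr_ge0 ?enorm_ge0// mulVf.
have gv : dotrV g v = enorm g by rewrite dotrVZr -enorm_sqr expr2 mulKf.
have := smooth_taylor beta0 aA sm 0 v.
rewrite add0r phi0 subr0 v1 enorm0 addr0 expr1n mulr1 -/g gv -[1 + 1]/2.
rewrite distrC => /(le_trans (ler_norm _)); rewrite lerBlDr => /le_trans; apply.
by rewrite addrC lerD2r (le_trans (ler_norm _))// H.
Qed.

Lemma bounded_set_enorm (Theta : set 'rV[R]_d) : bounded_set Theta ->
  exists2 D : R, 0 <= D & forall t, Theta t -> enorm t <= D.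
Proof.
move=> [M [_ H]]; exists (d%:R * (`|M| + 1)); first by rewrite mulr_ge0 ?addr_ge0.
move=> t Tt; rewrite (le_trans (enorm_le_norm _))// ler_wpM2l//.
by apply: H => //; rewrite (le_lt_trans (ler_norm M))// ltrDl.
Qed.

End controlled.

(** Over a bounded set of parameters, the Lipschitz dependence bounds all potentials
    on the unit sphere by one of them, hence all gradients at the origin. *)
Lemma family_controlled (R : realType) (d m : nat) (Theta : set 'rV[R]_m)
    (phi_ : 'rV[R]_m -> 'rV[R]_d -> R) (L p beta a : R) : 
  bounded_set Theta -> (forall theta, Theta theta -> potential (phi_ theta)) ->
  0 <= L -> 0 <= p ->
  (forall theta theta', Theta theta -> Theta theta' -> forall x,
      `|phi_ theta x - phi_ theta' x|
        <= L * enorm (theta - theta') * (1 + enorm x) `^ p) ->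
  0 <= beta -> (forall theta, Theta theta -> smooth beta a (phi_ theta)) ->
  exists B k, [/\ 1 <= B, p <= k%:R &
    forall theta, Theta theta -> controlled B k (phi_ theta)].
Proof.
move=> bT pot L0 p0 Lip beta0 sm.
have [[t1 T1]|T0] := pselect (exists t, Theta t); last first.
  exists 1, (Num.truncn p).+1; split=> //; first exact/ltW/truncnS_gt.
  by move=> t Tt; exfalso; apply: T0; exists t.
have [D D0 HD] := bounded_set_enorm bT.
pose A := (Num.truncn a).+1; have aA : a <= A%:R by exact/ltW/truncnS_gt.
pose c1 := enorm (grad (phi_ t1) 0) + beta * 2 ^+ A.
have c10 : 0 <= c1 by rewrite addr_ge0 ?enorm_ge0// mulr_ge0// exprn_ge0.
have H1 v : enorm v = 1 -> `|phi_ t1 v| <= c1.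
  move=> v1; have := smooth_taylor beta0 aA (sm _ T1) 0 v.
  rewrite add0r (pot _ T1) subr0 v1 enorm0 addr0 expr1n mulr1 -[1 + 1]/2.
  move=> H; rewrite -(subrK (dotrV (grad (phi_ t1) 0) v) (phi_ t1 v)).
  rewrite (le_trans (ler_normD _ _))// addrC lerD//.
  by rewrite (le_trans (normr_dotrV _ _))// v1 mulr1.
pose c := c1 + L * (D + D) * 2 `^ p.
have c0 : 0 <= c by rewrite addr_ge0// !mulr_ge0 ?addr_ge0 ?powR_ge0.
pose B := 1 + (c + beta * 2 ^+ A + beta).
have B0 : 0 <= c + beta * 2 ^+ A by rewrite addr_ge0// mulr_ge0// exprn_ge0.
exists B, (maxn A.+2 (Num.truncn p).+1); split.
- by rewrite /B lerDl addr_ge0.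
- rewrite (le_trans (ltW (truncnS_gt p)))// ler_nat leq_maxr//.
move=> t Tt.
apply: (@controlled_mono _ _ (c + beta * 2 ^+ A + beta) _ A.+2).
- by rewrite addr_ge0.
- by rewrite /B lerDr.
- by rewrite leq_maxl.
apply: (smooth_controlled beta0 aA B0 (sm _ Tt)); first exact: pot.
apply: (smooth_grad0_le beta0 aA c0 (sm _ Tt)); first exact: pot.
move=> v v1; rewrite -(subrK (phi_ t1 v) (phi_ t v)) (le_trans (ler_normD _ _))//.
rewrite addrC lerD ?H1// (le_trans (Lip _ _ Tt T1 _))// v1 -[1 + 1]/2.
rewrite ler_wpM2r ?powR_ge0// ler_wpM2l// (le_trans (ler_enormB _ _))//.
by rewrite lerD// HD.
Qed.

(** * Expectations of real random variables *)

Notation L1 mu f := (mu.-integrable [set: _] (EFin \o f)).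

Section expectation.
Context d (T : measurableType d) (R : realType) (mu : probability T R).
Implicit Types f g : T -> R.

Lemma L1_measurable f : L1 mu f -> measurable_fun setT f.
Proof. by move=> /measurable_int/measurable_EFinP. Qed.

Lemma L1_le f g : measurable_fun setT f -> (forall x, `|f x| <= g x) ->
  L1 mu g -> L1 mu f.
Proof.
move=> mf fg; apply: le_integrable => //; first exact/measurable_EFinP.
by move=> x _ /=; rewrite lee_fin (le_trans (fg x))// ler_norm.
Qed.

Lemma L1_cst (c : R) : L1 mu (fun=> c).
Proof. exact: finite_measure_integrable_cst. Qed.

Lemma L1D f g : L1 mu f -> L1 mu g -> L1 mu (fun x => f x + g x).
Proof. by move=> If Ig; exact: integrableD If Ig. Qed.

Lemma L1Z (k : R) f : L1 mu f -> L1 mu (fun x => k * f x).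
Proof. by move=> If; exact: integrableZl If. Qed.

Lemma L1N f : L1 mu f -> L1 mu (fun x => - f x).
Proof. by move=> If; exact: integrableN If. Qed.

Lemma L1B f g : L1 mu f -> L1 mu g -> L1 mu (fun x => f x - g x).
Proof. by move=> If Ig; exact: L1D If (L1N Ig). Qed.

Lemma L1_sum I (s : seq I) (F : I -> T -> R) :
  (forall i, L1 mu (F i)) -> L1 mu (fun x => \sum_(i <- s) F i x).
Proof.
move=> IF; elim: s => [|i s IH].
  by rewrite (_ : (fun _ => _) = fun=> 0); [exact: L1_cst|apply/funext => x; rewrite big_nil].
rewrite (_ : (fun _ => _) = fun x => F i x + \sum_(j <- s) F j x).
  exact: L1D.
by apply/funext => x; rewrite big_cons.
Qed.

Lemma expect_cst (c : R) : \int[mu]_x c = c.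
Proof.
by rewrite Rintegral_cst// -[X in fine X]/(mu [set: T]) (probability_setT mu) mulr1.
Qed.

Lemma expectD f g : L1 mu f -> L1 mu g ->
  \int[mu]_x (f x + g x) = \int[mu]_x f x + \int[mu]_x g x.
Proof. exact: RintegralD. Qed.

Lemma expectB f g : L1 mu f -> L1 mu g ->
  \int[mu]_x (f x - g x) = \int[mu]_x f x - \int[mu]_x g x.
Proof. exact: RintegralB. Qed.

Lemma expectZ (k : R) f : L1 mu f -> \int[mu]_x (k * f x) = k * \int[mu]_x f x.
Proof. exact: RintegralZl. Qed.

Lemma expect_sum I (s : seq I) (F : I -> T -> R) : (forall i, L1 mu (F i)) ->
  \int[mu]_x (\sum_(i <- s) F i x) = \sum_(i <- s) \int[mu]_x F i x.
Proof.
move=> IF; elim: s => [|i s IH].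
  by rewrite big_nil -[RHS](expect_cst 0); apply: eq_Rintegral => x _; rewrite big_nil.
rewrite big_cons -IH -expectD//; last exact: L1_sum.
by apply: eq_Rintegral => x _; rewrite big_cons.
Qed.

Lemma expect_le f g : L1 mu f -> L1 mu g -> (forall x, f x <= g x) ->
  \int[mu]_x f x <= \int[mu]_x g x.
Proof. by move=> If Ig fg; apply: le_Rintegral. Qed.

Lemma expect_ge0 f : (forall x, 0 <= f x) -> 0 <= \int[mu]_x f x.
Proof. by move=> f0; apply: Rintegral_ge0. Qed.

Lemma EFin_expect f : L1 mu f -> (\int[mu]_x (f x)%:E)%E = (\int[mu]_x f x)%:E.
Proof. by move=> If; rewrite /Rintegral fineK//; exact: integrable_fin_num If. Qed.

Lemma ge0_L1 f (c : R) : measurable_fun setT f -> (forall x, 0 <= f x) ->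
  (\int[mu]_x (f x)%:E <= c%:E)%E -> L1 mu f.
Proof.
move=> mf f0 fc; apply/integrableP; split; first exact/measurable_EFinP.
under eq_integral => x _ do rewrite /= ger0_norm//.
by rewrite (le_lt_trans fc)// ltry.
Qed.

Lemma L1_indic (A : set T) : measurable A -> L1 mu (\1_A).
Proof. by move=> mA; apply: integrable_indic; rewrite ?fin_num_measure. Qed.

Lemma expect_indic (A : set T) : measurable A -> \int[mu]_x (\1_A x) = fine (mu A).
Proof. by move=> mA; rewrite /Rintegral integral_indic// setIT. Qed.

(** The integral of a nonnegative function is a supremum over simple functions,
    hence monotone even when the smaller function is not measurable. *)
Lemma ge0_integral_mono (f g : T -> \bar R) : (forall x, 0 <= f x)%E ->
  (forall x, f x <= g x)%E -> (\int[mu]_x f x <= \int[mu]_x g x)%E.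
Proof.
move=> f0 fg; have g0 x : (0 <= g x)%E by exact: le_trans (f0 x) (fg x).
rewrite !ge0_integralTE//; apply: le_ereal_sup => _ [h /= hf <-].
by exists h => // x; exact: le_trans (hf x) (fg x).
Qed.

End expectation.

Section law.
Context {R : realType} {dO dT : measure_display} {Om : measurableType dO}
  {T : measurableType dT} (Pr : probability Om R) (mu : probability T R).
Variable X : Om -> T.
Hypothesis lawX : has_law Pr X mu.

Lemma ge0_expect_law (g : T -> \bar R) : measurable_fun setT g ->
  (forall y, 0 <= g y)%E -> (\int[Pr]_w g (X w) = \int[mu]_y g y)%E.
Proof.
case: lawX => mX lX mg g0.
rewrite -[LHS](@ge0_integral_pushforward _ _ _ _ _ _ mX Pr setT g)//; last first.
apply: eq_measure_integral => A mA _; exact: lX.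
Qed.

Lemma L1_law (g : T -> R) : L1 mu g -> L1 Pr (g \o X).
Proof.
move=> Ig; have mg := L1_measurable Ig; case: (lawX) => mX lX.
apply/integrableP; split; first exact/measurable_EFinP/measurableT_comp.
have -> : (\int[Pr]_x `|(EFin \o (g \o X)) x| = \int[mu]_y `|(EFin \o g) y|)%E.
  rewrite -(ge0_expect_law (g := fun y => `|(EFin \o g) y|%E))//.
  by apply: measurableT_comp => //; exact/measurable_EFinP.
by case/integrableP : Ig.
Qed.

Lemma expect_law (g : T -> R) : L1 mu g ->
  \int[Pr]_w g (X w) = \int[mu]_y g y.
Proof.
move=> Ig; rewrite /Rintegral; congr fine; have [mX lX] := lawX.
have mg := L1_measurable Ig.
rewrite -[LHS](@integral_pushforward _ _ _ _ _ _ mX Pr setT (EFin \o g))//.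
- by apply: eq_measure_integral => A mA _; exact: lX.
- exact/measurable_EFinP.
- by rewrite preimage_setT; exact: L1_law.
Qed.

End law.

(** * Moments under a Poincare inequality *)

Section borel.
Context {R : realType} {d : nat}.

Lemma open_borelrV (A : set 'rV[R]_d) : open A -> measurable (A : set (borelrV R d)).
Proof. by move=> oA; apply: sub_sigma_algebra. Qed.

Lemma continuous_borelrV (f : 'rV[R]_d -> R) :
  continuous f -> measurable_fun [set: borelrV R d] f.
Proof.
move=> /continuousP cf; apply: (measurability _ (RGenOpens.measurableE R)).
move=> _ [_ [a [b ->] <-]]; rewrite setTI; apply: open_borelrV.
exact/cf/interval_open.
Qed.

Lemma continuous_borelrV_map (g : 'rV[R]_d -> 'rV[R]_d) :
  continuous g -> measurable_fun [set: borelrV R d] (g : borelrV R d -> borelrV R d).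
Proof.
move=> /continuousP cg; apply: (@measurability _ _ (borelrV R d) (borelrV R d) setT g open) => //.
by move=> _ [A oA <-]; rewrite setTI; apply: open_borelrV; exact: cg.
Qed.

End borel.

Section poincare.
Context {R : realType} {d : nat} (P : probability (borelrV R d) R).
Implicit Types f : 'rV[R]_d -> R.

(** Poincare's inequality between real expectations, with the integrability of its
    left-hand side. *)
Definition real_poincare (CPI : R) : Prop := forall f, (forall x, differentiable f x) ->
  L1 P (fun x => enorm (grad f x) ^+ 2) ->
  L1 P (fun x => (f x - \int[P]_y f y) ^+ 2) /\
  \int[P]_x ((f x - \int[P]_y f y) ^+ 2) <= CPI * \int[P]_x (enorm (grad f x) ^+ 2).

Lemma poincareP : poincare P -> exists2 CPI : R, 0 <= CPI & real_poincare CPI.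
Proof.
move=> [CPI CPI0 H]; exists CPI => // f df Ig.
have Hm : (\int[P]_x ((f x - \int[P]_y f y) ^+ 2)%:E
    <= (CPI * \int[P]_x (enorm (grad f x) ^+ 2))%:E)%E.
  rewrite EFinM -EFin_expect//; apply: le_trans (H f df).
  by rewrite /variance unlock unlock.
set m := Rintegral _ _ _ in Hm *.
have mf : measurable_fun [set: borelrV R d] f.
  by apply: continuous_borelrV => x; exact: differentiable_continuous.
have I : L1 P (fun x => (f x - m) ^+ 2).
  apply: (ge0_L1 _ _ Hm) => [|x]; last exact: sqr_ge0.
  by apply: measurable_funX; apply: measurable_funB.
by split=> //; move: Hm; rewrite EFin_expect// lee_fin.
Qed.

End poincare.

Section coordinate_moments.
Context {R : realType} {d : nat} (P : probability (borelrV R d) R) (CPI : R).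
Hypothesis CPI_ge0 : 0 <= CPI.
Hypothesis poinc : real_poincare P CPI.
Variable i : 'I_d.
Let X (x : 'rV[R]_d) : R := x 0 i.

Let is_derive_X x v : is_derive x v X (v 0 i).
Proof.
have lin : linear X by move=> c y z; rewrite /X !mxE.
pose linM := GRing.isLinear.Build _ _ _ _ _ lin.
pose L : {linear 'rV[R]_d -> R} := HB.pack X linM.
apply: DeriveDef; first by apply: diff_derivable; exact: differentiable_coord.
rewrite deriveE; last exact: differentiable_coord.
by rewrite -[X]/(L : _ -> _) diff_lin//; exact: coord_continuous.
Qed.

Let enorm_grad_X k x : enorm (grad (fun x => X x ^+ k) x) ^+ 2
  = k%:R ^+ 2 * X x ^+ (2 * k.-1).
Proof.
have -> : grad (fun x => X x ^+ k) x = (k%:R * X x ^+ k.-1) *: delta_mx 0 i.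
  apply/rowP => j; rewrite !mxE eqxx/=.
  have := is_deriveX k (is_derive_X x (delta_mx 0 j)).
  rewrite (_ : X ^+ k = fun x => X x ^+ k); last first.
    by apply/funext => y; rewrite exprfctE.
  by move=> [_ ->]; rewrite mxE eqxx/= eq_sym.
rewrite enormZ exprMn real_normK ?num_real// exprMn -exprM (mulnC k.-1).
suff -> : enorm (delta_mx 0 i : 'rV[R]_d) = 1 by rewrite expr1n mulr1.
rewrite /enorm /dotrV (bigD1 i)//= !mxE !eqxx/= mulr1 big1 ?addr0 ?sqrtr1// => j ji.
by rewrite !mxE (negbTE ji) mulr0.
Qed.

Let measurable_X k : measurable_fun [set: borelrV R d] (fun x => X x ^+ k).
Proof. by apply: measurable_funX; apply: continuous_borelrV; exact: coord_continuous. Qed.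

Let L1_X k (l : nat) : (k <= l)%N -> L1 P (fun x => X x ^+ (2 * l)) -> L1 P (fun x => X x ^+ k).
Proof.
move=> kl I; apply: (L1_le _ _ (L1D (L1_cst P 1) I)) => // x.
have [x1|x1] := leP `|X x| 1.
  by rewrite normrX (le_trans (exprn_ile1 _ (normr_ge0 _) x1))// lerDl exprM exprn_ge0// sqr_ge0.
rewrite normrX exprM -(real_normK (num_real (X x))) -exprM.
rewrite (@le_trans _ _ (`|X x| ^+ (2 * l)))//; last by rewrite lerDr.
rewrite ler_weXn2l ?(ltW x1)// (leq_trans kl)//.
by rewrite leq_pmull.
Qed.

(** Poincare's inequality for X ^+ k, whose gradient has norm k |X| ^ (k - 1). *)
Let moment_step k : (0 < k)%N -> L1 P (fun x => X x ^+ (2 * k.-1)) ->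
  L1 P (fun x => X x ^+ (2 * k)) /\
  \int[P]_x (X x ^+ (2 * k)) <=
    CPI * k%:R ^+ 2 * \int[P]_x (X x ^+ (2 * k.-1)) + (\int[P]_x (X x ^+ k)) ^+ 2.
Proof.
move=> k0 I; have Ig : L1 P (fun x => enorm (grad (fun x => X x ^+ k) x) ^+ 2).
  by under [X in L1 P X]eq_fun do rewrite enorm_grad_X; exact: L1Z.
have df x : differentiable (fun x => X x ^+ k) x.
  rewrite (_ : (fun x => X x ^+ k) = X ^+ k); last first.
    by apply/funext => y; rewrite exprfctE.
  by rewrite -(prednK k0); apply: differentiableX; exact: differentiable_coord.
have [I1 H] := poinc df Ig; set m := \int[P]_y _ in I1 H *.
have I2 : L1 P (fun x => X x ^+ (2 * k)).
  apply: (L1_le _ _ (L1Z 2 (L1D I1 (L1_cst P (m ^+ 2))))) => // x.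
  rewrite mulnC exprM ger0_norm ?sqr_ge0//.
  have := sqr_ge0 (X x ^+ k - m - m); set a := X x ^+ k; nra.
have I3 : L1 P (fun x => X x ^+ k) by exact: L1_X (leqnn k) I2.
split=> //; move: H.
under [X in _ <= CPI * X]eq_Rintegral do rewrite enorm_grad_X.
rewrite expectZ// mulrA.
have -> : \int[P]_x ((X x ^+ k - m) ^+ 2) = \int[P]_x (X x ^+ (2 * k)) - m ^+ 2.
  rewrite (_ : (fun x => (X x ^+ k - m) ^+ 2) =
      fun x => X x ^+ (2 * k) - ((2 * m) * X x ^+ k - m ^+ 2)); last first.
    by apply/funext => x; rewrite mulnC exprM; set a := X x ^+ k; ring.
  rewrite expectB//; last by apply: L1B; [exact: L1Z|exact: L1_cst].
  rewrite expectB ?expect_cst//; [|exact: L1Z|exact: L1_cst].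
  rewrite expectZ// -/m; ring.
by rewrite lerBlDr.
Qed.

Lemma coord_L1 k : L1 P (fun x : 'rV[R]_d => x 0 i ^+ (2 * k)).
Proof.
elim: k => [|k IH].
  by under [X in L1 P X]eq_fun do rewrite muln0 expr0; exact: L1_cst.
by have [] := @moment_step k.+1 isT IH.
Qed.

(** Strong induction on k: Poincare's inequality bounds the moment of order 2 k by
    k ^ 2 times the previous even moment, plus the square of the mean of X ^+ k, which
    involves even moments of order at most k + 1. *)
Lemma coord_moments : exists2 K : R, 1 <= K & forall k,
  \int[P]_x (x 0 i ^+ (2 * k)) <= (K * k%:R) ^+ (2 * k).
Proof.
pose a k := \int[P]_x (X x ^+ (2 * k)).
have a0 k : 0 <= a k by apply: expect_ge0 => x; rewrite exprM exprn_ge0// sqr_ge0.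
(* K settles the case k = 1 and absorbs CPI into half of the target bound. *)
pose K := 1 + a 1%N + 2 * CPI.
have K1 : 1 <= K by rewrite /K -addrA lerDl addr_ge0// mulr_ge0.
have K0 : 0 <= K by exact: le_trans K1.
have KK : K <= K ^+ 2 by rewrite expr2 ler_peMl.
have CK : 2 * CPI <= K ^+ 2 by apply: le_trans KK; rewrite /K lerDr addr_ge0.
exists K => // k; rewrite -/(a k).
elim/ltn_ind: k => -[|[|k]] IH.
- rewrite /a muln0 expr0; under eq_Rintegral do rewrite expr0.
  by rewrite expect_cst.
- rewrite (_ : (K * _) ^+ _ = K ^+ 2) ?mulr1//.
  by apply: le_trans KK; rewrite /K -addrA addrCA lerDl addr_ge0// mulr_ge0.
set l := k.+2; have l0 : (0 < l)%N by [].
have [_] := moment_step l0 (coord_L1 _); rewrite -/(a l) -/(a l.-1).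
move=> /le_trans; apply.
set T := (K * l%:R) ^+ (2 * l).
have T0 : 0 <= T by rewrite exprn_ge0// mulr_ge0.
have Kl0 : 0 <= K * l%:R by rewrite mulr_ge0.
have H1 : CPI * l%:R ^+ 2 * a l.-1 <= T / 2.
  apply: (@le_trans _ _ (CPI * l%:R ^+ 2 * (K * l%:R) ^+ (2 * l.-1))).
    rewrite ler_wpM2l ?mulr_ge0 ?sqr_ge0//; apply: (le_trans (IH _ _)) => //.
    by rewrite lerXn2r ?nnegrE ?mulr_ge0// ler_wpM2l// ler_nat.
  have -> : T = (K ^+ 2 * l%:R ^+ 2) * (K * l%:R) ^+ (2 * l.-1).
    by rewrite /T -exprMn -exprD -mulnS.
  rewrite [leRHS]mulrAC; apply: ler_wpM2r; first by rewrite exprn_ge0.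
  by rewrite [leRHS]mulrAC ler_wpM2r ?sqr_ge0//; lra.
have H2 : `|\int[P]_x (X x ^+ l)| <= (K * (uphalf l)%:R) ^+ l.
  apply: (le_trans (le_normr_Rintegral _ (L1_X (leqnn l) (coord_L1 l)))) => //.
  have [ol|el] := boolP (odd l); last first.
    have lE : l = (2 * l./2)%N by rewrite mul2n -[LHS]odd_double_half (negbTE el).
    rewrite (_ : uphalf l = l./2); last by rewrite uphalf_half (negbTE el).
    rewrite [leRHS](_ : _ = (K * (l./2)%:R) ^+ (2 * l./2)); last by rewrite -lE.
    apply: le_trans (IH l./2 _); last first.
      by rewrite ltn_half_double -addnn -{1}(addn0 l) ltn_add2l.
    rewrite le_eqVlt; apply/orP; left; apply/eqP; apply: eq_Rintegral => x _.
    by rewrite (_ : X x ^+ l = X x ^+ (2 * l./2)) -?lE// ger0_norm// lE exprM exprn_ge0// sqr_ge0.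
  (* An odd power is a mean of the two neighbouring even ones, balanced at c. *)
  set h := l./2; have lE : l = (2 * h).+1.
    by rewrite mul2n -[LHS]odd_double_half ol.
  have uE : uphalf l = h.+1 by rewrite uphalf_half ol.
  have hl : (h.+1 < l)%N by rewrite lE; move: lE; rewrite /l; case: (h) => // h' _; lia.
  have hl' : (h < l)%N by exact: ltn_trans hl.
  rewrite uE; set c := K * h.+1%:R.
  have c0 : 0 < c by rewrite mulr_gt0// (lt_le_trans ltr01).
  apply: (@le_trans _ _ (\int[P]_x (c / 2 * X x ^+ (2 * h) + (2 * c)^-1 * X x ^+ (2 * h.+1)))).
    apply: expect_le => [||x].
    - by apply: integrable_norm; exact: (L1_X (leqnn l) (coord_L1 l)).
    - by apply: L1D; apply: L1Z; exact: coord_L1.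
    rewrite lE exprS normrM (ger0_norm (_ : 0 <= X x ^+ (2 * h))); last first.
      by rewrite exprM exprn_ge0// sqr_ge0.
    rewrite mulnS exprD mulrA -mulrDl ler_wpM2r//.
      by rewrite exprM exprn_ge0// sqr_ge0.
    rewrite -(real_normK (num_real (X x))); set b := `|X x|.
    rewrite -subr_ge0 (_ : _ - _ = (c - b) ^+ 2 / (2 * c)).
      by rewrite divr_ge0 ?sqr_ge0// mulr_ge0// ltW.
    by field; rewrite gt_eqF.
  rewrite expectD ?expectZ//; try exact: coord_L1; try by apply: L1Z; exact: coord_L1.
  rewrite -/(a h) -/(a h.+1).
  have A1 : a h <= c ^+ (2 * h).
    apply: (le_trans (IH _ hl')); rewrite lerXn2r ?nnegrE ?mulr_ge0// ?(ltW c0)//.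
    by rewrite ler_wpM2l// ler_nat.
  have A2 : a h.+1 <= c ^+ (2 * h.+1) by exact: IH.
  apply: (@le_trans _ _ (c / 2 * c ^+ (2 * h) + (2 * c)^-1 * c ^+ (2 * h.+1))).
    by apply: lerD; rewrite ler_wpM2l// ?invr_ge0 ?mulr_ge0 ?invr_ge0 ?(ltW c0).
  rewrite mulnS exprD lE (exprS _ (2 * h)) le_eqVlt; apply/orP; left; apply/eqP.
  by field; rewrite gt_eqF.
have H3 : (\int[P]_x (X x ^+ l)) ^+ 2 <= T / 2.
  rewrite -(real_normK (num_real (Rintegral _ _ _))).
  apply: (@le_trans _ _ ((K * (uphalf l)%:R) ^+ (2 * l))).
    by rewrite mulnC exprM lerXn2r// ?nnegrE ?exprn_ge0// mulr_ge0.
  have h3 : (3 * uphalf l <= 2 * l)%N by rewrite /l; lia.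
  have : (K * (uphalf l)%:R) ^+ (2 * l) <= (2 / 3 * (K * l%:R)) ^+ (2 * l).
    rewrite lerXn2r ?nnegrE ?mulr_ge0//.
    rewrite mulrCA ler_wpM2l//; rewrite mulrAC ler_pdivlMr// mulrC.
    by rewrite -!natrM ler_nat.
  move=> /le_trans; apply; rewrite exprMn -/T mulrC ler_wpM2l//.
  rewrite exprM (le_trans (y := (2 / 3) ^+ 2))//; last by rewrite -subr_ge0; lra.
  by rewrite -[leRHS]expr1 ler_wiXn2l//; lra.
by rewrite (splitr T) lerD.
Qed.

End coordinate_moments.

Section moments.
Context {R : realType} {d : nat} (P : probability (borelrV R d) R).
Hypotheses (d_gt0 : (0 < d)%N) (poincP : poincare P).
Implicit Types x : 'rV[R]_d.

Let pow_sum_le (a : 'I_d -> R) k : (0 < k)%N -> (forall i, 0 <= a i) ->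
  (\sum_i a i) ^+ k <= d%:R ^+ k * \sum_i a i ^+ k.
Proof.
move=> k0 a0.
have [j _ aj] := @arg_maxP _ _ _ (Ordinal d_gt0) predT a isT.
apply: (@le_trans _ _ ((d%:R * a j) ^+ k)).
  rewrite lerXn2r ?nnegrE ?sumr_ge0 ?mulr_ge0//.
  apply: (@le_trans _ _ (\sum_(i < d) a j)); first by apply: ler_sum => i _; exact: aj.
  by rewrite sumr_const card_ord mulr_natl.
rewrite exprMn ler_wpM2l ?exprn_ge0// (bigD1 j)//= lerDl.
by apply: sumr_ge0 => i _; rewrite exprn_ge0.
Qed.

Let enorm_pow_le k x : (0 < k)%N ->
  (1 + enorm x) ^+ (2 * k) <= 4 ^+ k * (1 + d%:R ^+ k * \sum_i x 0 i ^+ (2 * k)).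
Proof.
move=> k0; have e0 := enorm_ge0 x.
have H : (1 + enorm x) ^+ (2 * k) <= 4 ^+ k * (1 + enorm x ^+ (2 * k)).
  rewrite (_ : 4 = 2 ^+ 2); last by rewrite -natrX.
  rewrite -exprM; have [e1|e1] := leP (enorm x) 1.
    apply: (@le_trans _ _ (2 ^+ (2 * k))); last by rewrite ler_peMr ?exprn_ge0// lerDl exprn_ge0.
    by rewrite lerXn2r ?nnegrE ?addr_ge0//; lra.
  apply: (@le_trans _ _ ((2 * enorm x) ^+ (2 * k))).
    by rewrite lerXn2r ?nnegrE ?addr_ge0 ?mulr_ge0//; lra.
  by rewrite exprMn ler_wpM2l ?exprn_ge0// lerDr.
apply: (le_trans H); rewrite ler_wpM2l ?exprn_ge0// lerD2l exprM enorm_sqr.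
apply: le_trans (pow_sum_le k0 _) _; first by move=> i; rewrite -expr2 sqr_ge0.
rewrite ler_wpM2l ?exprn_ge0//; apply: ler_sum => i _.
by rewrite -expr2 exprM.
Qed.

Lemma measurable_enorm_pow q :
  measurable_fun [set: borelrV R d] (fun x : 'rV[R]_d => (1 + enorm x) ^+ q).
Proof.
apply: measurable_funX; apply: measurable_funD => //.
by apply: continuous_borelrV; exact: enorm_continuous.
Qed.

Let enorm_moments_aux : exists2 K : R, 1 <= K & forall k, (0 < k)%N ->
  L1 P (fun x => (1 + enorm x) ^+ (2 * k)) /\
  \int[P]_x ((1 + enorm x) ^+ (2 * k)) <= (K * k%:R) ^+ (2 * k).
Proof.
have [CPI CPI0 pc] := poincareP poincP.
have [K_ K_P] := @choice _ _ _ (fun i => let: ex_intro2 K a b :=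
   coord_moments CPI0 pc i in ex_intro (fun K => 1 <= K /\ forall k,
  \int[P]_x (x 0 i ^+ (2 * k)) <= (K * k%:R) ^+ (2 * k)) K (conj a b)).
have K1 i : 1 <= K_ i by case: (K_P i).
have K0 i : 0 <= K_ i by exact: le_trans (K1 i).
pose K := \sum_i K_ i.
have KK i : K_ i <= K by rewrite /K (bigD1 i)//= lerDl sumr_ge0.
have K1' : 1 <= K by exact: le_trans (K1 (Ordinal d_gt0)) (KK _).
have d1 : 1 <= d%:R :> R by rewrite ler1n.
exists (4 * (d%:R * K)).
  rewrite (le_trans K1')// mulrA ler_peMl ?(le_trans _ K1')//.
  by rewrite mulr_ege1// ler1n.
move=> k k0.
pose b x := 4 ^+ k * (1 + d%:R ^+ k * \sum_i x 0 i ^+ (2 * k)) : R.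
have Is : L1 P (fun x : 'rV[R]_d => \sum_i x 0 i ^+ (2 * k)).
  by apply: L1_sum => i; exact: (coord_L1 pc).
have Ib : L1 P b by apply: L1Z; apply: L1D; [exact: L1_cst|exact: L1Z].
have Iu : L1 P (fun x => (1 + enorm x) ^+ (2 * k)).
  apply: L1_le Ib; first exact: measurable_enorm_pow.
  move=> x; rewrite ger0_norm; first exact: enorm_pow_le.
  by rewrite exprn_ge0// addr_ge0// enorm_ge0.
split=> //; apply: (@le_trans _ _ (\int[P]_x b x)).
  by apply: expect_le => // x; exact: enorm_pow_le.
rewrite /b expectZ; last by apply: L1D; [exact: L1_cst|exact: L1Z].
rewrite expectD ?expect_cst; [|exact: L1_cst|exact: L1Z].
rewrite expectZ// expect_sum; last by move=> i; exact: (coord_L1 pc).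
set S := \sum_i _.
have HS : S <= d%:R * (K * k%:R) ^+ (2 * k).
  rewrite mulr_natl -[d in leRHS]card_ord -sumr_const; apply: ler_sum => i _.
  case: (K_P i) => _ /(_ k)/le_trans; apply.
  by rewrite lerXn2r ?nnegrE ?mulr_ge0 ?(le_trans (K0 _) (KK i))// ler_wpM2r.
set A := (K * k%:R) ^+ (2 * k) in HS *.
have A1 : 1 <= A.
  by rewrite exprn_ege1// mulr_ege1// ler1n.
rewrite -mulrA -mulrA [leRHS]exprMn [in leRHS]exprMn -/A.
have dk : d%:R ^+ k * S <= d%:R ^+ (2 * k) * A.
  apply: (@le_trans _ _ (d%:R ^+ k * (d%:R * A))).
    by rewrite ler_wpM2l ?exprn_ge0.
  rewrite mulrA -exprSr ler_wpM2r ?(le_trans _ A1)// ler_weXn2l//.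
  by lia.
have D1 : 1 <= d%:R ^+ (2 * k) * A by rewrite mulr_ege1// exprn_ege1.
rewrite exprM (_ : 4 ^+ 2 = 4 * 4 :> R) ?expr2// [leRHS]mulrA.
apply: (@le_trans _ _ (4 ^+ k * (2 * (d%:R ^+ (2 * k) * A)))).
  by rewrite ler_wpM2l ?exprn_ge0//; lra.
rewrite exprMn -!mulrA ler_wpM2l ?exprn_ge0// ler_wpM2r ?(le_trans _ D1)//.
rewrite (@le_trans _ _ 4)//; first by lra.
by rewrite -[leLHS]expr1 ler_weXn2l//; lra.
Qed.

Lemma enorm_L1 q : L1 P (fun x => (1 + enorm x) ^+ q).
Proof.
have [K _ /(_ q.+1 isT)[I _]] := enorm_moments_aux.
apply: L1_le I; first exact: measurable_enorm_pow.
move=> x; rewrite ger0_norm ?exprn_ge0 ?addr_ge0 ?enorm_ge0//.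
by rewrite ler_weXn2l ?enorm1_ge1//; lia.
Qed.

Lemma enorm_moments : exists2 K : R, 1 <= K & forall k, (0 < k)%N ->
  \int[P]_x ((1 + enorm x) ^+ (2 * k)) <= (K * k%:R) ^+ (2 * k).
Proof.
by have [K K1 H] := enorm_moments_aux; exists K => // k /H[].
Qed.

Lemma natr_pow_le_expR N q : N%:R ^+ q <= q`!%:R * expR N%:R :> R.
Proof.
case: q => [|q]; first by rewrite expr0 mul1r -[leLHS]expR0 ler_expR.
have := @expR_ge1Dxn R N%:R q (ler0n _ _).
have f0 : 0 < q.+1`!%:R :> R by rewrite ltr0n fact_gt0.
move=> H; rewrite mulrC -ler_pdivrMr//; apply: le_trans H.
by rewrite lerDr.
Qed.

Definition far (r : R) : set (borelrV R d) := [set x | r < enorm x].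

Lemma measurable_far r : measurable (far r).
Proof.
apply: open_borelrV; rewrite (_ : far r = enorm @^-1` [set y : R | r < y])//.
by apply: open_comp => [x _|]; [exact: enorm_continuous|exact: open_gt].
Qed.

Lemma measurable_far_indic q r : measurable_fun [set: borelrV R d]
  (fun x : 'rV[R]_d => (1 + enorm x) ^+ q * \1_(far r) x).
Proof.
apply: measurable_funM; first exact: measurable_enorm_pow.
exact: measurable_indic (measurable_far r).
Qed.

Lemma far_L1 q r : L1 P (fun x => (1 + enorm x) ^+ q * \1_(far r) x).
Proof.
apply: L1_le (enorm_L1 q); first exact: measurable_far_indic.
move=> x; have u0 : 0 <= (1 + enorm x) ^+ q by rewrite exprn_ge0// addr_ge0 ?enorm_ge0.
by rewrite indicE normrM !ger0_norm// ler_piMr// lern1 leq_b1.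
Qed.

(** Subexponential moments make the mass outside a ball of logarithmic radius
    smaller than any power of n: Markov's inequality with an exponent
    proportional to ln n. *)
Lemma tail_moment q kappa : exists C K : R, [/\ 0 <= C, 1 <= K &
  forall n : nat, (0 < n)%N ->
  \int[P]_x ((1 + enorm x) ^+ q * \1_(far (K * (1 + ln n%:R))) x) <= C / n%:R ^+ kappa].
Proof.
have [K K1 H] := enorm_moments; have K0 : 0 < K by rewrite (lt_le_trans ltr01).
pose C := K ^+ (2 * q) * ((2 * q)`!%:R * expR q%:R).
pose K' := expR 1 * K * (q + kappa + 1)%:R.
exists C, K'; split.
- by rewrite !mulr_ge0 ?exprn_ge0 ?expR_ge0// ltW.
- by rewrite !mulr_ege1 ?(le_trans _ (expR_ge1Dx 1)) ?lerDl// ler1n addn1.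
move=> n n0; set t := 1 + ln n%:R.
have n1 : 1 <= n%:R :> R by rewrite ler1n.
have t1 : 1 <= t by rewrite lerDl ln_ge0.
(* Markov's inequality is applied with the moment of order 2 k. *)
pose k := (Num.truncn (kappa%:R * t)).+1.
have kt : kappa%:R * t < k%:R by exact: truncnS_gt.
have kt' : k%:R <= kappa%:R * t + 1.
  by rewrite -natr1 lerD2r truncn_le// mulr_ge0// (le_trans _ t1).
set r := K' * t; pose N := (q + k)%N.
have N0 : (0 < N)%N by rewrite /N addnS.
have KN : 0 < K * N%:R by rewrite mulr_gt0// ltr0n.
have rKN : expR 1 * (K * N%:R) <= r.
  rewrite /r /K' -!mulrA ler_pM2l ?expR_gt0// ler_pM2l// /N !natrD.
  have qt : 0 <= q%:R * (t - 1) by rewrite mulr_ge0// subr_ge0.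
  move: qt kt' t1 => {}H2 H3 H4; move: (t) H2 H3 H4 => s; lra.
have r0 : 0 < r by rewrite (lt_le_trans _ rKN)// mulr_gt0 ?expR_gt0.
apply: (@le_trans _ _ (\int[P]_x (r ^- (2 * k) * (1 + enorm x) ^+ (2 * N)))).
  apply: expect_le => [||x]; [exact: far_L1|by apply: L1Z; exact: enorm_L1|].
  have u1 := enorm1_ge1 x; have u0 : 0 <= 1 + enorm x by exact: le_trans u1.
  rewrite indicE; have [|_] := boolP (x \in _); last first.
    by rewrite mulr0 mulr_ge0 ?invr_ge0 ?exprn_ge0// ltW.
  rewrite inE /far/= => rx; rewrite mulr1 mulrC ler_pdivlMr ?exprn_gt0//.
  rewrite /N mulnDr exprD ler_pM ?exprn_ge0 ?(ltW r0)//.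
    by rewrite ler_weXn2l// leq_pmull.
  rewrite lerXn2r ?nnegrE ?(ltW r0)//.
  by rewrite (le_trans (ltW rx))// lerDr.
rewrite expectZ; last exact: enorm_L1.
apply: (@le_trans _ _ (r ^- (2 * k) * (K * N%:R) ^+ (2 * N))).
  by rewrite ler_wpM2l ?H// invr_ge0 exprn_ge0// ltW.
apply: (@le_trans _ _ ((K * N%:R) ^+ (2 * q) * expR (- (2 * k%:R)))).
  rewrite /N mulnDr exprD mulrCA -/N ler_wpM2l ?exprn_ge0 ?(ltW KN)//.
  rewrite expRN [leLHS]mulrC ler_pdivrMr ?exprn_gt0// [leRHS]mulrC ler_pdivlMr ?expR_gt0//.
  have -> : expR (2 * k%:R) = expR 1 ^+ (2 * k) :> R by rewrite -expRM_natl mulr1 natrM.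
  rewrite -exprMn.
  rewrite lerXn2r ?nnegrE ?(ltW r0)//; last by rewrite mulrC.
  by rewrite mulr_ge0 ?expR_ge0 ?(ltW KN).
rewrite exprMn /C -!mulrA ler_wpM2l ?exprn_ge0 ?(ltW K0)//.
apply: (@le_trans _ _ ((2 * q)`!%:R * expR N%:R * expR (- (2 * k%:R)))).
  by rewrite ler_wpM2r ?expR_ge0// natr_pow_le_expR.
rewrite -!mulrA ler_wpM2l// -expRD /N natrD.
rewrite (_ : q%:R + k%:R - 2 * k%:R = q%:R - k%:R); last by ring.
rewrite expRB ler_wpM2l ?expR_ge0// lef_pV2 ?posrE ?expR_gt0 ?exprn_gt0 ?ltr0n//.
rewrite -[leLHS]lnK ?posrE ?exprn_gt0 ?ltr0n// ler_expR lnXn ?ltr0n//.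
rewrite -[leLHS]mulr_natl (le_trans _ (ltW kt))// ler_wpM2l// /t addrC lerDl ler01//.
Qed.

End moments.

(** * Independence and the lower-tail Chernoff bound *)

Section indicator_extension.
Context {R : realType} {dO dT : measure_display} {Om : measurableType dO}
  {T : measurableType dT} (Pr : probability Om R).
Variables (Z : Om -> T).
Hypothesis (mZ : measurable_fun setT Z).

Import HBNNSimple.

Let nnsfun_sum (W : Om -> R) (h : {nnsfun T >-> R}) :
  measurable_fun setT W -> (forall w, 0 <= W w) ->
  (\int[Pr]_w (h (Z w) * W w)%:E = \sum_(y \in range h)
     (y%:E * \int[Pr]_w (\1_(h @^-1` [set y]) (Z w) * W w)%:E))%E.
Proof.
move=> mW W0.
have mI y : measurable_fun setT (fun w => \1_(h @^-1` [set y]) (Z w) : R).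
  have mB : measurable (h @^-1` [set y]) by exact: measurable_funPTI.
  exact: (measurableT_comp (measurable_indic mB) mZ).
under eq_integral do rewrite fimfunE mulrC mulr_fsumr -fsumEFin//.
rewrite ge0_integral_fsum//; last 2 first.
- move=> y; apply/measurable_EFinP; apply: measurable_funM => //.
  by apply: measurable_funM => //; exact: mI.
- move=> y w _; rewrite EFinM mule_ge0 ?lee_fin//; exact: nnfun_muleindic_ge0.
apply: eq_fsbigr => y; rewrite inE => -[t _ <-].
rewrite -ge0_integralZl_EFin//.
- by apply: eq_integral => w _; rewrite mulrC -mulrA EFinM.
- by move=> w _; rewrite lee_fin mulr_ge0.
- by apply/measurable_EFinP; apply: measurable_funM => //; exact: mI.
Qed.

Variables (W : Om -> R) (c : R).
Hypotheses (mW : measurable_fun setT W) (W0 : forall w, 0 <= W w).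
Hypothesis indicE : forall B : set T, measurable B ->
  (\int[Pr]_w (\1_B (Z w) * W w)%:E = c%:E * Pr (Z @^-1` B))%E.

Let nnsfun_ext (h : {nnsfun T >-> R}) :
  (\int[Pr]_w (h (Z w) * W w)%:E = c%:E * \int[Pr]_w (h (Z w))%:E)%E.
Proof.
rewrite nnsfun_sum//.
under [in RHS]eq_integral do rewrite -[h _]mulr1.
rewrite (@nnsfun_sum (fun=> 1) h)// ge0_mule_fsumr; last first.
  move=> y; have [yh|yh] := pselect (exists t, h t = y).
    case: yh => t <-; rewrite mule_ge0 ?lee_fin//.
    by apply: integral_ge0 => w _; rewrite lee_fin mulr_ge0.
  rewrite (_ : (fun w => _) = fun=> 0%E) ?integral0 ?mule0//.
  apply/funext => w; rewrite mulr1 preimage10 ?indic0//.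
  by apply: contra_not yh => -[t _ <-]; exists t.
apply: eq_fsbigr => y; rewrite inE => -[t _ <-].
have mB : measurable (h @^-1` [set h t]) by exact: measurable_funPTI.
rewrite indicE// muleCA; congr (_ * (_ * _))%E.
under eq_integral do rewrite mulr1.
rewrite -[RHS](_ : \int[Pr]_w (\1_(Z @^-1` (h @^-1` [set h t])) w)%:E = _)%E//.
rewrite integral_indic ?setIT//.
by rewrite -[X in measurable X]setTI; exact: mZ.
Qed.

(** Both sides are linear in g and continuous along increasing sequences, so that
    the case of indicators suffices. *)
Lemma indicator_extension (g : T -> R) : measurable_fun setT g -> (forall t, 0 <= g t) ->
  (\int[Pr]_w (g (Z w) * W w)%:E = c%:E * \int[Pr]_w (g (Z w))%:E)%E.
Proof.
move=> mg g0; have mEg : measurable_fun setT (EFin \o g) by exact/measurable_EFinP.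
pose h := nnsfun_approx measurableT mEg.
have cvgh t : (h n t)%:E @[n --> \oo] --> (g t)%:E.
  by apply: (cvg_nnsfun_approx measurableT mEg) => // ? _; rewrite lee_fin.
have ndh : nondecreasing_seq (h : (T -> R)^nat) by exact: nd_nnsfun_approx.
have mh n : measurable_fun setT (fun w => h n (Z w)) by exact: measurableT_comp.
have L : (\int[Pr]_w (h n (Z w) * W w)%:E @[n --> \oo] --> \int[Pr]_w (g (Z w) * W w)%:E)%E.
  rewrite (_ : (\int[Pr]_w (g (Z w) * W w)%:E)%E =
     (\int[Pr]_w (limn (fun n => (h n (Z w) * W w)%:E)))%E); last first.
    apply: eq_integral => w _; apply/esym/cvg_lim => //.
    under eq_fun do rewrite EFinM; rewrite EFinM; apply: cvgeZr => //.
  apply: cvg_monotone_convergence => //.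
  - by move=> n; apply/measurable_EFinP; apply: measurable_funM.
  - by move=> n w _; rewrite lee_fin mulr_ge0.
  - move=> w _ m n mn; rewrite lee_fin ler_wpM2r//; exact/lefP/ndh.
have L' : (\int[Pr]_w (h n (Z w))%:E @[n --> \oo] --> \int[Pr]_w (g (Z w))%:E)%E.
  rewrite (_ : (\int[Pr]_w (g (Z w))%:E)%E =
     (\int[Pr]_w (limn (fun n => (h n (Z w))%:E)))%E); last first.
    by apply: eq_integral => w _; apply/esym/cvg_lim.
  apply: cvg_monotone_convergence => //.
  - by move=> n; apply/measurable_EFinP.
  - by move=> n w _; rewrite lee_fin.
  - by move=> w _ m n mn; rewrite lee_fin; exact/lefP/ndh.
have L2 : (\int[Pr]_w (h n (Z w) * W w)%:E @[n --> \oo] --> c%:E * \int[Pr]_w (g (Z w))%:E)%E.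
  under eq_fun do rewrite nnsfun_ext.
  exact: cvgeZl.
by rewrite -(cvg_lim _ L)// (cvg_lim _ L2).
Qed.

End indicator_extension.

Section exponential.
Context {R : realType}.

(** For s <= 0 this follows from expR s <= (1 - s)^-1, and for s > 0 from the same
    bound at s / 2, squared. *)
Lemma expR_le_quadratic (s : R) : s <= 1 / 3 -> expR s <= 1 + s + s ^+ 2.
Proof.
have inv (t : R) : t < 1 -> expR t <= (1 - t)^-1.
  move=> t1; rewrite -[t]opprK expRN lef_pV2 ?posrE ?expR_gt0 ?subr_gt0 ?opprK//.
  exact: expR_ge1Dx.
have [s0 _|s0 s3] := leP s 0.
  apply: (le_trans (inv s _)); first by rewrite (le_lt_trans s0).
  rewrite -div1r ler_pdivrMr; last by rewrite subr_gt0 (le_lt_trans s0).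
  rewrite -subr_ge0 (_ : _ - 1 = - s * s ^+ 2); last by ring.
  by rewrite mulr_ge0 ?sqr_ge0// oppr_ge0.
have h1 : s / 2 < 1 by lra.
rewrite [s in expR s]splitr expRD.
apply: (@le_trans _ _ ((1 - s / 2)^-1 * (1 - s / 2)^-1)).
  by rewrite ler_pM ?expR_ge0// inv.
rewrite -invfM -div1r ler_pdivrMr; last by rewrite mulr_gt0// subr_gt0.
have s2 : 0 <= s ^+ 2 by exact: sqr_ge0.
have : 0 <= s ^+ 2 * (1 - 3 * s) by rewrite mulr_ge0//; lra.
have : 0 <= s ^+ 2 * s ^+ 2 by rewrite mulr_ge0.
move=> H1 H2; rewrite -subr_ge0.
rewrite (_ : _ - _ = (s ^+ 2 * (1 - 3 * s) + s ^+ 2 * s ^+ 2) / 4).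
  by rewrite divr_ge0// addr_ge0.
by field.
Qed.

(** Clipping from below only decreases the exponential, and the clipped variable
    has a smaller square. *)
Lemma expR_clip_le (l b w : R) : 0 <= l -> 0 <= b -> l * b <= 1 / 3 ->
  expR (- l * Num.max w (- b)) <= 1 - l * w + l ^+ 2 * w ^+ 2.
Proof.
move=> l0 b0 lb; set w' := Num.max w (- b).
have ww' : w <= w' by rewrite le_max lexx.
have bw' : - b <= w' by rewrite le_max lexx orbT.
have sq : w' ^+ 2 <= w ^+ 2.
  rewrite /w'; case: (leP w (- b)) => // wb; rewrite sqrrN; nra.
apply: (le_trans (expR_le_quadratic _)).
  apply: le_trans lb; rewrite mulNr -mulrN ler_wpM2l//; lra.
rewrite mulNr sqrrN exprMn lerD//; last by rewrite ler_wpM2l// sqr_ge0.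
by rewrite lerD2l lerN2 ler_wpM2l.
Qed.

End exponential.

Section independence.
Context {R : realType} {dO dT : measure_display} {Om : measurableType dO}
  {T : measurableType dT} (Pr : probability Om R) {I : finType}.
Variables (Z : I -> Om -> T) (g : I -> T -> R).
Hypotheses (mZ : forall i, measurable_fun setT (Z i)) (indepZ : mutually_independent Pr Z).
Hypotheses (mg : forall i, measurable_fun setT (g i)) (g0 : forall i t, 0 <= g i t).
Hypothesis L1g : forall i, L1 Pr (fun w => g i (Z i w)).

Let factor (s : seq I) (A : I -> set T) i w : R :=
  if i \in s then g i (Z i w) else \1_(A i) (Z i w).

Let mean (s : seq I) (A : I -> set T) i : R :=
  if i \in s then \int[Pr]_w g i (Z i w) else fine (Pr (Z i @^-1` A i)).

Let measurable_preim i B : measurable B -> measurable (Z i @^-1` B).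
Proof. by move=> mB; rewrite -[X in measurable X]setTI; exact: mZ. Qed.

Let expect_prod_mixed (s : seq I) (A : I -> set T) : (forall i, measurable (A i)) ->
  (\int[Pr]_w (\prod_i factor s A i w)%:E = (\prod_i mean s A i)%:E)%E.
Proof.
elim: s A => [|j s IH] A mA.
  have -> : (\int[Pr]_w (\prod_i factor [::] A i w)%:E =
      \int[Pr]_w (\1_(\bigcap_(i in [set` [set: I]%SET]) (Z i @^-1` A i)) w)%:E)%E.
    apply: eq_integral => w _; congr (_%:E); rewrite indicE.
    have [H|H] := boolP (w \in _).
      apply: big1 => i _; rewrite /factor /= indicE mem_set//.
      by move: H; rewrite inE => /(_ i); apply; rewrite /= inE.
    have [i Hi] : exists i, ~ A i (Z i w).
      apply/existsNP => H'; move/negP: H; apply; rewrite inE => i _; exact: H'.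
    by rewrite (bigD1 i)//= /factor /= indicE memNset// mul0r.
  rewrite integral_indic ?setIT//; last first.
    apply: fin_bigcap_measurable => [|i _]; first exact: finite_finset.
    exact: measurable_preim.
  apply: etrans (indepZ [set: I]%SET mA) _.
  transitivity (\prod_i Pr (Z i @^-1` A i))%E.
    by apply: eq_bigl => i; rewrite inE.
  rewrite (big_morph EFin EFinM erefl); apply: eq_bigr => i _.
  by rewrite /mean /= fineK// fin_num_measure//; exact: measurable_preim.
have [js|js] := boolP (j \in s).
  have E i : (i \in j :: s) = (i \in s).
    by rewrite inE; case: eqVneq => // ->; rewrite js.
  rewrite -(_ : \prod_i mean s A i = \prod_i mean (j :: s) A i); last first.
    by apply: eq_bigr => i _; rewrite /mean E.
  rewrite -IH//; apply: eq_integral => w _; congr (_%:E).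
  by apply: eq_bigr => i _; rewrite /factor E.
pose W w := \prod_(i | i != j) factor s A i w.
pose c := \prod_(i | i != j) mean s A i.
have mfactor i : measurable_fun setT (factor s A i).
  rewrite /factor; case: (i \in s); first exact: measurableT_comp.
  exact: (measurableT_comp (measurable_indic (mA i)) (mZ i)).
have mW : measurable_fun setT W.
  rewrite /W; under eq_fun do rewrite big_mkcond.
  by apply: measurable_prod => i _; case: (i != j).
have W0 w : 0 <= W w.
  by apply: prodr_ge0 => i _; rewrite /factor; case: (i \in s).
have H B : measurable B ->
    (\int[Pr]_w (\1_B (Z j w) * W w)%:E = c%:E * Pr (Z j @^-1` B))%E.
  move=> mB; pose A' i := if i == j then B else A i.
  have mA' i : measurable (A' i) by rewrite /A'; case: eqP.
  have := IH A' mA'; rewrite [in RHS](bigD1 j)//= /mean (negbTE js) /A' eqxx EFinM.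
  rewrite fineK; last by rewrite fin_num_measure//; exact: measurable_preim.
  rewrite muleC (eq_bigr (mean s A)); last by move=> i /negbTE ij; rewrite /mean ij.
  rewrite -/c => <-; apply: eq_integral => w _; congr (_%:E).
  rewrite [RHS](bigD1 j)//= /factor (negbTE js) eqxx; congr (_ * _).
  by apply: eq_bigr => i /negbTE ij; rewrite /factor ij.
have := indicator_extension (mZ j) mW W0 H (mg j) (g0 j).
rewrite (EFin_expect (L1g j)) -EFinM => E.
rewrite (bigD1 j)//= {1}/mean inE eqxx/= mulrC.
rewrite (eq_bigr (mean s A)); last first.
  by move=> i /negbTE ij; rewrite /mean inE ij.
rewrite -/c -E; apply: eq_integral => w _; congr (_%:E).
rewrite (bigD1 j)//= {1}/factor inE eqxx/=; congr (_ * _).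
by apply: eq_bigr => i /negbTE ij; rewrite /factor inE ij.
Qed.

(** Multiplicativity of the expectation, by trading indicators for general factors
    one index at a time. *)
Lemma expect_prod :
  (\int[Pr]_w (\prod_i g i (Z i w))%:E = (\prod_i \int[Pr]_w g i (Z i w))%:E)%E.
Proof.
have := @expect_prod_mixed (enum I) (fun=> setT) (fun=> measurableT).
under eq_integral do under eq_bigr do rewrite /factor mem_enum.
by move=> ->; congr (_%:E); apply: eq_bigr => i _; rewrite /mean mem_enum.
Qed.

End independence.

Section chernoff.
Context {R : realType} {dO dT : measure_display} {Om : measurableType dO}
  {T : measurableType dT} {n : nat} (Pr : probability Om R) (P Q : probability T R).
Variables (X Y : 'I_n -> Om -> T).
Hypothesis iid : iid_samples Pr P Q X Y.

Let expect_exp_clip (mu : probability T R) (Z : Om -> T) (U : T -> R) (l b : R) :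
  has_law Pr Z mu ->
  0 <= l -> 0 <= b -> l * b <= 1 / 3 -> L1 mu U -> L1 mu (fun t => U t ^+ 2) ->
  L1 Pr (fun w => expR (- l * Num.max (U (Z w)) (- b))) /\
  \int[Pr]_w expR (- l * Num.max (U (Z w)) (- b)) <=
    expR (- l * \int[mu]_t U t + l ^+ 2 * \int[mu]_t (U t ^+ 2)).
Proof.
move=> lawZ l0 b0 lb I1 I2.
have mU := L1_measurable I1.
have Iq : L1 mu (fun t => 1 - l * U t + l ^+ 2 * U t ^+ 2).
  by apply: L1D (L1Z _ I2); apply: L1B; [exact: L1_cst|exact: L1Z].
have Ie : L1 mu (fun t => expR (- l * Num.max (U t) (- b))).
  apply: L1_le Iq => [|t]; last by rewrite ger0_norm ?expR_ge0// expR_clip_le.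
  apply: measurableT_comp => //; apply: measurable_funM => //.
  exact: measurable_maxr.
split; first exact: (L1_law lawZ Ie).
rewrite (expect_law lawZ Ie).
apply: (@le_trans _ _ (\int[mu]_t (1 - l * U t + l ^+ 2 * U t ^+ 2))).
  by apply: expect_le => // t; exact: expR_clip_le.
rewrite expectD; [|by apply: L1B; [exact: L1_cst|exact: L1Z]|exact: L1Z].
rewrite expectB ?expect_cst; [|exact: L1_cst|exact: L1Z].
rewrite !expectZ//; apply: le_trans (expR_ge1Dx _).
by rewrite mulNr addrA.
Qed.

(** Chernoff's bound for the lower tail.  Clipping at -b costs nothing: it increases
    the variables, while the exponential of the clipped ones is still controlled by
    the first two moments of the original ones. *)
Lemma chernoff_lower_tail (U V : T -> R) (l b A : R) :
  0 < l -> 0 <= b -> l * b <= 1 / 3 ->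
  L1 P U -> L1 P (fun t => U t ^+ 2) -> L1 Q V -> L1 Q (fun t => V t ^+ 2) ->
  (Pr [set w | (\sum_(i < n) Num.max (U (X i w)) (- b)
              + \sum_(i < n) Num.max (V (Y i w)) (- b) < A)%R] <=
   (expR (l * A + n%:R * (- l * (\int[P]_t U t + \int[Q]_t V t)
     + l ^+ 2 * (\int[P]_t (U t ^+ 2) + \int[Q]_t (V t ^+ 2)))))%:E)%E.
Proof.
move=> l0 b0 lb U1 U2 V1 V2; have [lawX lawY ind] := iid.
pose S w := \sum_(i < n) Num.max (U (X i w)) (- b)
  + \sum_(i < n) Num.max (V (Y i w)) (- b); rewrite -[X in Pr X]/[set w | S w < A].
pose ZZ (k : 'I_n + 'I_n) := match k with inl i => X i | inr j => Y j end.
pose g (k : 'I_n + 'I_n) t := expR (- l * Num.max (if k is inl _ then U t else V t) (- b)).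
have mU := L1_measurable U1; have mV := L1_measurable V1.
have mZZ k : measurable_fun setT (ZZ k).
  by case: k => i /=; [case: (lawX i)|case: (lawY i)].
have mg k : measurable_fun setT (g k).
  apply: measurableT_comp => //; apply: measurable_funM => //.
  by apply: measurable_maxr => //; case: k.
have Hg k : L1 Pr (fun w => g k (ZZ k w)) /\
    \int[Pr]_w g k (ZZ k w) <= expR (if k is inl _
      then - l * \int[P]_t U t + l ^+ 2 * \int[P]_t (U t ^+ 2)
      else - l * \int[Q]_t V t + l ^+ 2 * \int[Q]_t (V t ^+ 2)).
  by case: k => i; [exact: (expect_exp_clip (lawX i) (ltW l0))|
                    exact: (expect_exp_clip (lawY i) (ltW l0))].
have Eprod w : \prod_k g k (ZZ k w) = expR (- l * S w).
  rewrite big_sumType /= -!expR_sum -expRD /S mulrDr !mulr_sumr.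
  by congr (expR (_ + _)).
have mS : measurable_fun setT S.
  apply: measurable_funD; apply: measurable_sum => i; apply: measurable_maxr => //.
    by apply: measurableT_comp => //; case: (lawX i).
  by apply: measurableT_comp => //; case: (lawY i).
have mA : measurable [set w | S w < A].
  rewrite (_ : [set w | S w < A] = setT `&` S @^-1` [set` `]-oo, A[]); first exact: mS.
  by apply/seteqP; split => w /=; rewrite in_itv/= => // -[].
have mE : measurable_fun setT (fun w => expR (- l * S w)).
  by apply: measurableT_comp => //; exact: measurable_funM.
apply: (@le_trans _ _ ((expR (l * A))%:E * \int[Pr]_w (expR (- l * S w))%:E)%E).
  rewrite (_ : Pr _ = \int[Pr]_w (\1_[set w | S w < A] w)%:E)%E; last first.
    by rewrite integral_indic ?setIT.
  rewrite -ge0_integralZl_EFin ?expR_ge0//; last exact/measurable_EFinP.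
  apply: ge0_integral_mono => w; first by rewrite lee_fin.
  rewrite -EFinM lee_fin indicE; case: (boolP (w \in _)) => [|_]; last first.
    by rewrite mulr_ge0 ?expR_ge0.
  rewrite inE /= => SA; rewrite -expRD -[leLHS]expR0 ler_expR.
  by rewrite mulNr -mulrBr mulr_ge0 ?(ltW l0)// subr_ge0 ltW.
under eq_integral do rewrite -Eprod.
rewrite (expect_prod mZZ ind mg) => [|k t|k]; last 2 first.
- exact: expR_ge0.
- by case: (Hg k).
rewrite -EFinM lee_fin expRD ler_wpM2l ?expR_ge0//.
apply: (@le_trans _ _ (\prod_(k : 'I_n + 'I_n) expR (if k is inl _
      then - l * \int[P]_t U t + l ^+ 2 * \int[P]_t (U t ^+ 2)
      else - l * \int[Q]_t V t + l ^+ 2 * \int[Q]_t (V t ^+ 2)))).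
  apply: ler_prod => k _; apply/andP; split; last by case: (Hg k).
  by apply: expect_ge0 => w; exact: expR_ge0.
rewrite -expR_sum big_sumType /= !sumr_const card_ord -mulrnDl.
by rewrite ler_expR -[leLHS]mulr_natl le_eqVlt; apply/orP; left; apply/eqP; ring.
Qed.

End chernoff.

(** * Truncated conjugates and the semidual gap *)

Section conjugates.
Context {R : realType} {d : nat}.
Implicit Types (phi : 'rV[R]_d -> R) (x y : 'rV[R]_d) (S : set 'rV[R]_d).

Definition conj_on S phi y : \bar R := ereal_sup [set (dotrV x y - phi x)%:E | x in S].

Lemma conjugateE phi : conjugate phi = conj_on setT phi.
Proof. by []. Qed.

Lemma conj_on_ge S phi x y : S x -> ((dotrV x y - phi x)%:E <= conj_on S phi y)%E.
Proof. by move=> Sx; apply: ereal_sup_ubound; exists x. Qed.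

Lemma conj_on_le S phi y (c : \bar R) :
  (forall x, S x -> ((dotrV x y - phi x)%:E <= c)%E) -> (conj_on S phi y <= c)%E.
Proof. by move=> H; apply: ge_ereal_sup => _ [x Sx <-]; exact: H. Qed.

Lemma conj_on_subset S S' phi y : S `<=` S' -> (conj_on S phi y <= conj_on S' phi y)%E.
Proof. by move=> SS'; apply: conj_on_le => x /SS'; exact: conj_on_ge. Qed.

Lemma conj_on_ge0 S phi y : phi 0 = 0 -> S 0 -> (0 <= conj_on S phi y)%E.
Proof.
by move=> phi0 /(conj_on_ge phi y); rewrite dotrV0l phi0 subrr.
Qed.

(** A supremum of continuous functions of y is lower semicontinuous. *)
Lemma measurable_conj_on S phi :
  measurable_fun [set: borelrV R d] (conj_on S phi : borelrV R d -> \bar R).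
Proof.
apply: (measurability _ (ErealGenOInfty.measurableE R)).
move=> /= _ [_ [a ->]] <-; rewrite setTI; apply: open_borelrV.
rewrite (_ : _ @^-1` _ = \bigcup_(x in S) ((dotrV x) @^-1` [set t : R | a + phi x < t])).
  apply: bigcup_open => x Sx; apply: open_comp => [y _|]; last exact: open_gt.
  rewrite (_ : dotrV x = dotrV ^~ x); first exact: dotrV_continuous.
  by apply/funext => z; rewrite dotrVC.
apply/seteqP; split=> y /=; rewrite in_itv/= andbT.
  move=> /ereal_sup_gt[_ [x Sx <-]]; rewrite lte_fin ltrBrDr => H.
  by exists x.
move=> [x Sx /= H]; apply: lt_le_trans (conj_on_ge phi y Sx).
by rewrite lte_fin ltrBrDr.
Qed.

Lemma measurable_fine_conj_on S phi :
  measurable_fun [set: borelrV R d] (fun y : borelrV R d => fine (conj_on S phi y)).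
Proof. by apply: (measurableT_comp (f := fine)) => //; exact: measurable_conj_on. Qed.

(** Fenchel's equality at a gradient, from the convexity of phi. *)
Lemma conjugate_grad phi x : convex_function [set: 'rV[R]_d] phi ->
  differentiable phi x ->
  conjugate phi (grad phi x) = (dotrV x (grad phi x) - phi x)%:E.
Proof.
move=> cphi dphi; apply/eqP; rewrite eq_le conjugateE conj_on_ge// andbT.
apply: conj_on_le => z _; rewrite lee_fin.
have := convex_above_tangent (z - x) cphi dphi.
rewrite (addrC x) subrK dotrVBr (dotrVC z) (dotrVC x); lra.
Qed.

(** Strong convexity makes Fenchel's inequality quadratically tight. *)
Lemma strongly_convex_conj_le alpha a phi x y : (0 < d)%N -> 0 < alpha -> 0 <= a ->
  strongly_convex alpha a phi ->
  (conjugate phi y <=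
   (dotrV x y - phi x + enorm (grad phi x - y) ^+ 2 / (2 * alpha))%:E)%E.
Proof.
move=> d0 alpha0 a0 sc; rewrite conjugateE; apply: conj_on_le => z _; rewrite lee_fin.
pose v := z - x; have -> : z = x + v by rewrite addrC subrK.
have := strongly_convexP d0 alpha0 a0 sc x v.
move=> H; rewrite dotrVDl (dotrVC v).
set g := grad phi x in H *.
have cs := cauchy_schwarz (y - g) v; rewrite dotrVBl enormB in cs.
set t := enorm v in H cs *; set s := enorm (g - y) in cs *.
have : 0 <= (s - alpha * t) ^+ 2 / (2 * alpha) by rewrite divr_ge0 ?sqr_ge0// mulr_ge0// ltW.
rewrite (_ : _ / _ = s ^+ 2 / (2 * alpha) - s * t + alpha / 2 * t ^+ 2); last first.
  by field; rewrite gt_eqF.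
lra.
Qed.

Definition eball (r : R) : set 'rV[R]_d := [set x | enorm x <= r].

(** The conjugate of a potential that is not strongly convex may be infinite; its
    restriction to slopes of points of a ball is real and Lipschitz in phi. *)
Definition tconj (r : R) phi y : R := fine (conj_on (eball r) phi y).

Lemma measurable_tconj r phi :
  measurable_fun [set: borelrV R d] (tconj r phi : borelrV R d -> R).
Proof. exact: measurable_fine_conj_on. Qed.

Section truncated.
Variables (B : R) (k : nat) (r : R).
Hypotheses (B0 : 0 <= B) (r0 : 0 <= r).

Let le_ball phi x : controlled B k phi -> enorm x <= r -> `|phi x| <= B * (1 + r) ^+ k.
Proof.
move=> cphi xr; apply: (le_trans (controlled_le cphi x)).
rewrite ler_wpM2l// lerXn2r ?nnegrE ?addr_ge0 ?enorm_ge0//.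
by rewrite lerD2l.
Qed.

Lemma tconjE phi y : controlled B k phi -> conj_on (eball r) phi y = (tconj r phi y)%:E.
Proof.
move=> cphi; rewrite /tconj fineK// ge0_fin_numE; last first.
  by apply: conj_on_ge0; [exact: controlled0 cphi|rewrite /eball/= enorm0].
apply: (@le_lt_trans _ _ (r * enorm y + B * (1 + r) ^+ k)%:E); last exact: ltry.
apply: conj_on_le => x xr; rewrite lee_fin; apply: lerD.
  by rewrite (le_trans (cauchy_schwarz _ _))// ler_wpM2r ?enorm_ge0.
by rewrite (le_trans _ (le_ball cphi xr))// -normrN ler_norm.
Qed.

Lemma tconj_ge phi x y : controlled B k phi -> enorm x <= r ->
  dotrV x y - phi x <= tconj r phi y.
Proof. by move=> cphi xr; rewrite -lee_fin -tconjE//; exact: conj_on_ge. Qed.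

Lemma tconj_le phi y c : controlled B k phi ->
  (forall x, enorm x <= r -> dotrV x y - phi x <= c) -> tconj r phi y <= c.
Proof.
move=> cphi H; rewrite -lee_fin -tconjE//; apply: conj_on_le => x xr.
by rewrite lee_fin H.
Qed.

Lemma tconj_ge0 phi y : controlled B k phi -> 0 <= tconj r phi y.
Proof.
move=> cphi; have := @tconj_ge phi 0 y cphi; rewrite enorm0 => /(_ r0).
by rewrite dotrV0l (controlled0 cphi) subrr.
Qed.

Lemma tconj_le_growth phi y : controlled B k phi ->
  tconj r phi y <= r * enorm y + B * (1 + r) ^+ k.
Proof.
move=> cphi; apply: tconj_le => // x xr; apply: lerD.
  by rewrite (le_trans (cauchy_schwarz _ _))// ler_wpM2r ?enorm_ge0.
by rewrite (le_trans _ (le_ball cphi xr))// -normrN ler_norm.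
Qed.

Lemma tconj_conjugate phi y : controlled B k phi ->
  ((tconj r phi y)%:E <= conjugate phi y)%E.
Proof. by move=> cphi; rewrite -tconjE//; exact: conj_on_subset. Qed.

Lemma tconj_lip phi phi' y c : controlled B k phi -> controlled B k phi' ->
  (forall x, enorm x <= r -> phi' x - phi x <= c) ->
  tconj r phi y <= tconj r phi' y + c.
Proof.
move=> cphi cphi' H; apply: tconj_le => // x xr.
have := tconj_ge y cphi' xr; have := H x xr; lra.
Qed.

End truncated.
End conjugates.

Section gap.
Context {R : realType} {d : nat} (B : R) (k : nat) (phi0 : 'rV[R]_d -> R).
Hypotheses (B1 : 1 <= B) (cphi0 : controlled B k phi0).
Implicit Types (phi : 'rV[R]_d -> R) (x y : 'rV[R]_d).

(** The integrand of the excess of the semidual objective over its value at phi0,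
    at y = grad phi0 x and with the conjugate truncated. *)
Definition gap (r : R) phi x : R :=
  phi x + tconj (r + 1) phi (grad phi0 x) - dotrV x (grad phi0 x).

(** Bounds the constants of a controlled potential on the ball of radius r + 1. *)
Definition scale (r : R) : R := B * (2 + r) ^+ k.+1.

Let B0 : 0 <= B. Proof. exact: le_trans B1. Qed.

Lemma measurable_controlled phi : controlled B k phi ->
  measurable_fun [set: borelrV R d] (phi : borelrV R d -> R).
Proof.
move=> c; apply: continuous_borelrV => x; apply: differentiable_continuous.
exact: controlled_differentiable c x.
Qed.

Lemma measurable_grad : measurable_fun [set: borelrV R d] (grad phi0 : borelrV R d -> borelrV R d).
Proof. by apply: continuous_borelrV_map; exact: controlled_grad_continuous cphi0. Qed.

Lemma measurable_gap r phi : controlled B k phi ->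
  measurable_fun [set: borelrV R d] (gap r phi : borelrV R d -> R).
Proof.
move=> c; apply: measurable_funB; first apply: measurable_funD.
- exact: measurable_controlled.
- exact: (measurableT_comp (measurable_tconj (r + 1) phi) measurable_grad).
- apply: measurable_sum => i; apply: measurable_funM; apply: continuous_borelrV.
    exact: coord_continuous.
  move=> x; apply: (continuous_comp (f := grad phi0) (g := fun y : 'rV[R]_d => y 0 i)).
    exact: controlled_grad_continuous cphi0 x.
  exact: coord_continuous.
Qed.

Lemma grad_diff_le phi x : controlled B k phi ->
  enorm (grad phi x - grad phi0 x) <= 2 * B * (1 + enorm x) ^+ k.
Proof.
move=> c; rewrite (le_trans (ler_enormB _ _))// -mulrA mulr_natl mulr2n.
by apply: lerD; [exact: controlled_grad_le c x|exact: controlled_grad_le cphi0 x].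
Qed.

Section radius.
Variable r : R.
Hypothesis r0 : 0 <= r.
Let N := scale r.

Let r2 : 1 <= 2 + r. Proof. by rewrite -addrA lerDl addr_ge0. Qed.
Let r20 : 0 <= 2 + r. Proof. exact: le_trans r2. Qed.

Lemma scale_ge1 : 1 <= scale r.
Proof. by rewrite mulr_ege1// exprn_ege1. Qed.

Let N1 : 1 <= N. Proof. exact: scale_ge1. Qed.
Let N_gt0 : 0 < N. Proof. exact: lt_le_trans N1. Qed.

Let le_scale (s : R) : 0 <= s -> s <= 2 + r -> B * s ^+ k <= N.
Proof.
move=> s0 sr; rewrite ler_wpM2l// (@le_trans _ _ ((2 + r) ^+ k))//.
  by rewrite lerXn2r ?nnegrE.
by rewrite ler_weXn2l.
Qed.

(** Moving from x in the direction grad phi0 x - grad phi x, with a step small enough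
    to stay in the ball, lower-bounds the truncated conjugate. *)
Lemma grad_dist_le_gap phi x : controlled B k phi -> enorm x <= r ->
  enorm (grad phi x - grad phi0 x) ^+ 2 <= 4 * N * gap r phi x.
Proof.
move=> c xr; have x0 := enorm_ge0 x.
have vN : enorm (grad phi x - grad phi0 x) <= 2 * N.
  rewrite (le_trans (grad_diff_le x c))// -mulrA ler_wpM2l//.
  by apply: le_scale; lra.
rewrite enormB in vN *; set v := grad phi0 x - grad phi x in vN *.
pose eta := (2 * N)^-1; have eta0 : 0 < eta by rewrite invr_gt0 mulr_gt0.
have ev : enorm (eta *: v) <= 1.
  rewrite enormZ gtr0_norm// mulrC ler_pdivrMr; first by rewrite mul1r.
  by rewrite mulr_gt0.
have xv : enorm (x + eta *: v) <= r + 1 by rewrite (le_trans (ler_enormD _ _))// lerD.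
have r10 : 0 <= r + 1 by rewrite addr_ge0.
have H1 := tconj_ge B0 r10 (grad phi0 x) c xv.
have H2 := controlled_taylor c x (eta *: v).
have ev0 := enorm_ge0 (eta *: v).
have H3 : B * (1 + enorm x + enorm (eta *: v)) ^+ k * enorm (eta *: v) ^+ 2
    <= N * (eta ^+ 2 * enorm v ^+ 2).
  have <- : enorm (eta *: v) ^+ 2 = eta ^+ 2 * enorm v ^+ 2.
    by rewrite enormZ exprMn (gtr0_norm eta0).
  by rewrite ler_wpM2r ?sqr_ge0// le_scale//; lra.
have H4 : dotrV (grad phi0 x) v - dotrV (grad phi x) v = enorm v ^+ 2.
  by rewrite -dotrVBl enorm_sqr.
move: H1 H2; rewrite dotrVDl dotrVZl dotrVZr (dotrVC v) => H1 H2.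
have H5 : N * (eta ^+ 2 * enorm v ^+ 2) = eta / 2 * enorm v ^+ 2.
  by rewrite /eta; field; rewrite gt_eqF.
have H6 : eta / 2 * enorm v ^+ 2 <= gap r phi x.
  rewrite /gap; move: H1 H2 H3 H5; set t := enorm v ^+ 2 in H4 *.
  move: H4; set a := dotrV (grad phi0 x) v; set b := dotrV (grad phi x) v.
  move=> H4; have : eta * (a - b) = eta * t by rewrite H4.
  lra.
have -> : enorm v ^+ 2 = 4 * N * (eta / 2 * enorm v ^+ 2).
  by rewrite /eta; field; rewrite gt_eqF.
by rewrite ler_wpM2l// mulr_ge0// ltW.
Qed.

Lemma gap_near_ge0 phi x : controlled B k phi -> enorm x <= r -> 0 <= gap r phi x.
Proof.
move=> c xr; have := le_trans (sqr_ge0 _) (grad_dist_le_gap c xr).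
by rewrite pmulr_rge0// mulr_gt0.
Qed.

Lemma gap_near_le phi x : controlled B k phi -> enorm x <= r -> gap r phi x <= 4 * N.
Proof.
move=> c xr; have x0 := enorm_ge0 x; have r10 : 0 <= r + 1 by rewrite addr_ge0.
set y := grad phi0 x.
have ball z : enorm z <= r + 1 -> `|phi z| <= N.
  move=> zr; have z0 := enorm_ge0 z; apply: (le_trans (controlled_le c z)).
  by apply: le_scale; lra.
have yN : enorm y <= B * (2 + r) ^+ k.
  apply: (le_trans (controlled_grad_le cphi0 x)); rewrite ler_wpM2l//.
  by rewrite lerXn2r ?nnegrE//; lra.
rewrite /gap lerBlDr -lerBrDl; apply: (tconj_le B0 r10 c) => z zr.
have zx : enorm (z - x) <= 2 * (2 + r).
  by rewrite (le_trans (ler_enormB _ _))//; lra.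
have : dotrV (z - x) y <= 2 * N.
  rewrite (le_trans (cauchy_schwarz _ _))//.
  apply: (@le_trans _ _ (2 * (2 + r) * (B * (2 + r) ^+ k))).
    by rewrite ler_pM ?enorm_ge0.
  by rewrite /N /scale exprS le_eqVlt; apply/orP; left; apply/eqP; ring.
rewrite dotrVBl -/y.
have h1 := ball z zr; have h2 : `|phi x| <= N by apply: ball; lra.
move: h1 h2; rewrite !ler_norml => /andP[h1 h2] /andP[h3 h4]; lra.
Qed.

Lemma gap_growth phi x : controlled B k phi ->
  `|gap r phi x| <= 4 * N * (1 + enorm x) ^+ k.+1.
Proof.
move=> c; have r10 : 0 <= r + 1 by rewrite addr_ge0.
have u1 := enorm1_ge1 x; set u := 1 + enorm x in u1 *.
have u0 : 0 <= u by exact: le_trans u1.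
have uk : u ^+ k <= u ^+ k.+1 by rewrite ler_weXn2l.
have uk1 : 1 <= u ^+ k.+1 by rewrite exprn_ege1.
have uk0 : 0 <= u ^+ k by rewrite exprn_ge0.
set y := grad phi0 x.
have y1 : enorm y <= B * u ^+ k := controlled_grad_le cphi0 x.
have BN : B * 1 <= N by rewrite -(expr1n _ k); apply: le_scale => //; lra.
have h1 : `|phi x| <= N * u ^+ k.+1.
  by rewrite (le_trans (controlled_le c x))// ler_pM// -[B]mulr1.
have h2 : `|dotrV x y| <= N * u ^+ k.+1.
  rewrite (le_trans (normr_dotrV _ _))// (@le_trans _ _ (u * (B * u ^+ k)))//.
    by rewrite ler_pM ?enorm_ge0// lerDr.
  by rewrite mulrCA -exprS ler_wpM2r ?exprn_ge0// -[B]mulr1.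
have h3 : `|tconj (r + 1) phi y| <= 2 * N * u ^+ k.+1.
  rewrite ger0_norm ?(tconj_ge0 B0 r10 _ c)//.
  apply: (le_trans (tconj_le_growth B0 r10 _ c)).
  rewrite -mulrA mulr_natl mulr2n; apply: lerD.
    apply: (@le_trans _ _ ((2 + r) * (B * u ^+ k))).
      by rewrite ler_pM ?enorm_ge0//; lra.
    rewrite mulrCA mulrA ler_pM// ?mulr_ge0// ler_wpM2l//.
    by rewrite exprS ler_peMr// exprn_ege1.
  apply: (@le_trans _ _ (N * 1)); last by rewrite ler_wpM2l// ltW.
  by rewrite mulr1; apply: le_scale; lra.
rewrite /gap -/y (le_trans (ler_normB _ _))//.
have := ler_normD (phi x) (tconj (r + 1) phi y).
lra.
Qed.

End radius.
End gap.

(** * Moments of the centred empirical terms *)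

Lemma L1_law_inv (R : realType) (dO dT : measure_display) (Om : measurableType dO)
    (T : measurableType dT) (Pr : probability Om R) (mu : probability T R)
    (X : Om -> T) (g : T -> R) : has_law Pr X mu -> measurable_fun setT g ->
  L1 Pr (fun w => g (X w)) -> L1 mu g.
Proof.
move=> lawX mg I; apply/integrableP; split; first exact/measurable_EFinP.
rewrite -(ge0_expect_law lawX (g := fun y => `|(EFin \o g) y|%E))//.
  by case/integrableP : I.
by apply: measurableT_comp => //; exact/measurable_EFinP.
Qed.

Section gap_moments.
Context {R : realType} {d : nat} (P Q : probability (borelrV R d) R).
Variables (B : R) (k : nat) (phi0 phi : 'rV[R]_d -> R) (CPI r tau : R).
Hypotheses (B1 : 1 <= B) (cphi0 : controlled B k phi0) (cphi : controlled B k phi).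
Hypothesis convex0 : convex_function [set: 'rV[R]_d] phi0.
Hypotheses (CPI0 : 0 <= CPI) (r0 : 0 <= r).
Hypothesis poinc : real_poincare P CPI.
Hypothesis polyL1 : forall q, L1 P (fun x => (1 + enorm x) ^+ q).
Hypothesis tailP :
  \int[P]_x ((1 + enorm x) ^+ (2 * k.+1) * \1_(far r) x) <= tau.
Hypothesis lawQ : has_law P (grad phi0 : borelrV R d -> borelrV R d) Q.

Let N := scale B k r.
Let N1 : 1 <= N. Proof. exact: scale_ge1. Qed.
Let N0 : 0 <= N. Proof. exact: le_trans N1. Qed.
Let B0 : 0 <= B. Proof. exact: le_trans B1. Qed.
Let G x := gap phi0 r phi x.
Let u (x : 'rV[R]_d) := 1 + enorm x.
Let I (x : 'rV[R]_d) : R := \1_(far r) x.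
Let u1 x : 1 <= u x. Proof. exact: enorm1_ge1. Qed.
Let u0 x : 0 <= u x. Proof. exact: le_trans (u1 x). Qed.
Let uX q x : 1 <= u x ^+ q. Proof. exact: exprn_ege1. Qed.
Let uXX q q' x : (q <= q')%N -> u x ^+ q <= u x ^+ q'.
Proof. by move=> qq; rewrite ler_weXn2l. Qed.

Let BN : B <= N.
Proof. by rewrite /N /scale ler_peMr// exprn_ege1// -addrA lerDl addr_ge0. Qed.

Let IP x : (r < enorm x /\ I x = 1) \/ (enorm x <= r /\ I x = 0).
Proof.
rewrite /I indicE; have [h|h] := ltP r (enorm x); [left|right]; split=> //.
  by rewrite mem_set.
by rewrite memNset// /far/= => /lt_geF; rewrite h.
Qed.

Let poly_le (f : 'rV[R]_d -> R) c q : measurable_fun [set: borelrV R d] f ->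
  (forall x, `|f x| <= c * u x ^+ q) -> L1 P f.
Proof. by move=> mf H; apply: (L1_le mf H); apply: L1Z. Qed.

(** Only the ball is kept, where the gap is nonnegative. *)
Definition near_gap : R := \int[P]_x (gap phi0 r phi x * (1 - \1_(far r) x)).
Let e := near_gap.

Let mI : measurable_fun [set: borelrV R d] I.
Proof. exact: measurable_indic (measurable_far r). Qed.

Let mG : measurable_fun [set: borelrV R d] G.
Proof. exact: (measurable_gap cphi0 r cphi). Qed.

Let G_L1 : L1 P G.
Proof. by apply: (poly_le mG) => x; exact: (gap_growth B1 cphi0 r0 _ cphi). Qed.

Let G2_L1 : L1 P (fun x => G x ^+ 2).
Proof.
apply: (@poly_le _ ((4 * N) ^+ 2) (2 * k.+1)); first exact: measurable_funX.
move=> x; rewrite normrX mulnC exprM -exprMn.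
have h := gap_growth B1 cphi0 r0 x cphi.
by rewrite lerXn2r// nnegrE// (le_trans _ h).
Qed.

Lemma near_gap_L1 : L1 P (fun x => gap phi0 r phi x * (1 - \1_(far r) x)).
Proof.
apply: (@poly_le _ (4 * N) k.+1).
  by apply: measurable_funM => //; apply: measurable_funB.
move=> x; rewrite normrM -/(I x) -/(G x); case: (IP x) => -[_ ->].
  by rewrite subrr normr0 mulr0 mulr_ge0 ?exprn_ge0// mulr_ge0.
by rewrite subr0 normr1 mulr1; exact: (gap_growth B1 cphi0 r0 _ cphi).
Qed.

Let near_L1 : L1 P (fun x => G x * (1 - I x)). Proof. exact: near_gap_L1. Qed.

Lemma near_gap_ge0 : 0 <= near_gap.
Proof.
apply: expect_ge0 => x; case: (IP x) => -[xr]; rewrite /I => ->.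
  by rewrite subrr mulr0.
by rewrite subr0 mulr1 (gap_near_ge0 B1 cphi0 r0).
Qed.

Let tail_L1 : L1 P (fun x => u x ^+ (2 * k.+1) * I x).
Proof.
apply: (@poly_le _ 1 (2 * k.+1)).
  apply: measurable_funM => //; exact: measurable_enorm_pow.
move=> x; have ux0 := le_trans ler01 (uX (2 * k.+1) x).
by rewrite mul1r normrM ger0_norm// ler_piMr//; case: (IP x) => -[_ ->]; rewrite ?normr1 ?normr0.
Qed.

Let tau0 : 0 <= tau.
Proof.
apply: le_trans tailP; apply: expect_ge0 => x; rewrite mulr_ge0//.
by rewrite exprn_ge0// addr_ge0// enorm_ge0.
Qed.

Let split_le (f : 'rV[R]_d -> R) (c1 c2 : R) : L1 P f -> 0 <= c2 ->
  (forall x, f x <= c1 * (G x * (1 - I x)) + c2 * (u x ^+ (2 * k.+1) * I x)) ->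
  \int[P]_x f x <= c1 * e + c2 * tau.
Proof.
move=> If c20 H; apply: (@le_trans _ _
    (\int[P]_x (c1 * (G x * (1 - I x)) + c2 * (u x ^+ (2 * k.+1) * I x)))).
  by apply: expect_le => //; apply: L1D; exact: L1Z.
rewrite expectD; [|exact: L1Z|exact: L1Z].
by rewrite !expectZ// lerD2l ler_wpM2l.
Qed.

Let expect_gap_ge : e - 4 * N * tau <= \int[P]_x G x.
Proof.
have H : \int[P]_x (- G x) <= -1 * e + 4 * N * tau.
  apply: split_le; [exact: L1N|by rewrite mulr_ge0|] => x.
  have := gap_growth B1 cphi0 r0 x cphi; rewrite -/(G x) -/(u x) ler_norml => /andP[h1 h2].
  case: (IP x) => -[_ ->].
    rewrite subrr !mulr0 add0r mulr1 lerNl (le_trans _ h1)// lerN2.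
    by apply: ler_wpM2l; [rewrite mulr_ge0|apply: uXX; rewrite leq_pmull].
  by rewrite subr0 mulr1 !mulr0 addr0 mulN1r.
have : \int[P]_x (- G x) = - \int[P]_x G x.
  by rewrite -mulN1r -expectZ//; apply: eq_Rintegral => x _; rewrite mulN1r.
move=> E; rewrite E in H; lra.
Qed.

Let expect_gap_sqr_le : \int[P]_x (G x ^+ 2) <= 4 * N * e + 16 * N ^+ 2 * tau.
Proof.
apply: split_le => //; first by rewrite mulr_ge0 ?sqr_ge0.
move=> x; case: (IP x) => -[xr ->].
  rewrite subrr !mulr0 add0r mulr1.
  have := gap_growth B1 cphi0 r0 x cphi; rewrite -/(G x) -/(u x) => h.
  rewrite -(real_normK (num_real (G x))) mulnC exprM (_ : 16 * N ^+ 2 = (4 * N) ^+ 2).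
    by rewrite -exprMn lerXn2r// nnegrE// (le_trans _ h).
  ring.
rewrite subr0 mulr1 !mulr0 addr0 expr2 ler_wpM2r//.
  exact: (gap_near_ge0 B1 cphi0 r0).
exact: (gap_near_le B1 cphi0 r0).
Qed.

Let f x := phi x - phi0 x.
Let df x : differentiable f x.
Proof.
by apply: differentiableB; [exact: (controlled_differentiable cphi)|
  exact: (controlled_differentiable cphi0)].
Qed.

Let grad_f x : grad f x = grad phi x - grad phi0 x.
Proof.
apply/rowP => i; rewrite !mxE deriveB//; apply: diff_derivable.
  exact: (controlled_differentiable cphi).
exact: (controlled_differentiable cphi0).
Qed.

Let measurable_enorm_grad :
  measurable_fun [set: borelrV R d] (fun x => enorm (grad phi x - grad phi0 x) ^+ 2).
Proof.
apply: measurable_funX; apply: continuous_borelrV => x.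
apply: (continuous_comp (f := fun x => grad phi x - grad phi0 x) (g := enorm)).
  apply: continuousB; first exact: controlled_grad_continuous cphi x.
  exact: controlled_grad_continuous cphi0 x.
exact: enorm_continuous.
Qed.

Let grad_sqr_le x : enorm (grad phi x - grad phi0 x) ^+ 2 <= 4 * B ^+ 2 * u x ^+ (2 * k.+1).
Proof.
have := grad_diff_le cphi0 x cphi; rewrite -/(u x) => h.
apply: (@le_trans _ _ ((2 * B * u x ^+ k) ^+ 2)).
  by rewrite lerXn2r// nnegrE ?enorm_ge0// (le_trans _ h)// enorm_ge0.
rewrite !exprMn -exprM (_ : 2 ^+ 2 = 4); last by rewrite expr2; lra.
by apply: ler_wpM2l; [rewrite mulr_ge0// sqr_ge0|apply: uXX; rewrite mulnC leq_mul2l leqnSn].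
Qed.

Lemma grad_dist_L1 : L1 P (fun x => enorm (grad phi x - grad phi0 x) ^+ 2).
Proof.
apply: (@poly_le _ (4 * B ^+ 2) (2 * k.+1)) => // x.
by rewrite ger0_norm ?sqr_ge0.
Qed.

Lemma expect_grad_le_cst : \int[P]_x (enorm (grad phi x - grad phi0 x) ^+ 2)
  <= 4 * B ^+ 2 * \int[P]_x ((1 + enorm x) ^+ (2 * k.+1)).
Proof.
rewrite -expectZ//; apply: (expect_le grad_dist_L1 _ grad_sqr_le).
exact: L1Z.
Qed.

Lemma expect_grad_le :
  \int[P]_x (enorm (grad phi x - grad phi0 x) ^+ 2) <= 4 * N * e + 4 * N ^+ 2 * tau.
Proof.
apply: split_le; [exact: grad_dist_L1|by rewrite mulr_ge0 ?sqr_ge0|] => x.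
case: (IP x) => -[xr ->].
  rewrite subrr !mulr0 add0r mulr1 (le_trans (grad_sqr_le x))// ler_wpM2r//.
    by rewrite (le_trans ler01).
  by rewrite ler_wpM2l// lerXn2r ?nnegrE.
by rewrite subr0 mulr1 !mulr0 addr0; exact: (grad_dist_le_gap B1 cphi0 r0).
Qed.

Let m := \int[P]_x f x.
(** The terms of the empirical excess objective, centred by opposite constants: their
    sum is unchanged and the first one has mean zero under P. *)
Definition centredP x := phi x - phi0 x - \int[P]_y (phi y - phi0 y).
Definition centredQ y :=
  tconj (r + 1) phi y - fine (conjugate phi0 y) + \int[P]_x (phi x - phi0 x).
Let U := centredP.
Let V := centredQ.

Let mf : measurable_fun [set: borelrV R d] f.
Proof. by apply: measurable_funB; exact: (@measurable_controlled _ _ B k). Qed.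

Let f_growth x : `|f x| <= 2 * B * u x ^+ k.
Proof.
rewrite (le_trans (ler_normB _ _))// -mulrA mulr_natl mulr2n.
by apply: lerD; [exact: controlled_le cphi x|exact: controlled_le cphi0 x].
Qed.

Let f_L1 : L1 P f. Proof. by apply: (poly_le mf) => x; exact: f_growth. Qed.

Lemma centredP_L1 : L1 P centredP.
Proof. by apply: L1B => //; exact: L1_cst. Qed.

Lemma centredP_mean : \int[P]_x centredP x = 0.
Proof. by rewrite expectB ?expect_cst ?subrr//; exact: L1_cst. Qed.

Lemma centredP_sqr : L1 P (fun x => centredP x ^+ 2) /\
  \int[P]_x (centredP x ^+ 2) <= CPI * (4 * N * e + 4 * N ^+ 2 * tau).
Proof.
have Ig : L1 P (fun x => enorm (grad f x) ^+ 2).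
  by under [X in L1 P X]eq_fun do rewrite grad_f; exact: grad_dist_L1.
have [I2 H] := poinc df Ig; split=> //; apply: (le_trans H).
rewrite ler_wpM2l//; under eq_Rintegral do rewrite grad_f.
exact: expect_grad_le.
Qed.

(** The fluctuation of the conjugate reduces to the gap and to the difference of
    the potentials themselves, to which Poincare's inequality applies. *)
Lemma centredQ_grad x : centredQ (grad phi0 x) = G x - U x.
Proof.
rewrite /centredQ conjugate_grad//; last exact: (controlled_differentiable cphi0).
by rewrite /G /gap /U /centredP/=; ring.
Qed.

Lemma measurable_centredQ : measurable_fun [set: borelrV R d] centredQ.
Proof.
apply: measurable_funD => //; apply: measurable_funB; first exact: measurable_tconj.
by rewrite conjugateE; exact: measurable_fine_conj_on.
Qed.

Let GU_L1 : L1 P (fun x => G x - U x).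
Proof. by apply: L1B => //; exact: centredP_L1. Qed.

Lemma centredQ_L1 : L1 Q centredQ.
Proof.
apply: (L1_law_inv lawQ measurable_centredQ).
by under [X in L1 P X]eq_fun do rewrite centredQ_grad.
Qed.

Lemma centredQ_mean : e - 4 * N * tau <= \int[Q]_y centredQ y.
Proof.
rewrite -(expect_law lawQ centredQ_L1).
under eq_Rintegral do rewrite centredQ_grad.
by rewrite expectB ?centredP_mean ?subr0//; exact: centredP_L1.
Qed.

Lemma centredQ_sqr : L1 Q (fun y => centredQ y ^+ 2) /\
  \int[Q]_y (centredQ y ^+ 2) <=
    2 * (4 * N * e + 16 * N ^+ 2 * tau) + 2 * (CPI * (4 * N * e + 4 * N ^+ 2 * tau)).
Proof.
have [U2 HU] := centredP_sqr.
have mV2 : measurable_fun [set: borelrV R d] (fun y => centredQ y ^+ 2).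
  by apply: measurable_funX; exact: measurable_centredQ.
have I2 : L1 P (fun x => 2 * G x ^+ 2 + 2 * U x ^+ 2).
  by apply: L1D; exact: L1Z.
have le2 x : centredQ (grad phi0 x) ^+ 2 <= 2 * G x ^+ 2 + 2 * U x ^+ 2.
  rewrite centredQ_grad; have := sqr_ge0 (G x + U x); move: (G x) (U x) => s t; nra.
have IV : L1 P (fun x => centredQ (grad phi0 x) ^+ 2).
  apply: (L1_le _ _ I2) => [|x]; last by rewrite ger0_norm ?sqr_ge0.
  exact: (measurableT_comp mV2 (measurable_grad cphi0)).
have IQ : L1 Q (fun y => centredQ y ^+ 2) := L1_law_inv lawQ mV2 IV.
split=> //; rewrite -(expect_law lawQ IQ).
apply: (le_trans (expect_le IV I2 le2)).
rewrite expectD; [|exact: L1Z|exact: L1Z].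
by rewrite !expectZ// lerD// ler_wpM2l.
Qed.

Let M := \int[P]_x ((1 + enorm x) ^+ k).

Definition clip_level : R := N * (6 + 2 * M).

Let M0 : 0 <= M.
Proof. by apply: expect_ge0 => x; rewrite exprn_ge0// addr_ge0 ?enorm_ge0. Qed.

Lemma clip_level_ge0 : 0 <= clip_level.
Proof. by rewrite mulr_ge0// addr_ge0// mulr_ge0. Qed.

Lemma centredP_near x : enorm x <= r -> `|centredP x| <= 2 * N + 2 * N * M.
Proof.
move=> xr; rewrite (le_trans (ler_normB _ _))// lerD//.
  apply: (le_trans (f_growth x)); rewrite -mulrA ler_wpM2l// ler_wpM2l//.
  apply: (@le_trans _ _ ((2 + r) ^+ k)).
    have x0 := enorm_ge0 x; rewrite lerXn2r ?nnegrE//; try lra.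
    have := r0; rewrite /u; lra.
  by rewrite ler_weXn2l// -addrA lerDl addr_ge0.
apply: (le_trans (le_normr_Rintegral _ f_L1)) => //.
apply: (@le_trans _ _ (\int[P]_x (2 * B * u x ^+ k))).
  by apply: expect_le => //; [exact: integrable_norm f_L1|exact: L1Z].
by rewrite expectZ// ler_wpM2r// ler_wpM2l.
Qed.

Lemma centredP_ge x : enorm x <= r -> - clip_level <= centredP x.
Proof.
move=> /centredP_near; rewrite ler_norml => /andP[h _]; apply: le_trans h.
rewrite lerN2 /clip_level; have NM : 0 <= N * M by rewrite mulr_ge0.
have := N0; lra.
Qed.

Lemma centredQ_ge x : enorm x <= r -> - clip_level <= centredQ (grad phi0 x).
Proof.
move=> xr; have := centredP_near xr; rewrite ler_norml => /andP[_ h].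
have := gap_near_ge0 B1 cphi0 r0 cphi xr.
rewrite centredQ_grad -/(G x) -/(U x) in h *.
have : 0 <= N * M by rewrite mulr_ge0.
by rewrite /clip_level; have := N0; lra.
Qed.

Definition rate_const : R := 2 * (12 * CPI + 32) + 3 * (6 + 2 * M).

Lemma rate_const_ge1 : 1 <= rate_const.
Proof. by rewrite /rate_const; have := M0; have := CPI0; lra. Qed.

(** The variances of both terms are at most a multiple of the gap itself, so that
    half of the gap absorbs the stochastic fluctuation (a fast rate). *)
Lemma concentration (dO : measure_display) (Om : measurableType dO) (n : nat)
    (Pr : probability Om R) (X Y : 'I_n -> Om -> borelrV R d) (s : R) :
  iid_samples Pr P Q X Y ->
  (Pr [set w | (\sum_(i < n) Num.max (centredP (X i w)) (- clip_level)
              + \sum_(i < n) Num.max (centredQ (Y i w)) (- clip_level)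
              < n%:R * (e / 2 - s))%R] <=
   (expR (- (n%:R * s) / (rate_const * N) + 5 * (n%:R * tau)))%:E)%E.
Proof.
move=> iid; have [U2 HU] := centredP_sqr; have [V2 HV] := centredQ_sqr.
have L1' := rate_const_ge1; set L := rate_const in L1' *.
have N_gt0 : 0 < N by rewrite (lt_le_trans ltr01).
have L_gt0 : 0 < L by rewrite (lt_le_trans ltr01).
pose l := (L * N)^-1; have l0 : 0 < l by rewrite invr_gt0 mulr_gt0.
have lN : l * N = L^-1 by rewrite /l; field; rewrite !gt_eqF.
have iL1 : L^-1 <= 1 by rewrite invf_le1.
have iL0 : 0 < L^-1 by rewrite invr_gt0.
have lb : l * clip_level <= 1 / 3.
  rewrite /clip_level mulrA lN mulrC ler_pdivrMr// /L /rate_const.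
  by have := M0; have := CPI0; lra.
apply: (le_trans (chernoff_lower_tail iid _ l0 clip_level_ge0 lb
  centredP_L1 U2 centredQ_L1 V2)).
rewrite lee_fin ler_expR centredP_mean add0r.
set v := \int[Q]_y centredQ y; have Hv : e - 4 * N * tau <= v := centredQ_mean.
set EU := \int[P]_x (centredP x ^+ 2) in HU *; set EV := \int[Q]_y _ in HV *.
have e0 : 0 <= e := near_gap_ge0.
pose Lam := 12 * CPI + 32.
have HUV : EU + EV <= Lam * (N * e + N ^+ 2 * tau).
  have h1 : 0 <= N * e by rewrite mulr_ge0.
  have h2 : 0 <= N ^+ 2 * tau by rewrite mulr_ge0// sqr_ge0.
  rewrite /Lam; lra.
have lLam : l * N * Lam <= 1 / 2.
  rewrite lN mulrC ler_pdivrMr// /L /rate_const /Lam.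
  by have := M0; have := CPI0; lra.
have n0 : 0 <= n%:R :> R by [].
have -> : - (n%:R * s) / (L * N) = n%:R * (- l * s) by rewrite /l; ring.
have -> : l * (n%:R * (e / 2 - s)) = n%:R * (l * (e / 2 - s)) by ring.
have -> : 5 * (n%:R * tau) = n%:R * (5 * tau) by ring.
rewrite -!mulrDr ler_wpM2l//.
have h1 : l ^+ 2 * (EU + EV) <= l ^+ 2 * (Lam * (N * e + N ^+ 2 * tau)).
  by rewrite ler_wpM2l// sqr_ge0.
have h2 : l ^+ 2 * (Lam * (N * e + N ^+ 2 * tau)) <= 1 / 2 * (l * e + l * N * tau).
  rewrite (_ : l ^+ 2 * _ = (l * N * Lam) * (l * e + l * N * tau)); last by ring.
  have l00 := ltW l0; apply: ler_wpM2r => //.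
  by apply: addr_ge0; repeat apply: mulr_ge0 => //.
have h3 : l * (e - 4 * N * tau) <= l * v by rewrite ler_wpM2l// ltW.
have h4 : l * N * tau <= tau by rewrite ler_piMl// lN.
have := tau0; lra.
Qed.

End gap_moments.

(** * Empirical objective and parameter nets *)

Section empirical_integral.
Context d (T : measurableType d) (R : realType) (n : nat) (x : 'I_n -> T).

Let m_ (i : nat) : {measure set T -> \bar R} := \d_(nth point (codom x) i).

Let nth_x (i : 'I_n) : nth point (codom x) i = x i.
Proof.
rewrite -[val i]/(val (cast_ord (esym (card_ord n)) i)) nth_codom.
by rewrite enum_val_ord cast_ordKV.
Qed.

Lemma ge0_integral_empirical (f : T -> \bar R) : measurable_fun setT f ->
  (forall t, 0 <= f t)%E ->
  (\int[empirical x]_t f t = (n%:R^-1)%:E * \sum_(i < n) f (x i))%E.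
Proof.
move=> mf f0.
transitivity (\int[mscale ((n%:R^-1)%:nng : {nonneg R})%R (msum m_ n)]_t f t)%E.
  apply: eq_measure_integral => A mA _.
  rewrite /empirical /mscale /msum /=; congr (_ * _)%E.
  by apply: eq_bigr => i _; rewrite /m_ nth_x.
rewrite ge0_integral_mscale// ge0_integral_measure_sum//; congr (_ * _)%E.
by apply: eq_bigr => i _; rewrite integral_dirac// diracT mul1e nth_x.
Qed.

Lemma integral_empirical (f : T -> R) : measurable_fun setT f ->
  (\int[empirical x]_t (f t)%:E = (n%:R^-1 * \sum_(i < n) f (x i))%:E)%E.
Proof.
move=> mf; have mEf : measurable_fun setT (EFin \o f) by exact/measurable_EFinP.
rewrite integralE !ge0_integral_empirical//; last 2 first.
- exact: measurable_funeneg.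
- exact: measurable_funepos.
under eq_bigr do rewrite funeposE -EFin_max.
under [X in (_ - _ * X)%E]eq_bigr do rewrite funenegE -EFinN -EFin_max.
rewrite !sumEFin -!EFinM -EFinB -mulrBr -sumrB; congr (_ * _)%:E.
apply: eq_bigr => i _; have [f0|f0] := leP 0 (f (x i)).
  by rewrite max_r ?subr0// oppr_le0.
by rewrite max_l ?sub0r ?opprK// oppr_ge0 ltW.
Qed.

End empirical_integral.

Section net.
Context {R : realType} {m : nat} (Theta : set 'rV[R]_m).

(** Cells of a grid of mesh 1/n, each represented by one of its points in Theta. *)
Lemma bounded_net : bounded_set Theta -> Theta !=set0 ->
  exists c : nat, forall n : nat, (0 < n)%N ->
  exists net : {ffun 'I_m -> 'I_(c * n).+1} -> 'rV[R]_m,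
    (forall j, Theta (net j)) /\
    forall t, Theta t -> exists j, enorm (t - net j) <= m%:R / n%:R.
Proof.
move=> bT [t1 T1]; have [D D0 HD] := bounded_set_enorm bT.
pose c := (Num.truncn (2 * D)).+1.
have Dc : 2 * D <= c%:R by exact/ltW/truncnS_gt.
exists c => n n0; have n0' : 0 < n%:R :> R by rewrite ltr0n.
pose cell (t : 'rV[R]_m) : {ffun 'I_m -> 'I_(c * n).+1} :=
  [ffun i => inord (Num.truncn ((t 0 i + D) * n%:R))].
have cellP t i : Theta t -> 0 <= (t 0 i + D) * n%:R /\
    (Num.truncn ((t 0 i + D) * n%:R)%R < (c * n).+1)%N.
  move=> Tt; have := le_trans (coord_le_enorm t i) (HD _ Tt).
  rewrite ler_norml => /andP[h1 h2].
  have p0 : 0 <= (t 0 i + D) * n%:R by rewrite mulr_ge0//; lra.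
  split=> //; rewrite ltnS -(ler_nat R) natrM.
  apply: (le_trans (y := (t 0 i + D) * n%:R)); first by case/andP: (truncn_itv p0).
  by rewrite ler_wpM2r//; lra.
pose net j := if pselect (exists2 t, Theta t & cell t = j) is left e then sval (cid2 e) else t1.
exists net; split=> [j|t Tt].
  by rewrite /net; case: pselect => // e; case: (cid2 e).
exists (cell t); rewrite /net; case: pselect => [e|]; last by case; exists t.
case: (cid2 e) => t' Tt' /= E.
apply: (le_trans (enorm_le_norm _)); rewrite ler_wpM2l//.
rewrite [leLHS]/Num.norm/= mx_normrE; apply/bigmax_leP; split=> [|[i0 i] _].
  by rewrite invr_ge0.
rewrite /= (ord1 i0) !mxE.
have [p1 q1] := cellP t i Tt; have [p2 q2] := cellP t' i Tt'.
move/ffunP/(_ i): E; rewrite !ffunE => /(congr1 val); rewrite /= !inordK// => E.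
have := truncn_itv p1; have := truncn_itv p2; rewrite E => /andP[h1 h2] /andP[h3 h4].
rewrite -(ler_pM2r n0') mulVf ?gt_eqF// -[X in _ * X](ger0_norm (ltW n0')) -normrM.
rewrite -natr1 in h2 h4.
by rewrite ler_norml; apply/andP; split; lra.
Qed.

End net.

(** * The oracle inequality for a fixed sample size *)

Lemma semidual_empirical (R : realType) (d n : nat) (x y : 'I_n -> borelrV R d)
    (phi : 'rV[R]_d -> R) :
  measurable_fun [set: borelrV R d] phi -> phi 0 = 0 ->
  semidual (empirical x) (empirical y) phi =
    ((n%:R^-1 * \sum_(i < n) phi (x i))%:E
     + (n%:R^-1)%:E * \sum_(i < n) conjugate phi (y i))%E.
Proof.
move=> mphi phi0; rewrite /semidual integral_empirical// ge0_integral_empirical//.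
- by rewrite conjugateE; exact: measurable_conj_on.
- by move=> t; rewrite conjugateE conj_on_ge0.
Qed.

Section near_gap_net.
Context {R : realType} {d : nat} (P : probability (borelrV R d) R).
Variables (B : R) (k : nat) (phi0 phi phi' : 'rV[R]_d -> R) (r delta : R).
Hypotheses (B1 : 1 <= B) (cphi0 : controlled B k phi0).
Hypotheses (cphi : controlled B k phi) (cphi' : controlled B k phi') (r0 : 0 <= r).
Hypothesis polyL1 : forall q, L1 P (fun x => (1 + enorm x) ^+ q).
Hypotheses (delta0 : 0 <= delta)
  (close : forall x, `|phi x - phi' x| <= delta * (1 + enorm x) ^+ k).
Let D := delta * (2 + r) ^+ k.
Let B0 : 0 <= B. Proof. exact: le_trans B1. Qed.

Lemma net_close x : enorm x <= r + 1 -> `|phi x - phi' x| <= D.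
Proof.
move=> xr; have x0 := enorm_ge0 x; have r0' := r0.
by rewrite (le_trans (close x))// ler_wpM2l// lerXn2r// ?nnegrE; lra.
Qed.

Lemma tconj_net_close y : `|tconj (r + 1) phi y - tconj (r + 1) phi' y| <= D.
Proof.
have r10 : 0 <= r + 1 by rewrite addr_ge0.
have h1 : tconj (r + 1) phi y <= tconj (r + 1) phi' y + D.
  apply: (tconj_lip B0 r10 _ cphi cphi') => x /net_close.
  by rewrite distrC => /(le_trans (ler_norm _)).
have h2 : tconj (r + 1) phi' y <= tconj (r + 1) phi y + D.
  apply: (tconj_lip B0 r10 _ cphi' cphi) => x /net_close.
  exact: (le_trans (ler_norm _)).
by rewrite ler_norml; apply/andP; split; lra.
Qed.

Lemma near_gap_close : near_gap P phi0 phi r <= near_gap P phi0 phi' r + 2 * D.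
Proof.
have D0 : 0 <= D by rewrite mulr_ge0// exprn_ge0// addr_ge0.
have L := near_gap_L1 B1 cphi0 cphi r0 polyL1.
have L' := near_gap_L1 B1 cphi0 cphi' r0 polyL1.
rewrite -[2 * D](expect_cst P) -expectD//; last exact: L1_cst.
apply: expect_le => //; first by apply: L1D => //; exact: L1_cst.
move=> x; rewrite indicE; have [h|h] := ltP r (enorm x).
  by rewrite mem_set// subrr !mulr0 add0r mulr_ge0.
rewrite memNset; last by rewrite /far/= => /lt_geF; rewrite h.
rewrite subr0 !mulr1 /gap.
have := tconj_net_close (grad phi0 x); rewrite ler_norml => /andP[_ h1].
have : enorm x <= r + 1 by rewrite (le_trans h)// lerDl.
move=> /net_close; rewrite ler_norml => /andP[_ h2]; lra.
Qed.

End near_gap_net.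

Section oracle.
Context {R : realType} {d : nat} (P Q : probability (borelrV R d) R).
Variables (B : R) (k : nat) (phi0 psi : 'rV[R]_d -> R) (CPI r tau alpha a : R).
Hypotheses (B1 : 1 <= B) (cphi0 : controlled B k phi0).
Hypothesis convex0 : convex_function [set: 'rV[R]_d] phi0.
Hypotheses (CPI0 : 0 <= CPI) (r0 : 0 <= r).
Hypothesis poinc : real_poincare P CPI.
Hypothesis polyL1 : forall q, L1 P (fun x => (1 + enorm x) ^+ q).
Hypothesis tailP :
  \int[P]_x ((1 + enorm x) ^+ (2 * k.+1) * \1_(far r) x) <= tau.
Hypothesis lawQ : has_law P (grad phi0 : borelrV R d -> borelrV R d) Q.
Hypotheses (d_gt0 : (0 < d)%N) (alpha0 : 0 < alpha) (a0 : 0 <= a).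
Variable F : set ('rV[R]_d -> R).
Hypothesis cF : forall phi, F phi -> controlled B k phi.
Hypotheses (Fpsi : F psi) (scpsi : strongly_convex alpha a psi).

Let N := scale B k r.
Let B0 : 0 <= B. Proof. exact: le_trans B1. Qed.
Let N0 : 0 <= N. Proof. by apply: le_trans (scale_ge1 k B1 r0). Qed.

Definition dist2 phi : R := \int[P]_x (enorm (grad phi x - grad phi0 x) ^+ 2).

Lemma grad_dist2E phi : F phi -> grad_dist2 P phi phi0 = (dist2 phi)%:E.
Proof.
by move=> Fphi; rewrite /grad_dist2 EFin_expect//; exact: (grad_dist_L1 cphi0 (cF Fphi)).
Qed.

Definition excessP (x : 'rV[R]_d) : R := psi x - phi0 x.
Definition excessQ (y : 'rV[R]_d) : R := fine (conjugate psi y) - fine (conjugate phi0 y).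

Let conj_psiE y : conjugate psi y = (fine (conjugate psi y))%:E.
Proof.
rewrite fineK// ge0_fin_numE; last first.
  by rewrite conjugateE conj_on_ge0//; exact: controlled0 (cF Fpsi).
apply: le_lt_trans (strongly_convex_conj_le 0 y d_gt0 alpha0 a0 scpsi) _.
exact: ltry.
Qed.

Let measurable_F phi : F phi -> measurable_fun [set: borelrV R d] phi.
Proof. by move=> /cF; exact: measurable_controlled. Qed.

Lemma measurable_excessP : measurable_fun [set: borelrV R d] excessP.
Proof.
by apply: measurable_funB; [exact: measurable_F|exact: measurable_controlled cphi0].
Qed.

Lemma measurable_excessQ : measurable_fun [set: borelrV R d] excessQ.
Proof. by apply: measurable_funB; rewrite conjugateE; exact: measurable_fine_conj_on. Qed.

Let kap := 2 * B ^+ 2 / alpha + 2 * B.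

Let kap0 : 0 <= kap.
Proof. by rewrite addr_ge0 ?divr_ge0 ?mulr_ge0 ?sqr_ge0 ?(ltW alpha0). Qed.

Let u1 (x : 'rV[R]_d) := enorm1_ge1 x.

Let excessP_le x : `|excessP x| <= 2 * B * (1 + enorm x) ^+ (2 * k).
Proof.
rewrite (le_trans (ler_normB _ _))// -mulrA mulr_natl mulr2n.
have M : B * (1 + enorm x) ^+ k <= B * (1 + enorm x) ^+ (2 * k).
  by rewrite ler_wpM2l// ler_weXn2l// leq_pmull.
by apply: lerD; apply: le_trans M; [exact: controlled_le (cF Fpsi) x|exact: controlled_le cphi0 x].
Qed.

(** D is Fenchel's defect of psi at the pair (x, grad phi0 x). *)
Let defect x : exists2 D : R, excessQ (grad phi0 x) = D - excessP x &
  0 <= D <= enorm (grad psi x - grad phi0 x) ^+ 2 / (2 * alpha).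
Proof.
exists (excessQ (grad phi0 x) + excessP x); first by rewrite addrK.
rewrite /excessQ /excessP (conjugate_grad convex0)/=; last first.
  exact: (controlled_differentiable cphi0).
have h1 : ((dotrV x (grad phi0 x) - psi x)%:E <= conjugate psi (grad phi0 x))%E.
  by rewrite conjugateE; exact: conj_on_ge.
have h2 := strongly_convex_conj_le x (grad phi0 x) d_gt0 alpha0 a0 scpsi.
rewrite conj_psiE lee_fin in h1; rewrite conj_psiE lee_fin in h2.
by apply/andP; split; lra.
Qed.

Let excessQ_le x : `|excessQ (grad phi0 x)| <= kap * (1 + enorm x) ^+ (2 * k).
Proof.
have [D -> /andP[D0 D1]] := defect x.
rewrite (le_trans (ler_normB _ _))// mulrDl lerD// ger0_norm// (le_trans D1)//.
have h := grad_diff_le cphi0 x (cF Fpsi).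
rewrite ler_pdivrMr ?mulr_gt0//.
apply: (@le_trans _ _ ((2 * B * (1 + enorm x) ^+ k) ^+ 2)).
  by rewrite lerXn2r// nnegrE ?enorm_ge0// (le_trans _ h)// enorm_ge0.
rewrite mulnC exprM exprMn le_eqVlt; apply/orP; left; apply/eqP.
by field; rewrite gt_eqF.
Qed.

Let polyL1' c q (f : 'rV[R]_d -> R) : measurable_fun [set: borelrV R d] f ->
  (forall x, `|f x| <= c * (1 + enorm x) ^+ q) -> L1 P f.
Proof. by move=> mf H; apply: (L1_le mf H); apply: L1Z. Qed.

Let excessP_L1 : L1 P excessP.
Proof. exact: (polyL1' measurable_excessP excessP_le). Qed.

Let excessQ_L1 : L1 Q excessQ.
Proof.
apply: (L1_law_inv lawQ measurable_excessQ).
apply: (polyL1' _ excessQ_le).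
exact: (measurableT_comp measurable_excessQ (measurable_grad cphi0)).
Qed.

Let C2 := kap ^+ 2 * \int[P]_x ((1 + enorm x) ^+ (4 * k)).

Let sqr_bound (f : 'rV[R]_d -> R) : measurable_fun [set: borelrV R d] f ->
  (forall x, `|f x| <= kap * (1 + enorm x) ^+ (2 * k)) ->
  L1 P (fun x => f x ^+ 2) /\ \int[P]_x (f x ^+ 2) <= C2.
Proof.
move=> mf H; have H2 x : f x ^+ 2 <= kap ^+ 2 * (1 + enorm x) ^+ (4 * k).
  rewrite -(real_normK (num_real (f x))) (_ : (4 * k = 2 * k * 2)%N); last first.
    by rewrite mulnAC.
  by rewrite exprM -exprMn lerXn2r// nnegrE// (le_trans _ (H x)).
have L : L1 P (fun x => f x ^+ 2).
  apply: (polyL1' _ (c := kap ^+ 2) (q := 4 * k)); first exact: measurable_funX.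
  by move=> x; rewrite ger0_norm ?sqr_ge0.
split=> //; rewrite /C2 -expectZ//; apply: expect_le => //; exact: L1Z.
Qed.

Let excessP_sqr : L1 P (fun x => excessP x ^+ 2) /\ \int[P]_x (excessP x ^+ 2) <= C2.
Proof.
apply: (sqr_bound measurable_excessP) => x; apply: (le_trans (excessP_le x)).
rewrite ler_wpM2r ?exprn_ge0 ?(le_trans _ (u1 x))// lerDr.
by rewrite divr_ge0 ?mulr_ge0 ?sqr_ge0 ?(ltW alpha0).
Qed.

Let excessQ_sqr : L1 Q (fun y => excessQ y ^+ 2) /\ \int[Q]_y (excessQ y ^+ 2) <= C2.
Proof.
have m1 := measurableT_comp measurable_excessQ (measurable_grad cphi0).
have [I H] := sqr_bound m1 excessQ_le.
have m2 : measurable_fun [set: borelrV R d] (fun y => excessQ y ^+ 2).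
  by apply: measurable_funX; exact: measurable_excessQ.
have IQ := L1_law_inv lawQ m2 I.
by split=> //; rewrite -(expect_law lawQ IQ).
Qed.

(** The expected excess objective of psi is the integral of Fenchel's defect, which
    strong convexity bounds. *)
Let excess_mean :
  \int[P]_x excessP x + \int[Q]_y excessQ y <= dist2 psi / (2 * alpha).
Proof.
rewrite -(expect_law lawQ excessQ_L1) -expectD//; last exact: (L1_law lawQ).
have Ig := grad_dist_L1 cphi0 (cF Fpsi) polyL1.
rewrite mulrC -expectZ//; apply: expect_le.
- by apply: L1D => //; exact: (L1_law lawQ).
- exact: L1Z.
- move=> x; have [D -> /andP[_ D1]] := defect x.
  by rewrite addrC subrK mulrC.
Qed.

Section sample.
Variables (n : nat) (J : finType) (nu : J -> 'rV[R]_d -> R) (delta s : R).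
Hypotheses (n_gt0 : (0 < n)%N) (Fnu : forall j, F (nu j)) (delta0 : 0 <= delta) (s0 : 0 <= s).
Hypothesis net : forall phi, F phi ->
  exists j, forall x, `|phi x - nu j x| <= delta * (1 + enorm x) ^+ k.
Context {dO : measure_display} {Om : measurableType dO} (Pr : probability Om R).
Variables (X Y : 'I_n -> Om -> borelrV R d) (phihat : Om -> 'rV[R]_d -> R).
Hypotheses (iid : iid_samples Pr P Q X Y) (minim : measurable_minimizer F X Y phihat).

Let D := delta * (2 + r) ^+ k.
Let b := clip_level P B k r.
Let nR : R := n%:R.
Let nR0 : 0 < nR. Proof. by rewrite ltr0n. Qed.

Let D0 : 0 <= D.
Proof. by rewrite mulr_ge0// exprn_ge0// addr_ge0. Qed.

Let bad j : set Om :=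
  [set w | \sum_(i < n) Num.max (centredP P phi0 (nu j) (X i w)) (- b)
         + \sum_(i < n) Num.max (centredQ P phi0 (nu j) r (Y i w)) (- b)
         < nR * (near_gap P phi0 (nu j) r / 2 - s)].

Let low j : set (borelrV R d) := [set y | centredQ P phi0 (nu j) r y < - b].

(** Counts the failing events.  It is at least 1 off the good event, and its mean is
    a sum of probabilities. *)
Let beta w : R := \sum_j \1_(bad j) w + \sum_(i < n) \1_(far r) (X i w)
  + \sum_j \sum_(i < n) \1_(low j) (Y i w).

Let good w := [/\ forall j, ~ bad j w, forall i, enorm (X i w) <= r &
  forall j i, - b <= centredQ P phi0 (nu j) r (Y i w)].

Let ge0_term (I : finType) (f : I -> R) i : (forall i, 0 <= f i) -> f i <= \sum_i f i.
Proof. by move=> f0; rewrite (bigD1 i)//= lerDl sumr_ge0. Qed.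

Let beta_ge0 w : 0 <= beta w.
Proof. by rewrite !addr_ge0 ?sumr_ge0// => j _; rewrite sumr_ge0. Qed.

Let good_or_bad w : good w \/ 1 <= beta w.
Proof.
have S1 : 0 <= \sum_j \1_(bad j) w :> R by rewrite sumr_ge0.
have S2 : 0 <= \sum_(i < n) \1_(far r) (X i w) :> R by rewrite sumr_ge0.
have S3 : 0 <= \sum_j \sum_(i < n) \1_(low j) (Y i w) :> R.
  by rewrite sumr_ge0// => j _; rewrite sumr_ge0.
have [[j bj]|H1] := pselect (exists j, bad j w).
  right; have := @ge0_term _ (fun j => \1_(bad j) w) j (fun=> ler0n _ _).
  by rewrite indicE mem_set//= /beta; lra.
have [[i xi]|H2] := pselect (exists i, r < enorm (X i w)).
  right; have := @ge0_term _ (fun i => \1_(far r) (X i w)) i (fun=> ler0n _ _).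
  by rewrite indicE mem_set//= /beta; lra.
have [[j [i yi]]|H3] := pselect (exists j i, centredQ P phi0 (nu j) r (Y i w) < - b).
  right; have := @ge0_term _ (fun i => \1_(low j) (Y i w)) i (fun=> ler0n _ _).
  have H j' : 0 <= \sum_(i < n) \1_(low j') (Y i w) :> R by rewrite sumr_ge0.
  have := @ge0_term _ (fun j => \sum_(i < n) \1_(low j) (Y i w)) j H.
  by rewrite indicE mem_set//= /beta; lra.
left; split=> [j bj|i|j i].
- by apply: H1; exists j.
- by rewrite leNgt; apply/negP => xi; apply: H2; exists i.
- by rewrite leNgt; apply/negP => yi; apply: H3; exists j, i.
Qed.

Let Fhat w : F (phihat w). Proof. by case: minim => _ /(_ w)[]. Qed.

Let minimizer_le w :
  \sum_(i < n) phihat w (X i w) + \sum_(i < n) tconj (r + 1) (phihat w) (Y i w)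
  <= \sum_(i < n) psi (X i w) + \sum_(i < n) fine (conjugate psi (Y i w)).
Proof.
have r10 : 0 <= r + 1 by rewrite addr_ge0.
case: minim => _ /(_ w)[_ /(_ psi Fpsi)].
have i0 : 0 < nR^-1 by rewrite invr_gt0.
rewrite !semidual_empirical//; try exact: measurable_F; try exact: (controlled0 (cF _)).
under [X in (_ <= _ + _ * X)%E]eq_bigr do rewrite conj_psiE.
rewrite sumEFin -EFinM -EFinD -mulrDr => H.
rewrite -(ler_pM2l i0) mulrDr -lee_fin; apply: le_trans H.
rewrite EFinD leeD2l// EFinM lee_wpmul2l ?lee_fin ?(ltW i0)// -sumEFin.
by apply: lee_sum => i _; exact: (tconj_conjugate B0 r10 _ (cF (Fhat w))).
Qed.

Let T w : R := nR^-1 * (\sum_(i < n) excessP (X i w) + \sum_(i < n) excessQ (Y i w)).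

(** On the good event the empirical objective of the minimizer controls its gap,
    through the closest element of the net. *)
Let good_bound w : good w ->
  dist2 (phihat w) <= 8 * N * T w + (24 * N * D + 8 * N * s + 4 * N ^+ 2 * tau).
Proof.
move=> [nbad Xr Yb]; have [j close] := net (Fhat w).
have cnu := cF (Fnu j); have chat := cF (Fhat w).
have close' x : `|nu j x - phihat w x| <= delta * (1 + enorm x) ^+ k.
  by rewrite distrC.
have e1 := near_gap_close B1 cphi0 chat cnu r0 polyL1 delta0 close.
have e2 := expect_grad_le B1 cphi0 chat r0 polyL1 tailP.
rewrite -/D in e1; rewrite -/N -/(dist2 _) in e2.
set e := near_gap P phi0 (phihat w) r in e1 e2; set ej := near_gap P phi0 (nu j) r in e1.
have H : nR * (ej / 2 - s) <= nR * (T w + 2 * D).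
  have /negP := nbad j; rewrite -leNgt => /le_trans; apply.
  under eq_bigr => i _ do rewrite max_l ?(centredP_ge B1 cphi0 cnu r0 polyL1 (Xr i))//.
  under [X in _ + X <= _]eq_bigr => i _ do rewrite max_l//.
  have term i : centredP P phi0 (nu j) (X i w) + centredQ P phi0 (nu j) r (Y i w) <=
      (phihat w (X i w) + tconj (r + 1) (phihat w) (Y i w))
      - (phi0 (X i w) + fine (conjugate phi0 (Y i w))) + 2 * D.
    have Xr1 : enorm (X i w) <= r + 1 by rewrite (le_trans (Xr i))// lerDl.
    have := net_close r0 delta0 close' Xr1.
    have := tconj_net_close B1 cnu chat r0 delta0 close' (Y i w).
    rewrite -/D !ler_norml => /andP[_ h1] /andP[_ h2].
    by rewrite /centredP /centredQ; lra.
  rewrite -big_split /=; apply: (le_trans (ler_sum _ (fun i _ => term i))).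
  rewrite big_split /= sumr_const card_ord -[_ *+ n]mulr_natl -/nR sumrB !big_split /=.
  rewrite mulrDr /T mulVKf ?gt_eqF// lerD2r.
  under [X in _ <= X + _]eq_bigr do rewrite /excessP.
  under [X in _ <= _ + X]eq_bigr do rewrite /excessQ.
  by rewrite !sumrB; have := minimizer_le w; lra.
rewrite ler_pM2l// in H; apply: (le_trans e2).
have : N * e <= N * (2 * T w + 6 * D + 2 * s) by rewrite ler_wpM2l//; lra.
lra.
Qed.

Let C0 := 4 * B ^+ 2 * \int[P]_x ((1 + enorm x) ^+ (2 * k.+1)).

Let C00 : 0 <= C0.
Proof.
rewrite mulr_ge0 ?mulr_ge0 ?sqr_ge0//; apply: expect_ge0 => x.
by rewrite exprn_ge0// (le_trans _ (u1 x)).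
Qed.

Let Tsq w : R :=
  nR^-1 * (\sum_(i < n) excessP (X i w) ^+ 2 + \sum_(i < n) excessQ (Y i w) ^+ 2).

Let R0 := 24 * N * D + 8 * N * s + 4 * N ^+ 2 * tau.

Let tau0 : 0 <= tau.
Proof.
apply: le_trans tailP; apply: expect_ge0 => x; rewrite mulr_ge0//.
by rewrite exprn_ge0// (le_trans _ (u1 x)).
Qed.

Let R00 : 0 <= R0.
Proof.
have h1 : 0 <= 24 * N * D by rewrite mulr_ge0// mulr_ge0.
have h2 : 0 <= 8 * N * s by rewrite mulr_ge0// mulr_ge0.
have h3 : 0 <= 4 * N ^+ 2 * tau by rewrite mulr_ge0// mulr_ge0// sqr_ge0.
by rewrite /R0 !addr_ge0.
Qed.

(** The last terms dominate 8 N |T w| off the good event, where beta w >= 1. *)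
Let bound w : R := 8 * N * T w + R0 + C0 * beta w + 4 * N * (Tsq w / nR + 2 * nR * beta w).

(** Each summand is a square after adding t ^ 2 / (2 n) and n / 2 to it. *)
Let T_ge w : 0 <= T w + Tsq w / (2 * nR) + nR.
Proof.
have E (t : R) : (t + nR) ^+ 2 / (2 * nR) = t + t ^+ 2 * (2 * nR)^-1 + nR / 2.
  by field; rewrite gt_eqF.
have sumE (p q : 'I_n -> R) : nR^-1 * (\sum_i p i + \sum_i q i)
    + nR^-1 * (\sum_i p i ^+ 2 + \sum_i q i ^+ 2) / (2 * nR) + nR = nR^-1 * \sum_i
    ((p i + nR) ^+ 2 / (2 * nR) + (q i + nR) ^+ 2 / (2 * nR)).
  under [in RHS]eq_bigr do rewrite !E.
  rewrite !big_split /= -!mulr_suml sumr_const card_ord -[_ *+ n]mulr_natl -/nR.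
  by field; rewrite gt_eqF.
rewrite /T /Tsq sumE.
rewrite mulr_ge0 ?invr_ge0 ?(ltW nR0)// sumr_ge0// => i _.
by rewrite addr_ge0// divr_ge0 ?sqr_ge0// mulr_ge0// ltW.
Qed.

Let Tsq_ge0 w : 0 <= Tsq w.
Proof.
by rewrite mulr_ge0 ?invr_ge0 ?(ltW nR0)// addr_ge0// sumr_ge0// => i _; rewrite sqr_ge0.
Qed.

Let dist2_bound w : dist2 (phihat w) <= bound w.
Proof.
have b0 := beta_ge0 w; have q0 : 0 <= Tsq w / nR by rewrite divr_ge0 ?Tsq_ge0 ?(ltW nR0).
have n0 := ltW nR0; have N0' := N0.
rewrite /bound; have [/good_bound h|h] := good_or_bad w.
  apply: (le_trans h); rewrite -/R0 -addrA lerDl.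
  have p1 : 0 <= C0 * beta w by rewrite mulr_ge0.
  have p2 : 0 <= 2 * nR * beta w by rewrite mulr_ge0// mulr_ge0.
  by rewrite addr_ge0// mulr_ge0 ?addr_ge0// mulr_ge0.
have h1 : dist2 (phihat w) <= C0 := expect_grad_le_cst cphi0 (cF (Fhat w)) polyL1.
have h2 : C0 <= C0 * beta w by rewrite ler_peMr.
have h3 : 0 <= N * (T w + Tsq w / (2 * nR) + nR * beta w).
  rewrite mulr_ge0// (le_trans (T_ge w))// lerD2l ler_peMr//.
have E : Tsq w / (2 * nR) = Tsq w / nR / 2 by field; rewrite gt_eqF.
rewrite E in h3; have := R00; set q := Tsq w / nR in h3 q0 *; lra.
Qed.

Let lawX i : has_law Pr (X i) P. Proof. by case: iid. Qed.
Let lawY i : has_law Pr (Y i) Q. Proof. by case: iid. Qed.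

Let avg_L1 (f g : 'rV[R]_d -> R) : L1 P f -> L1 Q g ->
  L1 Pr (fun w => nR^-1 * (\sum_(i < n) f (X i w) + \sum_(i < n) g (Y i w))) /\
  \int[Pr]_w (nR^-1 * (\sum_(i < n) f (X i w) + \sum_(i < n) g (Y i w)))
   = \int[P]_x f x + \int[Q]_y g y.
Proof.
move=> If Ig.
have I1 : L1 Pr (fun w => \sum_(i < n) f (X i w)).
  by apply: L1_sum => i; exact: (L1_law (lawX i) If).
have I2 : L1 Pr (fun w => \sum_(i < n) g (Y i w)).
  by apply: L1_sum => i; exact: (L1_law (lawY i) Ig).
have I12 := L1D I1 I2; split; first exact: L1Z.
rewrite expectZ// expectD// !expect_sum; last 2 first.
- by move=> i; exact: (L1_law (lawY i) Ig).
- by move=> i; exact: (L1_law (lawX i) If).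
rewrite (eq_bigr (fun=> \int[P]_x f x)); last by move=> i _; rewrite (expect_law (lawX i) If).
rewrite [X in _ + X](eq_bigr (fun=> \int[Q]_y g y)); last first.
  by move=> i _; rewrite (expect_law (lawY i) Ig).
rewrite !sumr_const card_ord -mulrnDl -[_ *+ n]mulr_natl mulKf ?gt_eqF//.
Qed.

Let measurable_low j : measurable (low j).
Proof.
rewrite (_ : low j = setT `&` centredQ P phi0 (nu j) r @^-1` [set` `]-oo, (- b)[]).
  exact: measurable_centredQ.
by apply/seteqP; split => y /=; rewrite in_itv/= => // -[].
Qed.

Let measurable_bad j : measurable (bad j).
Proof.
pose S w := \sum_(i < n) Num.max (centredP P phi0 (nu j) (X i w)) (- b)
         + \sum_(i < n) Num.max (centredQ P phi0 (nu j) r (Y i w)) (- b).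
have mS : measurable_fun setT S.
  have mP : measurable_fun [set: borelrV R d] (centredP P phi0 (nu j)).
    exact: L1_measurable (centredP_L1 cphi0 (cF (Fnu j)) polyL1).
  have mQ := measurable_centredQ P phi0 (nu j) r.
  apply: measurable_funD; apply: measurable_sum => i; apply: measurable_maxr => //.
    by apply: measurableT_comp mP _; case: (lawX i).
  by apply: measurableT_comp mQ _; case: (lawY i).
rewrite (_ : bad j = setT `&` S @^-1`
    [set` `]-oo, (nR * (near_gap P phi0 (nu j) r / 2 - s))[]); first exact: mS.
by apply/seteqP; split => w /=; rewrite in_itv/= => // -[].
Qed.

Let E0 := expR (- (nR * s) / (rate_const P k CPI * N) + 5 * (nR * tau)).

Let far_le : \int[P]_x (\1_(far r) x) <= tau.
Proof.
apply: le_trans tailP; apply: expect_le => [||x].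
- exact: (L1_indic P (measurable_far r)).
- apply: (polyL1' (c := 1) (q := 2 * k.+1)); first exact: measurable_far_indic.
  move=> x; rewrite mul1r normrM ger0_norm ?exprn_ge0 ?(le_trans _ (u1 x))//.
  rewrite ler_piMr ?exprn_ge0 ?(le_trans _ (u1 x))// indicE.
  by rewrite ger0_norm// lern1 leq_b1.
- by rewrite ler_peMl// exprn_ege1// u1.
Qed.

Let beta_mean : L1 Pr beta /\
  \int[Pr]_w beta w <= #|J|%:R * E0 + nR * tau + #|J|%:R * (nR * tau).
Proof.
have Ib j : L1 Pr (\1_(bad j) : Om -> R) by exact: L1_indic.
have If i : L1 Pr (fun w => \1_(far r) (X i w) : R).
  exact: (L1_law (lawX i) (L1_indic P (measurable_far r))).
have Il j i : L1 Pr (fun w => \1_(low j) (Y i w) : R).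
  exact: (L1_law (lawY i) (L1_indic Q (measurable_low j))).
have Ill j : L1 Pr (fun w => \sum_(i < n) \1_(low j) (Y i w) : R).
  by apply: L1_sum => i; exact: Il.
have I1 := L1_sum (index_enum J) Ib.
have I2 := L1_sum (index_enum 'I_n) If.
have I3 := L1_sum (index_enum J) Ill.
split; first exact: (L1D (L1D I1 I2) I3).
rewrite /beta expectD//; last exact: L1D.
rewrite expectD// !expect_sum//.
have le_low j i : \int[Pr]_w (\1_(low j) (Y i w)) <= tau.
  rewrite (expect_law (lawY i) (L1_indic Q (measurable_low j))).
  apply: le_trans far_le.
  rewrite -(expect_law lawQ (L1_indic Q (measurable_low j))).
  apply: expect_le => [||x].
  - exact: (L1_law lawQ (L1_indic Q (measurable_low j))).
  - exact: (L1_indic P (measurable_far r)).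
  rewrite !indicE; have [xr|xr] := ltP r (enorm x).
    have -> : x \in far r by exact: mem_set.
    by rewrite ler_nat leq_b1.
  rewrite memNset//= /low/=; apply/negP; rewrite -leNgt.
  exact: (centredQ_ge B1 cphi0 (cF (Fnu j)) convex0 r0 polyL1 xr).
apply: lerD; first apply: lerD.
- rewrite mulr_natl -sumr_const; apply: ler_sum => j _.
  rewrite expect_indic//.
  have := concentration B1 cphi0 (cF (Fnu j)) convex0 CPI0 r0 poinc polyL1 tailP lawQ s iid.
  by rewrite -/b -/N -/E0 => H; rewrite -lee_fin fineK// fin_num_measure.
- rewrite /nR mulr_natl -[n in leRHS]card_ord -sumr_const; apply: ler_sum => i _.
  by rewrite (expect_law (lawX i) (L1_indic P (measurable_far r))).
- rewrite mulr_natl -sumr_const; apply: ler_sum => j _.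
  rewrite expect_sum//.
  rewrite /nR mulr_natl -[n in leRHS]card_ord -sumr_const; apply: ler_sum => i _.
  exact: le_low.
Qed.

Let beta_ := #|J|%:R * E0 + nR * tau + #|J|%:R * (nR * tau).

(** Integrating the pathwise bound; outside the good event the crude bounds are
    compensated by its small probability. *)
Lemma oracle_inequality :
  (\int[Pr]_w grad_dist2 P (phihat w) phi0 <=
   (4 * N / alpha * dist2 psi + (24 * N * D + 8 * N * s + 4 * N ^+ 2 * tau)
    + (C0 + 8 * N * nR) * beta_ + 8 * N * C2 / nR)%:E)%E.
Proof.
have [Ibeta Hbeta] := beta_mean.
have [IT ET] := avg_L1 excessP_L1 excessQ_L1.
have [[P2 HP2] [Q2 HQ2]] := (excessP_sqr, excessQ_sqr).
have [IS ES] := avg_L1 P2 Q2.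
have I1 : L1 Pr (fun w => 8 * N * T w) by exact: L1Z.
have I2 : L1 Pr (fun w => C0 * beta w) by exact: L1Z.
have I3 : L1 Pr (fun w => nR^-1 * Tsq w) by exact: L1Z.
have I4 : L1 Pr (fun w => 2 * nR * beta w) by exact: L1Z.
have I5 : L1 Pr (fun w => 4 * N * (nR^-1 * Tsq w + 2 * nR * beta w)).
  by apply: L1Z; exact: L1D.
have I6 : L1 Pr (fun w => 8 * N * T w + R0) by apply: L1D => //; exact: L1_cst.
have I7 : L1 Pr (fun w => 8 * N * T w + R0 + C0 * beta w) by exact: L1D.
have Ebound : bound = fun w => 8 * N * T w + R0 + C0 * beta w
    + 4 * N * (nR^-1 * Tsq w + 2 * nR * beta w).
  by apply/funext => w; rewrite /bound (mulrC (Tsq w)).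
have Ibound : L1 Pr bound by rewrite Ebound; exact: L1D.
apply: (@le_trans _ _ (\int[Pr]_w (bound w)%:E)%E).
  apply: ge0_integral_mono => w; rewrite grad_dist2E// lee_fin.
    by apply: expect_ge0 => x; rewrite sqr_ge0.
  exact: dist2_bound.
rewrite EFin_expect// lee_fin Ebound.
rewrite expectD// expectD// expectD//; last exact: L1_cst.
rewrite expect_cst (expectZ (8 * N) IT) (expectZ C0 Ibeta) (expectZ (4 * N) (L1D I3 I4)).
rewrite (expectD I3 I4) (expectZ (2 * nR) Ibeta) (expectZ nR^-1 IS) ET ES.
have h1 : 8 * N * (\int[P]_x excessP x + \int[Q]_y excessQ y)
    <= 4 * N / alpha * dist2 psi.
  apply: (@le_trans _ _ (8 * N * (dist2 psi / (2 * alpha)))).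
    by rewrite ler_wpM2l ?excess_mean// mulr_ge0.
  by rewrite le_eqVlt; apply/orP; left; apply/eqP; field; rewrite gt_eqF.
have h2 : C0 * \int[Pr]_w beta w <= C0 * beta_ by rewrite ler_wpM2l.
have h3 : 8 * N * nR * \int[Pr]_w beta w <= 8 * N * nR * beta_.
  by rewrite ler_wpM2l// mulr_ge0 ?(ltW nR0)// mulr_ge0.
have h4 : 4 * N * (nR^-1 * (\int[P]_x (excessP x ^+ 2) + \int[Q]_y (excessQ y ^+ 2)))
    <= 8 * N * C2 / nR.
  rewrite (_ : 8 * N * C2 / nR = 4 * N * (nR^-1 * (2 * C2))); last by ring.
  have q1 : 0 <= 4 * N by rewrite mulr_ge0.
  have q2 : 0 <= nR^-1 by rewrite invr_ge0 ltW.
  apply: ler_wpM2l => //; apply: ler_wpM2l => //; lra.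
rewrite /R0; lra.
Qed.

End sample.

End oracle.

(** * The rate *)

Section rate_arithmetic.
Context {R : realType}.

Lemma ln_nat_ge (n : nat) : (2 <= n)%N -> 1 / 2 <= ln n%:R :> R.
Proof.
move=> n2; have n0 : 0 < n%:R :> R by rewrite ltr0n (leq_trans _ n2).
rewrite -ler_expR lnK ?posrE//; apply: (@le_trans _ _ 2); last by rewrite ler_nat.
rewrite -[leLHS]invrK -expRN -[leRHS]invrK lef_pV2 ?posrE ?invr_gt0 ?expR_gt0//.
by apply: le_trans (expR_ge1Dx _); lra.
Qed.

(** Each remainder is at most a constant times N ^+ 2 * t / nn. *)
Lemma rate_collect (N t nn g alpha Lm S Ct b1 C0 C2 D s tau bet : R) :
  0 < alpha -> 1 <= N -> 1 <= t -> 1 <= nn -> 0 <= g -> 0 <= Lm -> 0 <= S ->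
  0 <= Ct -> 0 <= b1 -> 0 <= C0 -> 0 <= C2 ->
  D <= Lm * N / nn -> s <= S * N * t / nn -> tau <= Ct / nn -> bet <= b1 / nn ^+ 2 ->
  4 * N / alpha * g + (24 * N * D + 8 * N * s + 4 * N ^+ 2 * tau)
    + (C0 + 8 * N * nn) * bet + 8 * N * C2 / nn
  <= N ^+ 2 * t * (4 / alpha + (24 * Lm + 8 * S + 4 * Ct + (C0 + 8) * b1 + 8 * C2))
     * (g + nn^-1).
Proof.
move=> al N1 t1 n1 g0 Lm0 S0 Ct0 b10 C00 C20 HD Hs Htau Hb.
have N0 : 0 <= N by exact: le_trans N1.
have n0 : 0 < nn by exact: lt_le_trans n1.
have i0 : 0 <= nn^-1 by rewrite invr_ge0 ltW.
have ia0 : 0 <= 4 / alpha by rewrite divr_ge0// ltW.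
have NN : N <= N ^+ 2 by rewrite expr2 ler_peMl.
have N20 : 0 <= N ^+ 2 by exact: sqr_ge0.
set Z := N ^+ 2 * t; have NZ : N ^+ 2 <= Z by rewrite ler_peMr.
have NZ' := le_trans NN NZ; have Z0 : 0 <= Z by exact: le_trans NZ.
have h1 : 4 * N / alpha * g <= Z * (4 / alpha * g).
  rewrite (_ : 4 * N / alpha * g = N * (4 / alpha * g)); last by ring.
  by rewrite ler_wpM2r// mulr_ge0.
have h2 : 24 * N * D <= Z * (24 * Lm * nn^-1).
  apply: (@le_trans _ _ (N ^+ 2 * (24 * Lm * nn^-1))); last by rewrite ler_wpM2r ?mulr_ge0.
  rewrite (_ : N ^+ 2 * _ = 24 * N * (Lm * N / nn)); last by ring.
  by rewrite ler_wpM2l ?mulr_ge0.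
have h3 : 8 * N * s <= Z * (8 * S * nn^-1).
  rewrite /Z (_ : N ^+ 2 * t * _ = 8 * N * (S * N * t / nn)); last by ring.
  by rewrite ler_wpM2l ?mulr_ge0.
have h4 : 4 * N ^+ 2 * tau <= Z * (4 * Ct * nn^-1).
  apply: (@le_trans _ _ (N ^+ 2 * (4 * Ct * nn^-1))); last by rewrite ler_wpM2r ?mulr_ge0.
  rewrite (_ : N ^+ 2 * _ = 4 * N ^+ 2 * (Ct / nn)); last by ring.
  by rewrite ler_wpM2l ?mulr_ge0.
have h5 : (C0 + 8 * N * nn) * bet <= Z * ((C0 + 8) * b1 * nn^-1).
  have a0 : 0 <= C0 + 8 * N * nn by rewrite addr_ge0// !mulr_ge0// ltW.
  apply: (le_trans (ler_wpM2l a0 Hb)).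
  have b0 : 0 <= b1 / nn ^+ 2 by rewrite divr_ge0// sqr_ge0.
  apply: (@le_trans _ _ ((C0 + 8) * N * nn * (b1 / nn ^+ 2))).
    rewrite ler_wpM2r//.
    have : C0 * 1 <= C0 * (N * nn) by rewrite ler_wpM2l// mulr_ege1.
    lra.
  rewrite (_ : _ * (b1 / nn ^+ 2) = N * ((C0 + 8) * b1 * nn^-1)).
    by rewrite ler_wpM2r// !mulr_ge0// addr_ge0.
  by field; rewrite gt_eqF.
have h6 : 8 * N * C2 / nn <= Z * (8 * C2 * nn^-1).
  rewrite (_ : 8 * N * C2 / nn = N * (8 * C2 * nn^-1)); last by ring.
  by rewrite ler_wpM2r ?mulr_ge0.
set K := 24 * Lm + 8 * S + 4 * Ct + (C0 + 8) * b1 + 8 * C2.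
have K0 : 0 <= K by rewrite /K !addr_ge0// !mulr_ge0// addr_ge0.
apply: (@le_trans _ _ (Z * (4 / alpha * g + K * nn^-1))).
  by rewrite /K; lra.
rewrite -[leRHS]mulrA ler_wpM2l//.
have : 0 <= 4 / alpha * nn^-1 by rewrite mulr_ge0.
have : 0 <= K * g by rewrite mulr_ge0.
lra.
Qed.

Lemma le_mul_ereal_inf (x : \bar R) (c v : R) (S : set (\bar R)) : 0 < c ->
  (forall g, S g -> (x <= c%:E * (g + v%:E))%E) ->
  (x <= c%:E * (ereal_inf S + v%:E))%E.
Proof.
move=> c0 H; rewrite -lee_pdivrMl// -leeBlDr//; apply: le_ereal_inf_tmp => g Sg.
by rewrite leeBlDr// lee_pdivrMl//; exact: H.
Qed.

End rate_arithmetic.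
Theorem mainTheorem7 (R : realType) (d m : nat) (hd : (2 <= d)%N)
    (Theta : set 'rV[R]_m) (phi_ : 'rV[R]_m -> 'rV[R]_d -> R)
    (hTheta : bounded_set Theta)
    (hpot : forall theta, Theta theta -> potential (phi_ theta))
    (L p : R) (hL : 0 <= L) (hp : 0 <= p)
    (hLip : forall theta theta', Theta theta -> Theta theta' -> forall x,
      `|phi_ theta x - phi_ theta' x|
        <= L * enorm (theta - theta') * (1 + enorm x) `^ p)
    (P Q : probability (borelrV R d) R) (hP : poincare P)
    (beta a : R) (hbeta : 0 <= beta) (ha : 0 <= a)
    (hsmooth : forall theta, Theta theta -> smooth beta a (phi_ theta))
    (phi0 : 'rV[R]_d -> R) (hpot0 : potential phi0)
    (hconv0 : convex_function [set: 'rV[R]_d] phi0)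
    (hsmooth0 : smooth beta a phi0)
    (hQ : forall A : set (borelrV R d), measurable A ->
      Q A = pushforward P (grad phi0 : borelrV R d -> borelrV R d) A)
    (alpha : R) (halpha : 0 < alpha) :
  let F := [set phi_ theta | theta in Theta] in
  let F_alpha := [set phi | F phi /\ strongly_convex alpha a phi] in
  exists C q : R, [/\ 0 <= C, 0 <= q &
    forall n : nat, (2 <= n)%N ->
    forall (dO : measure_display) (Om : measurableType dO)
      (Pr : probability Om R) (X Y : 'I_n -> Om -> borelrV R d)
      (phihat : Om -> 'rV[R]_d -> R),
    iid_samples Pr P Q X Y ->
    measurable_minimizer F X Y phihat ->
    (\int[Pr]_w grad_dist2 P (phihat w) phi0
      <= (C * ln n%:R `^ q)%:E *
         (ereal_inf [set grad_dist2 P phi phi0 | phi in F_alpha]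
          + (n%:R^-1)%:E))%E ].
Proof.
move=> F F_alpha; have d0 : (0 < d)%N by exact: leq_trans hd.
have [T0|TN] := pselect (Theta !=set0); last first.
  (* Without parameters there is no minimizer. *)
  exists 0, 0; split=> // n n2 dO Om Pr X Y phihat _ [_ /(_ point)[[t Tt _] _]].
  by case: TN; exists t.
have [B1 [k1 [B1_ge1 pk1 c1]]] := family_controlled hTheta hpot hL hp hLip hbeta hsmooth.
pose A := (Num.truncn a).+1; have aA : a <= A%:R by exact/ltW/truncnS_gt.
pose G0 := enorm (grad phi0 0); have G00 : 0 <= G0 by exact: enorm_ge0.
have c0 : controlled (G0 + beta) A.+2 phi0.
  by apply: (smooth_controlled hbeta aA G00 hsmooth0) => //; exact: lexx.
pose B := B1 + (G0 + beta); pose k := maxn k1 A.+2.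
have B1_ge0 : 0 <= B1 by exact: le_trans B1_ge1.
have GB0 : 0 <= G0 + beta by rewrite addr_ge0.
have B_ge1 : 1 <= B by rewrite /B (le_trans B1_ge1)// lerDl.
have B_ge0 : 0 <= B by exact: le_trans B_ge1.
have cphi0 : controlled B k phi0.
  by apply: (controlled_mono GB0 _ _ c0); rewrite ?leq_maxr// /B lerDr.
have cF phi : F phi -> controlled B k phi.
  move=> [t Tt <-]; apply: (controlled_mono B1_ge0 _ _ (c1 t Tt)); last exact: leq_maxl.
  by rewrite /B lerDl.
have pk : p <= k%:R by rewrite (le_trans pk1)// ler_nat leq_maxl.
have [CPI CPI0 poinc] := poincareP hP.
have polyL1 := enorm_L1 d0 hP.
have lawQ : has_law P (grad phi0 : borelrV R d -> borelrV R d) Q.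
  by split=> [|S mS]; [exact: measurable_grad cphi0|rewrite hQ].
have [c netc] := bounded_net hTheta T0.
have [Ct [Kt [Ct0 Kt1 tail]]] := tail_moment d0 hP (2 * k.+1) (m + 3).
pose Lam := rate_const P k CPI.
have Lam1 : 1 <= Lam by exact: rate_const_ge1.
have Lam0 : 0 <= Lam by exact: le_trans Lam1.
pose N1 := B * (2 + Kt) ^+ k.+1.
pose J1 : R := c.+1%:R ^+ m.
pose b1 := J1 * expR (5 * Ct) + Ct + J1 * Ct.
pose C0 := 4 * B ^+ 2 * \int[P]_x ((1 + enorm x) ^+ (2 * k.+1)).
pose C2 := (2 * B ^+ 2 / alpha + 2 * B) ^+ 2 * \int[P]_x ((1 + enorm x) ^+ (4 * k)).
pose K2 := 4 / alpha + (24 * (L * m%:R) + 8 * (Lam * m.+2%:R) + 4 * Ct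
                        + (C0 + 8) * b1 + 8 * C2).
pose q := (2 * k.+1).+1.
have J10 : 0 <= J1 by rewrite exprn_ge0.
have b10 : 0 <= b1 by rewrite !addr_ge0// mulr_ge0// expR_ge0.
have C00 : 0 <= C0.
  rewrite mulr_ge0 ?mulr_ge0 ?sqr_ge0//; apply: expect_ge0 => x.
  by rewrite exprn_ge0// addr_ge0// enorm_ge0.
have C20 : 0 <= C2.
  rewrite mulr_ge0 ?sqr_ge0//; apply: expect_ge0 => x.
  by rewrite exprn_ge0// addr_ge0// enorm_ge0.
have Lm0 : 0 <= L * m%:R by rewrite mulr_ge0.
have S0 : 0 <= Lam * m.+2%:R by rewrite mulr_ge0.
have Kt0 : 0 <= Kt by exact: le_trans Kt1.
have ia0 : 0 < 4 / alpha by rewrite divr_gt0.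
have K20 : 0 < K2.
  have h1 : 0 <= 24 * (L * m%:R) by rewrite mulr_ge0.
  have h2 : 0 <= 8 * (Lam * m.+2%:R) by rewrite mulr_ge0.
  have h3 : 0 <= (C0 + 8) * b1 by rewrite mulr_ge0// addr_ge0.
  rewrite /K2; lra.
have N10 : 0 < N1.
  by rewrite mulr_gt0 ?(lt_le_trans ltr01 B_ge1)// exprn_gt0// ltr_wpDr.
exists (N1 ^+ 2 * 3 ^+ q * K2), q%:R; split=> //.
  by rewrite mulr_ge0 ?(ltW K20)// mulr_ge0 ?sqr_ge0// exprn_ge0.
move=> n n2 dO Om Pr X Y phihat iid minim.
have n0 : (0 < n)%N by exact: leq_trans n2.
have n1 : 1 <= n%:R :> R by rewrite ler1n.
have nR0 : 0 < n%:R :> R by rewrite ltr0n.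
have lnn : 1 / 2 <= ln n%:R :> R by exact: ln_nat_ge.
have ln0 : 0 < ln n%:R :> R by rewrite (lt_le_trans _ lnn).
pose t := 1 + ln n%:R : R; have t1 : 1 <= t by rewrite lerDl ltW.
have t0 : 0 <= t by exact: le_trans t1.
have t3 : t <= 3 * ln n%:R by rewrite /t; lra.
(* Outside this ball all moments in use are O(n ^ - (m + 3)). *)
pose r := Kt * t; have r0 : 0 <= r by rewrite mulr_ge0.
pose tau := Ct / n%:R ^+ (m + 3).
have tailP := tail n n0; rewrite -/t -/r -/tau in tailP.
pose N := scale B k r.
have N_ge1 : 1 <= N by exact: scale_ge1.
have N_gt0 : 0 < N by exact: lt_le_trans N_ge1.
have r2t : 2 + r <= (2 + Kt) * t by rewrite /r mulrDl lerD2r ler_peMr.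
have r2 : 0 <= 2 + r by rewrite addr_ge0.
have Nle : N <= N1 * t ^+ k.+1.
  rewrite /N /scale /N1 -mulrA -exprMn ler_wpM2l// lerXn2r// nnegrE.
  exact: le_trans r2t.
have [net [Tnet netP]] := netc n n0.
pose nu j := phi_ (net j).
have Fnu j : F (nu j) by exists (net j).
pose delta := L * (m%:R / n%:R).
have delta0 : 0 <= delta by rewrite mulr_ge0// divr_ge0.
have closeF phi : F phi -> exists j, forall x, `|phi x - nu j x| <= delta * (1 + enorm x) ^+ k.
  move=> [th Tth <-]; have [j Hj] := netP th Tth; exists j => x.
  apply: (le_trans (hLip _ _ Tth (Tnet j) x)).
  rewrite ler_pM ?mulr_ge0 ?enorm_ge0 ?powR_ge0//; first by rewrite ler_wpM2l.
  by rewrite powR_le_expn// enorm1_ge1.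
(* The exponent of the concentration bound becomes - (m + 2) ln n, which beats the
   O(n ^ m) elements of the net. *)
pose s := Lam * N * (m.+2%:R * ln n%:R) / n%:R.
have s0 : 0 <= s.
  have h1 : 0 <= Lam * N by rewrite mulr_ge0// ltW.
  have h2 : 0 <= m.+2%:R * ln n%:R :> R by rewrite mulr_ge0// ltW.
  by rewrite divr_ge0// mulr_ge0.
have nX (i : nat) : 0 < n%:R ^+ i :> R by rewrite exprn_gt0.
have tau_le (i : nat) : (i <= m + 3)%N -> tau <= Ct / n%:R ^+ i.
  move=> im; rewrite /tau ler_wpM2l// lef_pV2 ?posrE ?nX//.
  by rewrite ler_weXn2l.
have Jle : #|{ffun 'I_m -> 'I_(c * n).+1}|%:R <= J1 * n%:R ^+ m :> R.
  rewrite card_ffun !card_ord natrX /J1 -exprMn lerXn2r ?nnegrE ?mulr_ge0//.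
  by rewrite -natrM ler_nat mulSn addnC -addn1 leq_add2l.
have taun : n%:R * tau <= Ct / n%:R ^+ m.+2.
  rewrite /tau addn3 exprS le_eqVlt; apply/orP; left; apply/eqP; field.
  by rewrite expf_neq0 ?gt_eqF.
pose E0 := expR (- (n%:R * s) / (Lam * N) + 5 * (n%:R * tau)).
have E0le : E0 <= expR (5 * Ct) / n%:R ^+ m.+2.
  rewrite /E0 expRD mulrC ler_pM ?expR_ge0//.
    rewrite ler_expR ler_wpM2l// (le_trans taun)// ler_pdivrMr// ler_peMr//.
    exact: exprn_ege1.
  rewrite -[X in _ <= X^-1]lnK ?posrE// -expRN ler_expR lnXn// /s -mulr_natl.
  rewrite le_eqVlt; apply/orP; left; apply/eqP; field.
  by rewrite !gt_eqF// (lt_le_trans ltr01).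
pose bet := #|{ffun 'I_m -> 'I_(c * n).+1}|%:R * E0 + n%:R * tau
  + #|{ffun 'I_m -> 'I_(c * n).+1}|%:R * (n%:R * tau).
have tau0 : 0 <= tau by rewrite divr_ge0// exprn_ge0.
have betle : bet <= b1 / n%:R ^+ 2.
  have e2 : n%:R ^+ m.+2 = n%:R ^+ m * n%:R ^+ 2 :> R by rewrite -exprD addn2.
  have aux (z w : R) : 0 <= w -> w <= z / n%:R ^+ m.+2 ->
      #|{ffun 'I_m -> 'I_(c * n).+1}|%:R * w <= J1 * z / n%:R ^+ 2.
    move=> w0 wz; apply: (@le_trans _ _ (J1 * n%:R ^+ m * (z / n%:R ^+ m.+2))).
      by rewrite ler_pM.
    rewrite e2 le_eqVlt; apply/orP; left; apply/eqP; field.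
    by rewrite expf_neq0 ?gt_eqF.
  rewrite /bet /b1 [leRHS]mulrDl [X in _ <= X + _]mulrDl; apply: lerD; first apply: lerD.
  - by apply: aux; [rewrite /E0 expR_ge0|exact: E0le].
  - apply: (le_trans taun); rewrite ler_wpM2l// lef_pV2 ?posrE//.
    by rewrite ler_weXn2l.
  - by apply: aux => //; rewrite mulr_ge0.
have Dle : delta * (2 + r) ^+ k <= L * m%:R * N / n%:R.
  rewrite /delta (_ : L * m%:R * N / n%:R = L * (m%:R / n%:R) * N); last by ring.
  rewrite ler_wpM2l// /N /scale.
  have r21 : 1 <= 2 + r by rewrite -addrA lerDl addr_ge0.
  rewrite (@le_trans _ _ ((2 + r) ^+ k.+1))//; first by rewrite ler_weXn2l.
  by rewrite ler_peMl// exprn_ge0.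
have sle : s <= Lam * m.+2%:R * N * t / n%:R.
  rewrite /s ler_wpM2r ?invr_ge0//.
  rewrite (_ : Lam * m.+2%:R * N * t = Lam * N * (m.+2%:R * t)); last by ring.
  apply: ler_wpM2l; first by rewrite mulr_ge0// ltW.
  by apply: ler_wpM2l => //; rewrite /t lerDr.
have tau1 : tau <= Ct / n%:R by have := tau_le 1%N; rewrite expr1; apply; rewrite addn3.
have const_le : N ^+ 2 * t * K2 <= N1 ^+ 2 * 3 ^+ q * K2 * ln n%:R `^ q%:R.
  rewrite powR_mulrn ?(ltW ln0)// [leRHS]mulrAC ler_wpM2r ?(ltW K20)//.
  rewrite [leRHS](_ : _ = N1 ^+ 2 * (3 * ln n%:R) ^+ q); last first.
    by rewrite -[LHS]mulrA; congr (_ * _); rewrite exprMn.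
  apply: (@le_trans _ _ (N1 ^+ 2 * t ^+ q)); last first.
    by rewrite ler_wpM2l ?sqr_ge0// lerXn2r ?nnegrE ?mulr_ge0 ?(ltW ln0).
  apply: (@le_trans _ _ ((N1 * t ^+ k.+1) ^+ 2 * t)).
    by apply: ler_wpM2r => //; rewrite lerXn2r// nnegrE ?(ltW N_gt0)// (le_trans _ Nle)// ltW.
  by rewrite exprMn -mulrA -exprM (mulnC k.+1) -exprSr.
apply: le_mul_ereal_inf.
  by rewrite mulr_gt0 ?powR_gt0// mulr_gt0// mulr_gt0 ?exprn_gt0.
move=> _ [psi [Fpsi sc] <-].
have H := oracle_inequality B_ge1 cphi0 hconv0 CPI0 r0 poinc polyL1 tailP lawQ d0
  halpha ha cF Fpsi sc n0 Fnu delta0 s0 closeF iid minim.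
apply: (le_trans H); rewrite (grad_dist2E cphi0 polyL1 cF Fpsi).
have g0 : 0 <= dist2 P phi0 psi by apply: expect_ge0 => x; exact: sqr_ge0.
rewrite -EFinD -EFinM lee_fin.
have HC := rate_collect halpha N_ge1 t1 n1 g0 Lm0 S0 Ct0 b10 C00 C20 Dle sle tau1 betle.
apply: (le_trans HC); rewrite -/K2 ler_wpM2r// addr_ge0// invr_ge0 ltW.
Qed.
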